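(* Let $T$ be an $m$-linear operator on $\mathbb{R}^d$, bounded $L^{r_1}\times\dots\times L^{r_m}\to L^\alpha$ for some $r_i,\alpha\ge 1$ with $\frac1{r_1}+\dots+\frac1{r_m}=\frac1\alpha$, given away from the diagonal by integration against a kernel $K$ that has a decomposition $K=\sum_{s\in\mathbb{Z}}K_s$ as described in the context, and suppose $C_T=C_T(r_1,\dots,r_m,\alpha) < \infty$. Let $\Lambda$ be the $(m+1)$-linear form associated to $T$, with truncations $\Lambda_\mu^\nu$. Assume there exist $1 \leq p_1,\dots,p_m, p_{m+1} \leq \infty$ and a positive constant $C_L$ such that the following estimates hold uniformly over all finite truncations, all dyadic lattices $\mathcal{D}$, and all stopping collections $\mathcal{P}$ (with top $Q$): for every $j\in\{1,\dots,m+1\}$, $$|\Lambda_{\mathcal{P}}(g_1,\dots,g_{j-1}, b, g_{j+1},\dots, g_{m+1})| \leq C_L\,|Q|\,\Big(\prod_{i<j}\|g_i\|_{\mathcal{Y}_{\infty}}\Big)\,\|b\|_{\dot{\mathcal{X}}_{p_j}}\,\Big(\prod_{i>j}\|g_i\|_{\mathcal{Y}_{p_i}}\Big)$$ for all $b\in\dot{\mathcal{X}}_{p_j}$, $g_i\in\mathcal{Y}_\infty$ ($i<j$), $g_i\in\mathcal{Y}_{p_i}$ ($i>j$). Let $\vec{p} = (p_1,\dots,p_{m+1})$. Then there is a constant $c_{d}$ depending on the dimension $d$ (for the fixed $m$) such that $$\sup_{\mu, \nu} |\Lambda_{\mu}^{\nu}(f_1,\dots,f_{m}, f_{m+1})|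 \leq c_{d}\left[C_{T} + C_{L}\right]\sup_{\mathcal{S}} \mathrm{PSF}_{\mathcal{S}}^{\vec{p}}(f_1,\dots,f_{m}, f_{m+1})$$ for all $f_{j} \in L^{p_{j}}(\mathbb{R}^{d})$ with compact support, where the supremum on the right is taken over all sparse collections $\mathcal{S}$ with some fixed sparsity constant that depends only on $d,m$.
   Context: Kernel decomposition. $K(x_1,\dots,x_{m+1})=\sum_{s\in\mathbb{Z}}K_s(x_1,\dots,x_{m+1})$, $x_i\in\mathbb{R}^d$, where on the support of $K_s$ we have $|x_k-x_l|\le 2^s$ for all $k,l$. For $1\le p\le\infty$ put $$[K]_{p} := \sup_{s \in \mathbb{Z}} 2^{\frac{mds}{p'}} \sup_{y \in \mathbb{R}^{d}}\sum_{k=1}^{m+1}\|K_{s}(\cdot+y,\dots,\cdot+y,\, y,\, \cdot + y, \dots , \cdot + y)\|_{L^{p}(\mathbb{R}^{md})},$$ where in the $k$-th summand $y$ is in the $k$-th slot and each dot denotes a separate variable in $\mathbb{R}^d$. It is a standing assumption that $[K]_p<\infty$ (for some $1\le p\le\infty$). Truncated forms. For finite truncations $-\infty<\mu<\nu<\infty$, $$\Lambda_\mu^\nu(f_1,\dots,f_{m+1})=\int_{\mathbb{R}^{(m+1)d}}\sum_{\mu<s<\nu}K_s(x_1,\dots,x_{m+1})f_1(x_1)\cdots f_{m+1}(x_{m+1})\,dx_1\cdots dx_{m+1},$$ $$C_T(r_1,\dots,r_m,\alpha)=\sup_{\mu,\nu}\|\Lambda_\mu^\nu\|_{L^{r_1}\times\dots\times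 L^{r_m}\times L^{\alpha'}\to\mathbb{C}}.$$ When $\mu,\nu$ are fixed one writes $\Lambda$ for $\Lambda_\mu^\nu$. Stopping collections. For a cube $L$, $s_L=\log_2(\text{side length of }L)$, $cL$ is the concentric $c$-fold dilate, $\hat L=2^5L$. Given a dyadic lattice $\mathcal{D}$ in $\mathbb{R}^d$ and $Q\in\mathcal{D}$, a collection $\mathcal{P}\subset\mathcal{D}$ of pairwise disjoint cubes is a stopping collection with top $Q$ if its elements are contained in $3Q$ and: (i) if $L,R\in\mathcal{P}$ and $|s_L-s_R|\ge 8$ then $7L\cap7R=\emptyset$; (ii) $\bigcup_{L\in\mathcal{P},\,3L\cap2Q\ne\emptyset}9L\subset\bigcup_{L\in\mathcal{P}}L$. Localized forms. For a cube $L$ let $\Lambda_L(f_1,\dots,f_{m+1})=\Lambda^{s_L}(f_1\mathbf{1}_L,f_2,\dots,f_{m+1})$, where $\Lambda^{s_L}$ is defined like $\Lambda_\mu^\nu$ but with only scales $s\le s_L$ (and $\mu<s<\nu$) kept; by the support condition $f_2,\dots,f_{m+1}$ may be replaced by $f_i\mathbf{1}_{3L}$. For a stopping collection $\mathcal{P}$ with top $Q$, $$\Lambda_{\mathcal{P}}(f_1,\dots,f_{m+1})=\Lambda_Q(f_1,\dots,f_{m+1})-\sum_{L\in\mathcal{P},\,L\subset Q}\Lambda_L(f_1,\dots,f_{m+1}).$$ Norms. $M_pf(x)=\sup_{x\in R}\big(\frac1{|R|}\int_R|f|^p\big)^{1/p}$ (sup over cubes $R\ni x$). For $\mathcal{P}$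 fixed, $$\|h\|_{\mathcal{Y}_p}=\max\Big(\|h\mathbf{1}_{\mathbb{R}^d\setminus\bigcup_{L\in\mathcal{P}}L}\|_\infty,\ \sup_{L\in\mathcal{P}}\inf_{x\in\hat L}M_ph(x)\Big)\ (p<\infty),\qquad \|h\|_{\mathcal{Y}_\infty}=\|h\|_\infty.$$ $\|b\|_{\mathcal{X}_p}$ denotes $\|b\|_{\mathcal{Y}_p}$ when $b=\sum_{L\in\mathcal{P}}b_L$ with $b_L$ supported on $L$; $\dot{\mathcal{X}}_p$ indicates that in addition $\int b_L=0$ for each $L$ (same norm). Sparse forms. A collection $\mathcal{S}$ of cubes is $\eta$-sparse if for each $Q\in\mathcal{S}$ there is $E_Q\subset Q$ with $|E_Q|\ge\eta|Q|$ and $E_Q\cap E_{Q'}=\emptyset$ for $Q\ne Q'$. $\mathrm{PSF}_{\mathcal{S}}^{\vec p}(f_1,\dots,f_{m+1})=\sum_{Q\in\mathcal{S}}|Q|\prod_{i=1}^{m+1}(f_i)_{p_i,Q}$, $(f)_{q,Q}=|Q|^{-1/q}\|f\mathbf{1}_Q\|_q$ (for $q=\infty$: $\|f\mathbf{1}_Q\|_\infty$). *)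

(* Defs.v *)
From HB Require Import structures.
From mathcomp Require Import all_boot all_order all_algebra.
From mathcomp Require Import complex.
From mathcomp Require Import all_classical all_reals all_analysis.

Set Implicit Arguments.
Unset Strict Implicit.
Unset Printing Implicit Defensive.

Import Order.TTheory GRing.Theory Num.Theory.
Import numFieldNormedType.Exports.

Local Open Scope classical_set_scope.
Local Open Scope ring_scope.

Section pow_measure.
Context {disp : measure_display} {T : measurableType disp} {R : realType}.

Definition tcons (n : nat) (x : T * n.-tuple T) : n.+1.-tuple T :=
  [tuple of x.1 :: x.2].

Lemma measurable_tcons (n : nat) :
  measurable_fun [set: T * n.-tuple T] (@tcons n).
Proof. exact: measurable_cons. Qed.

Section step.
Variables (n : nat) (mu : {sigma_finite_measure set T -> \bar R}).
Variable nu : {sigma_finite_measure set (n.-tuple T) -> \bar R}.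

Definition tcons_measure : set (n.+1.-tuple T) -> \bar R :=
  pushforward (mu \x nu)%E (@tcons n).

Let tcons_measure0 : tcons_measure set0 = 0%E.
Proof. by rewrite /tcons_measure /pushforward preimage_set0 measure0. Qed.

Let tcons_measure_ge0 A : (0 <= tcons_measure A)%E.
Proof. by rewrite /tcons_measure /pushforward; exact: measure_ge0. Qed.

Let tcons_measure_sigma_additive : semi_sigma_additive tcons_measure.
Proof.
move=> F mF tF mUF; rewrite /tcons_measure /pushforward preimage_bigcup.
apply: measure_semi_sigma_additive.
- by move=> k; rewrite -[X in measurable X]setTI; exact: measurable_tcons.
- apply/trivIsetP => /= i j _ _ ij; rewrite -preimage_setI.
  by move/trivIsetP : tF => /(_ _ _ _ _ ij) ->//; rewrite preimage_set0.
- rewrite -preimage_bigcup -[X in measurable X]setTI.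
  exact: measurable_tcons.
Qed.

HB.instance Definition _ := isMeasure.Build _ _ _ tcons_measure
  tcons_measure0 tcons_measure_ge0 tcons_measure_sigma_additive.

Let sigma_finite_prod : sigma_finite setT (mu \x nu)%E.
Proof.
have /sigma_finiteP[F [TF ndF Foo]] := sigma_finiteT mu.
have /sigma_finiteP[G [TG ndG Goo]] := sigma_finiteT nu.
exists (fun k => F k `*` G k).
  rewrite -setXTT TF TG predeqE => -[x y]; split.
    move=> [/= [i _ Fix] [k _ Gky]]; exists (maxn i k) => //; split.
    - by move: x Fix; exact/subsetPset/ndF/leq_maxl.
    - by move: y Gky; exact/subsetPset/ndG/leq_maxr.
  by move=> [k _ []/= ? ?]; split; exists k.
move=> k; have [? ?] := Foo k; have [? ?] := Goo k.
split; first exact: measurableX.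
by rewrite product_measure1E// lte_mul_pinfty// ge0_fin_numE.
Qed.

Let sigma_finite_tcons_measure : sigma_finite setT tcons_measure.
Proof.
have [F FT Foo] := sigma_finite_prod.
pose g (x : n.+1.-tuple T) : T * n.-tuple T := (thead x, [tuple of behead x]).
have gK : cancel g (@tcons n).
  by move=> x; rewrite [RHS]tuple_eta; exact: val_inj.
have Kg : cancel (@tcons n) g.
  by case=> x y; rewrite /g/tcons/= theadE; congr pair; exact: val_inj.
have mg : measurable_fun setT g.
  apply/measurable_fun_pairP; split => /=.
    exact: measurable_tnth.
  exact: measurable_behead.
exists (fun k => g @^-1` F k).
  by rewrite -preimage_bigcup -FT preimage_setT.
move=> k; have [mFk Fkoo] := Foo k; split.
  by rewrite -[X in measurable X]setTI; exact: mg.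
rewrite /tcons_measure /pushforward.
suff -> : @tcons n @^-1` (g @^-1` F k) = F k by [].
by apply/seteqP; split => x /=; rewrite Kg.
Qed.

HB.instance Definition _ := Measure_isSigmaFinite.Build _ _ _ tcons_measure
  sigma_finite_tcons_measure.

End step.

Fixpoint pow_measure (mu : {sigma_finite_measure set T -> \bar R}) (n : nat) :
    {sigma_finite_measure set (n.-tuple T) -> \bar R} :=
  match n with
  | 0 => (\d_([tuple] : 0.-tuple T) : set (0.-tuple T) -> \bar R)
  | k.+1 => tcons_measure mu (pow_measure mu k)
  end.

End pow_measure.


Section euclidean.
Context {R : realType}.

(* [measurableTypeR R] is [R] with its Borel sigma-algebra. *)
Definition Rd (d : nat) := d.-tuple (measurableTypeR R).

HB.instance Definition _ (d : nat) := Measurable.on (Rd d).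

Definition leb (d : nat) : {sigma_finite_measure set (Rd d) -> \bar R} :=
  pow_measure (@lebesgue_measure R) d.

Definition Rdn (d n : nat) := n.-tuple (Rd d).

HB.instance Definition _ (d n : nat) := Measurable.on (Rdn d n).

Definition lebn (d n : nat) : {sigma_finite_measure set (Rdn d n) -> \bar R} :=
  pow_measure (leb d) n.

Definition coord (d : nat) (x : Rd d) (a : 'I_d) : R := tnth x a.

Definition addv (d : nat) (x y : Rd d) : Rd d :=
  [tuple (coord x a + coord y a : R) | a < d].

Definition dist (d : nat) (x y : Rd d) : R :=
  Num.sqrt (\sum_(a < d) (coord x a - coord y a) ^+ 2).

Definition rowv (d : nat) (x : Rd d) : 'rV[R]_d := \row_a coord x a.

End euclidean.
Arguments Rd R d : clear implicits.
Arguments Rdn R d n : clear implicits.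

Section complex_functions.
Context {R : realType}.

Definition normc (z : R[i]) : R := ComplexField.Normc.normc z.

Section measure_space.
Context {disp : measure_display} {T : measurableType disp}.
Variable mu : {measure set T -> \bar R}.

Definition cmeasurable (f : T -> R[i]) : Prop :=
  measurable_fun setT (fun x => complex.Re (f x)) /\
  measurable_fun setT (fun x => complex.Im (f x)).

Definition cintegrable (f : T -> R[i]) : Prop :=
  mu.-integrable setT (fun x => (complex.Re (f x))%:E) /\
  mu.-integrable setT (fun x => (complex.Im (f x))%:E).

(* As for [Rintegral], a real or imaginary part whose integral is not finite
   contributes 0. *)
Definition cintegral (f : T -> R[i]) : R[i] :=
  Complex (\int[mu]_x complex.Re (f x)) (\int[mu]_x complex.Im (f x)).

Definition cLnorm (p : \bar R) (f : T -> R[i]) : \bar R :=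
  Lnorm mu p (fun x => (normc (f x))%:E).

Definition in_Lp (p : \bar R) (f : T -> R[i]) : Prop :=
  cmeasurable f /\ (cLnorm p f < +oo)%E.

End measure_space.

Definition cut {T : Type} (A : set T) (f : T -> R[i]) (x : T) : R[i] :=
  if x \in A then f x else 0.

Variable d : nat.

(* The support is taken in ['rV_d], which carries the usual topology of R^d. *)
Definition csupp (f : Rd R d -> R[i]) : set 'rV[R]_d :=
  closure [set rowv x | x in [set x | f x != 0]].

Definition compactly_supported (f : Rd R d -> R[i]) : Prop :=
  compact (csupp f).

End complex_functions.

Section cubes.
Context {R : realType}.
Variable d : nat.

(* The pair [(c, l)] stands for the half-open cube with lowest corner [c] and
   side length [l]; for [0 < d] distinct pairs give distinct sets. *)
Definition cube := (d.-tuple R * {posnum R})%type.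

HB.instance Definition _ := Choice.on cube.

Definition side (Q : cube) : R := Q.2%:num.

Definition corner (Q : cube) (a : 'I_d) : R := tnth Q.1 a.

Definition center (Q : cube) (a : 'I_d) : R := corner Q a + side Q / 2.

Definition cube_set (Q : cube) : set (Rd R d) :=
  [set x | forall a, corner Q a <= coord x a < corner Q a + side Q].

Definition dilate (t : R) (Q : cube) : set (Rd R d) :=
  [set x | forall a, center Q a - t * side Q / 2 <= coord x a
                     < center Q a + t * side Q / 2].

Definition scale (Q : cube) : R := ln (side Q) / ln 2.

Definition vol (Q : cube) : \bar R := leb d (cube_set Q).

Record dyadic_lattice (D : set cube) : Prop := {
  dyadic_side : forall Q, D Q -> exists k : int, side Q = 2 ^ k ;
  dyadic_nested : forall Q Q', D Q -> D Q' ->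
    [\/ cube_set Q `<=` cube_set Q', cube_set Q' `<=` cube_set Q
      | cube_set Q `&` cube_set Q' = set0] ;
  dyadic_cover : forall (k : int) (x : Rd R d),
    exists Q, [/\ D Q, side Q = 2 ^ k & cube_set Q x] }.

Definition shadow (P : set cube) : set (Rd R d) :=
  \bigcup_(L in P) cube_set L.

Record stopping_collection (D P : set cube) (Q : cube) : Prop := {
  stop_top : D Q ;
  stop_sub : P `<=` D ;
  stop_disjoint : forall L L', P L -> P L' -> L <> L' ->
    cube_set L `&` cube_set L' = set0 ;
  stop_in3Q : forall L, P L -> cube_set L `<=` dilate 3 Q ;
  stop_sep : forall L L', P L -> P L' -> 8 <= `|scale L - scale L'| ->
    dilate 7 L `&` dilate 7 L' = set0 ;
  stop_whitney :
    \bigcup_(L in [set L | P L /\ dilate 3 L `&` dilate 2 Q !=set0]) dilate 9 L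
    `<=` shadow P }.

Local Open Scope ereal_scope.

Definition maximal (p : R) (f : Rd R d -> R[i]) (x : Rd R d) : \bar R :=
  ereal_sup [set ((vol Q)^-1 *
      \int[leb d]_(y in cube_set Q) (normc (f y) `^ p)%:E) `^ p^-1%R
    | Q in [set Q | cube_set Q x]].

Definition Ynorm (P : set cube) (p : \bar R) (h : Rd R d -> R[i]) : \bar R :=
  if p == +oo then cLnorm (leb d) +oo h
  else maxe (cLnorm (leb d) +oo (cut (~` shadow P) h))
    (ereal_sup
      [set ereal_inf [set maximal (fine p) h x | x in dilate (2 ^+ 5)%R L]
      | L in P]).

Definition in_Y (P : set cube) (p : \bar R) (h : Rd R d -> R[i]) : Prop :=
  cmeasurable h /\ Ynorm P p h < +oo.

Definition in_Xdot (P : set cube) (p : \bar R) (b : Rd R d -> R[i]) : Prop :=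
  in_Y P p b /\
  exists bL : cube -> Rd R d -> R[i],
    (forall L, P L -> [/\ cmeasurable (bL L),
                          (forall x, bL L x != 0%R -> cube_set L x)
                        & cintegral (leb d) (bL L) = 0%R]) /\
    (forall x, b x = (\sum_(L \in P) bL L x)%R).

Definition sparse (eta : R) (S : set cube) : Prop :=
  exists E : cube -> set (Rd R d),
    (forall Q, S Q -> [/\ measurable (E Q), E Q `<=` cube_set Q
                        & eta%:E * vol Q <= leb d (E Q)]) /\
    (forall Q Q', S Q -> S Q' -> Q <> Q' -> E Q `&` E Q' = set0).

Definition avg (q : \bar R) (f : Rd R d -> R[i]) (Q : cube) : \bar R :=
  vol Q `^ (- fine q^-1)%R * cLnorm (leb d) q (cut (cube_set Q) f).

Definition PSF (n : nat) (S : set cube) (p : 'I_n -> \bar R)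
    (f : 'I_n -> Rd R d -> R[i]) : \bar R :=
  \esum_(Q in S) (vol Q * \prod_(i < n) avg (p i) (f i) Q).

End cubes.
Arguments cube R d : clear implicits.

Section forms.
Context {R : realType}.
Variables d m : nat.

Definition tensor (f : 'I_m.+1 -> Rd R d -> R[i]) (x : Rdn R d m.+1) : R[i] :=
  \prod_(i < m.+1) f i (tnth x i).

(* The last slot of an (m+1)-tuple of functions is the dual one. *)
Definition init_fun {A : Type} (f : 'I_m.+1 -> A) (i : 'I_m) : A :=
  f (lift ord_max i).

Definition multilinear_on (r : 'I_m -> \bar R)
    (T : ('I_m -> Rd R d -> R[i]) -> Rd R d -> R[i]) : Prop :=
  forall (i : 'I_m) (w : 'I_m -> Rd R d -> R[i]) (a : R[i])
      (u v : Rd R d -> R[i]),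
    (forall j, in_Lp (leb d) (r j) (w j)) ->
    in_Lp (leb d) (r i) u -> in_Lp (leb d) (r i) v ->
    {ae leb d, forall x, T (dfwith w i (fun y => a * u y + v y)) x =
      a * T (dfwith w i u) x + T (dfwith w i v) x}.

Definition bounded_on (r : 'I_m -> \bar R) (alpha : \bar R)
    (T : ('I_m -> Rd R d -> R[i]) -> Rd R d -> R[i]) : Prop :=
  exists A : R, forall f : 'I_m -> Rd R d -> R[i],
    (forall i, in_Lp (leb d) (r i) (f i)) ->
    cmeasurable (T f) /\
    (cLnorm (leb d) alpha (T f) <=
       A%:E * \prod_(i < m) cLnorm (leb d) (r i) (f i))%E.

Definition assoc_form (T : ('I_m -> Rd R d -> R[i]) -> Rd R d -> R[i])
    (f : 'I_m.+1 -> Rd R d -> R[i]) : R[i] :=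
  cintegral (leb d) (fun x => T (init_fun f) x * f ord_max x).

(* "Away from the diagonal": the supports have no common point, i.e. the
   product of the supports misses the diagonal x_1 = ... = x_{m+1}. *)
Definition kernel_of (T : ('I_m -> Rd R d -> R[i]) -> Rd R d -> R[i])
    (K : Rdn R d m.+1 -> R[i]) : Prop :=
  cmeasurable K /\
  forall f : 'I_m.+1 -> Rd R d -> R[i],
    (forall i, in_Lp (leb d) +oo (f i) /\ compactly_supported (f i)) ->
    \bigcap_(i in [set: 'I_m.+1]) csupp (f i) = set0 ->
    cintegrable (lebn d m.+1) (fun x => K x * tensor f x) /\
    assoc_form T f = cintegral (lebn d m.+1) (fun x => K x * tensor f x).

(* On the diagonal every scale may contribute, whence the a.e. statement. *)
Definition kernel_decomposition (K : Rdn R d m.+1 -> R[i])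
    (Ks : int -> Rdn R d m.+1 -> R[i]) : Prop :=
  [/\ forall s, cmeasurable (Ks s),
      forall s x, Ks s x != 0 ->
        forall k l : 'I_m.+1, dist (tnth x k) (tnth x l) <= 2 ^ s
    & {ae lebn d m.+1, forall x,
        (fun N : nat => normc
          (\sum_(s \in [set s : int | (absz s <= N)%N]) Ks s x - K x))
        @ \oo --> (0 : R)}].

Definition put_slot (k : 'I_m.+1) (y : Rd R d) (z : Rdn R d m) :
    Rdn R d m.+1 :=
  [tuple (if unlift k i is Some j then addv (tnth z j) y else y) | i < m.+1].

Definition kernel_size (Ks : int -> Rdn R d m.+1 -> R[i]) (q : \bar R) :
    \bar R :=
  ereal_sup [set
    ((2 `^ ((m * d)%:R * s%:~R * fine (hoelder_conjugate q)^-1))%:E *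
     ereal_sup [set \sum_(k < m.+1)
         cLnorm (lebn d m) q (fun z => Ks s (put_slot k y z))
       | y in [set: Rd R d]])%E
  | s in [set: int]].

Definition scale_form (Ks : int -> Rdn R d m.+1 -> R[i]) (A : set int)
    (f : 'I_m.+1 -> Rd R d -> R[i]) : R[i] :=
  cintegral (lebn d m.+1) (fun x => (\sum_(s \in A) Ks s x) * tensor f x).

Definition trunc_form (Ks : int -> Rdn R d m.+1 -> R[i]) (mu nu : int) :=
  scale_form Ks [set s : int | mu < s < nu].

Definition form_norm (q : 'I_m.+1 -> \bar R)
    (Lam : ('I_m.+1 -> Rd R d -> R[i]) -> R[i]) : \bar R :=
  ereal_sup [set (normc (Lam f))%:E | f in
    [set f | forall i, cmeasurable (f i) /\
                       (cLnorm (leb d) (q i) (f i) <= 1)%E]].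

Definition CT (Ks : int -> Rdn R d m.+1 -> R[i]) (r : 'I_m -> \bar R)
    (alpha : \bar R) : \bar R :=
  ereal_sup [set form_norm
      (fun i => if unlift ord_max i is Some j then r j
                else hoelder_conjugate alpha)
      (trunc_form Ks munu.1 munu.2)
    | munu in [set munu : int * int | munu.1 < munu.2]].

Definition local_form (Ks : int -> Rdn R d m.+1 -> R[i]) (mu nu : int)
    (L : cube R d) (f : 'I_m.+1 -> Rd R d -> R[i]) : R[i] :=
  scale_form Ks [set s : int | mu < s < nu /\ s%:~R <= scale L]
    (dfwith f ord0 (cut (cube_set L) (f ord0))).

(* The sum has finitely many nonzero terms: only cubes of scale above [mu]
   contribute. *)
Definition stopping_form (Ks : int -> Rdn R d m.+1 -> R[i]) (mu nu : int)
    (P : set (cube R d)) (Q : cube R d) (f : 'I_m.+1 -> Rd R d -> R[i]) :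
    R[i] :=
  local_form Ks mu nu Q f -
  \sum_(L \in [set L | P L /\ cube_set L `<=` cube_set Q])
    local_form Ks mu nu L f.

End forms.

(* Main.v *)
(* Given a bounded tuple f and a dyadic cube Q, let a_i be the L^{p_i} average of
   f_i over 3Q, and let E be the set where some maximal average of f_i 1_{3Q}
   exceeds a large multiple of a_i. By the weak-type bound E is small, and the
   maximal dyadic cubes whose ninefold dilates lie in E form a stopping
   collection P. Splitting f_i 1_{3Q} = g_i + b_i into the cell averages over P
   and the remainder, the form with all g_i is bounded by C_T and each remaining
   term of the telescoping expansion by the hypothesis, so that the stopping form
   is at most C (C_T + C_L) |3Q| a_1 ... a_{m+1}. What is left is a sum of
   local forms over the cubes of P inside Q, which occupy at most half of Q.
   Iterate: the scales are bounded below, so the process stops, and the selected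
   cubes, once tripled, form a sparse family. General f follow by truncation. *)
Require Import Defs.
From HB Require Import structures.
From mathcomp Require Import all_boot all_order all_algebra.
From mathcomp Require Import complex.
From mathcomp Require Import all_classical all_reals all_analysis.
From mathcomp Require Import ring lra zify.
From mathcomp Require Import finmap measurable_realfun ess_sup_inf.
Import Defs.

Set Implicit Arguments.
Unset Strict Implicit.
Unset Printing Implicit Defensive.

Import Order.TTheory GRing.Theory Num.Theory.
Import numFieldNormedType.Exports.

Local Open Scope classical_set_scope.
Local Open Scope ring_scope.

(** * Product measures, translations and cubes *)

Section pow_measure_theory.
Context {disp : measure_display} {T : measurableType disp} {R : realType}.
Local Open Scope ereal_scope.

(** The splitting of [f_i 1_{3Q}] leaves no remainder only if the stopping cubes tile [3Q]; then
    [b_i] is exactly a sum of mean-zero pieces. The set [E] provides no such tiling, so grid cubes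
    of one low level fill the gaps; their local forms vanish because their scales lie below [mu].
    Replacing slots from left to right leaves cell averages before slot [j], a bad part in it and
    untouched functions after it, which are the three kinds of norms in the hypothesis.

    The size of [E] is tuned so that a cube whose ninefold dilate lies in [E] is at least [2 ^ 6]
    times smaller than [Q]. This keeps the dilates required by the covering condition inside [3Q].

    Integrals are total, a part without finite integral counting as 0, so a form is additive only
    where absolute convergence is known. It is known for bounded functions whose first member is cut
    to a cube, and the recursion runs on these alone. A vanishing average gives no threshold to stop
    at; the form is then shown to be 0 directly. The origin of the grid is free, so that one cube
    can hold the support of the first function. *)

Definition box {n : nat} (B : 'I_n -> set T) : set (n.-tuple T) :=
  [set x | forall i, B i (tnth x i)].

Lemma measurable_box (n : nat) (B : 'I_n -> set T) :
  (forall i, measurable (B i)) -> measurable (box B).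
Proof.
move=> mB.
have -> : box B = \bigcap_(i in [set: 'I_n]) ((@tnth n T ^~ i) @^-1` B i).
  by apply/seteqP; split=> x /= h i; [move=> _; exact: h|exact: (h i Logic.I)].
apply: fin_bigcap_measurable => // i _.
have := @measurable_tnth _ T n i measurableT (B i) (mB i).
by rewrite setTI.
Qed.

Lemma tnth_tcons0 (n : nat) (z : T * n.-tuple T) : tnth (tcons z) ord0 = z.1.
Proof. by []. Qed.

Lemma tnth_tconsS (n : nat) (z : T * n.-tuple T) (i : 'I_n) :
  tnth (tcons z) (lift ord0 i) = tnth z.2 i.
Proof. by rewrite (tnth_nth z.1) /= -tnth_nth. Qed.

Lemma pow_measure_box (mu : {sigma_finite_measure set T -> \bar R}) (n : nat)
    (B : 'I_n -> set T) :
  (forall i, measurable (B i)) ->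
  pow_measure mu n (box B) = \prod_(i < n) mu (B i).
Proof.
elim: n B => [|n IH] B mB.
  by rewrite big_ord0 /= diracE mem_set// => -[].
rewrite big_ord_recl -IH//= /tcons_measure /pushforward.
rewrite -product_measure1E//; last exact: measurable_box.
congr (_ _); apply/seteqP; split=> -[x y] /=.
  move=> h; split; first exact: (h ord0).
  by move=> i; have := h (lift ord0 i); rewrite tnth_tconsS.
move=> [/= h0 h] i; case: (unliftP ord0 i) => [j|] ->; last exact: h0.
by rewrite tnth_tconsS; exact: h.
Qed.

Lemma ge0_integral_pow_measureS (mu : {sigma_finite_measure set T -> \bar R})
    (n : nat) (F : n.+1.-tuple T -> \bar R) :
  measurable_fun [set: n.+1.-tuple T] F -> (forall x, 0 <= F x) ->
  \int[pow_measure mu n.+1]_x F x =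
  \int[mu]_x \int[pow_measure mu n]_y F (tcons (x, y)).
Proof.
move=> mF F0.
rewrite /= (ge0_integral_pushforward (@measurable_tcons _ T n))//=.
rewrite preimage_setT fubini_tonelli1//=.
by apply: measurableT_comp => //; exact: measurable_tcons.
Qed.

(** Invariance is stated for integrals of nonnegative functions, not for measures of sets, so that
    it passes through Tonelli's formula one coordinate at a time. *)
Definition preserves_integral (mu : {measure set T -> \bar R}) (h : T -> T) :=
  measurable_fun setT h /\
  forall F : T -> \bar R, measurable_fun setT F -> (forall x, 0 <= F x) ->
    \int[mu]_x F (h x) = \int[mu]_x F x.

End pow_measure_theory.

(** Each coordinate is moved by its own parameter. Scalars acting on [R] give the translations of
    [R^d]; vectors acting on [R^d] serve its powers, where all parameters are then taken equal. *)
Definition tuple_act {A T : Type} {n : nat} (act : A -> T -> T)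
  (a : n.-tuple A) (x : n.-tuple T) : n.-tuple T :=
  [tuple act (tnth a i) (tnth x i) | i < n].

Lemma tuple_act_tcons {A : Type} {disp} {T : measurableType disp} (n : nat)
    (act : A -> T -> T) (a : A) (b : n.-tuple A)
    (z : T * n.-tuple T) :
  tuple_act act [tuple of a :: b] (tcons z) =
  tcons (act a z.1, tuple_act act b z.2).
Proof.
apply: eq_from_tnth => i; rewrite tnth_mktuple.
case: (unliftP ord0 i) => [j|] -> //.
rewrite !tnth_tconsS tnth_mktuple; congr act.
by rewrite (tnth_nth a)/= -tnth_nth.
Qed.

Lemma pow_measure_preserves {A : Type} {disp} {T : measurableType disp}
    {R : realType} (mu : {sigma_finite_measure set T -> \bar R})
    (act : A -> T -> T) (n : nat) (a : n.-tuple A) :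
  (forall b, preserves_integral mu (act b)) ->
  preserves_integral (pow_measure mu n) (tuple_act act a).
Proof.
move=> hact.
have mact k (b : k.-tuple A) : measurable_fun [set: k.-tuple T] (@tuple_act A T k act b).
  apply/measurable_fun_tnthP => i.
  have -> : (@tnth k T ^~ i) \o tuple_act act b =
            act (tnth b i) \o (@tnth k T ^~ i).
    by apply/funext => x /=; rewrite tnth_mktuple.
  apply: measurableT_comp; first exact: (hact _).1.
  exact: measurable_tnth.
split; first exact: mact.
elim: n a => [|n IH] a F mF F0.
  congr (integral _ _ _); apply/funext => x; congr F.
  by rewrite [LHS]tuple0 [RHS]tuple0.
case/tupleP: a => b a.
have mFa : measurable_fun [set: n.+1.-tuple T]
    (F \o tuple_act act [tuple of b :: a]).
  by apply: measurableT_comp => //; exact: mact.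
rewrite [LHS](ge0_integral_pow_measureS mu mFa)//= ge0_integral_pow_measureS//.
under eq_integral => x _ do under eq_integral => y _ do rewrite tuple_act_tcons/=.
have mFc : measurable_fun [set: T * n.-tuple T] (F \o @tcons _ T n).
  by apply: measurableT_comp => //; exact: measurable_tcons.
have mc x : measurable_fun [set: n.-tuple T] (fun y => F (tcons (x, y))).
  have -> : (fun y => F (tcons (x, y))) = (F \o @tcons _ T n) \o (pair x) by [].
  by apply: measurableT_comp => //; exact: pair1_measurable.
under eq_integral => x _ do rewrite (IH a (fun y => F (tcons (act b x, y))))//.
rewrite ((hact b).2 (fun x => \int[pow_measure mu n]_y F (tcons (x, y))))%E//.
  exact: (measurable_fun_fubini_tonelli_F
    (fun z : T * n.-tuple T => F (tcons z)) mFc).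
by move=> x; apply: integral_ge0 => y _; exact: F0.
Qed.

Section euclidean_theory.
Context {R : realType}.
Implicit Types d m : nat.

Lemma shift_preserves (b : R) :
  preserves_integral (@lebesgue_measure R)
    ((fun x => x + b) : measurableTypeR R -> measurableTypeR R).
Proof.
have mb : measurable_fun setT
    ((fun x => x + b) : measurableTypeR R -> measurableTypeR R).
  by apply: measurable_funD => //; exact: measurable_id.
split=> // F mF F0.
have E : forall A, measurable A -> lebesgue_measure A =
   pushforward (@lebesgue_measure R)
     ((fun x => x + b) : measurableTypeR R -> measurableTypeR R) A.
  pose mu' := measure_function_pushforward__canonical__measure_function_Measure
    (@lebesgue_measure R) mb.
  apply: (lebesgue_measure_unique (mu := mu')) => _ [[u v]] _ <-.
  rewrite /mu' /= /pushforward.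
  have -> : (fun x : R => x + b) @^-1` `]u, v]%classic =
            `]u - b, v - b]%classic.
    by apply/seteqP; split=> x /=; rewrite !in_itv/= ltrBlDr lerBrDr.
  rewrite !lebesgue_measure_itv/= !lte_fin ltrD2r.
  by case: ifP => // _; congr (_%:E); rewrite opprB addrA subrK.
rewrite [RHS](eq_measure_integral _ (fun A mA _ => E A mA)).
by rewrite ge0_integral_pushforward//= preimage_setT.
Qed.

Lemma addv_preserves d (y : Rd R d) :
  preserves_integral (leb d) (fun x => addv x y).
Proof.
exact: (@pow_measure_preserves R _ _ R (@lebesgue_measure R)
  (fun b t => t + b) d y shift_preserves).
Qed.

Definition addvs d m (z : Rdn R d m) (y : Rd R d) : Rdn R d m :=
  [tuple addv (tnth z j) y | j < m].

Lemma addvs_preserves d m (y : Rd R d) :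
  preserves_integral (lebn d m) (fun z => addvs z y).
Proof.
have := @pow_measure_preserves _ _ _ R (leb d)
  (fun y x => addv x y) m [tuple y | _ < m] (@addv_preserves d).
have -> // : tuple_act (fun y x => addv x y) [tuple y | _ < m] =
          (fun z : Rdn R d m => addvs z y).
apply/funext => z.
by apply: eq_from_tnth => i; rewrite !tnth_mktuple.
Qed.

Lemma put_slot0 d m (y : Rd R d) (z : Rdn R d m) :
  put_slot ord0 y z = tcons (y, addvs z y).
Proof.
apply: eq_from_tnth => i; rewrite tnth_mktuple.
case: (unliftP ord0 i) => [j|] -> //.
by rewrite tnth_tconsS tnth_mktuple.
Qed.

Lemma dist_coord d (x y : Rd R d) (a : 'I_d) :
  `|coord x a - coord y a| <= dist x y.
Proof.
rewrite /dist -sqrtr_sqr; apply: ler_wsqrtr.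
by rewrite (bigD1 a)//= lerDl sumr_ge0// => i _; exact: sqr_ge0.
Qed.

Lemma coord_addv d (x y : Rd R d) a : coord (addv x y) a = coord x a + coord y a.
Proof. by rewrite /coord tnth_mktuple. Qed.

Section cubes.
Variable d : nat.
Implicit Types Q L : cube R d.

Lemma cube_setE Q : cube_set Q =
  box (fun a => `[corner Q a, corner Q a + side Q[%classic : set (measurableTypeR R)).
Proof.
by apply/seteqP; split=> x /= h a; have := h a; rewrite /= in_itv.
Qed.

Lemma measurable_cube Q : measurable (cube_set Q).
Proof. by rewrite cube_setE; exact: (measurable_box (fun a => measurable_itv _)). Qed.

Lemma side_gt0 Q : 0 < side Q.
Proof. by rewrite /side. Qed.

Lemma volE Q : vol Q = (side Q ^+ d)%:E.
Proof.
rewrite /vol cube_setE /leb pow_measure_box => [|a]; last exact: measurable_itv.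
rewrite (eq_bigr (fun=> (side Q)%:E)) => [|a _].
  by rewrite prodEFin prodr_const card_ord.
by rewrite [LHS]lebesgue_measure_itv/= lte_fin ltrDl side_gt0 -EFinD addrAC subrr add0r.
Qed.

(** The dilate as a cube in its own right, so that volumes, averages and bounds over arbitrary cubes
    apply to it. *)
Definition dilc (t : {posnum R}) Q : cube R d :=
  ([tuple (center Q a - t%:num * side Q / 2 : R) | a < d], (t%:num * Q.2%:num)%:pos).

Lemma side_dilc t Q : side (dilc t Q) = t%:num * side Q.
Proof. by []. Qed.

Lemma corner_dilc t Q a : corner (dilc t Q) a = center Q a - t%:num * side Q / 2.
Proof. by rewrite /corner tnth_mktuple. Qed.

Lemma dilateE t Q : dilate t%:num Q = cube_set (dilc t Q).
Proof.
have E a : center Q a - t%:num * side Q / 2 + t%:num * side Q =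
  center Q a + t%:num * side Q / 2.
  by rewrite [X in _ + X]splitr addrA subrK.
by apply/seteqP; split=> x h a; have := h a; rewrite corner_dilc side_dilc E.
Qed.

Lemma measurable_dilate (t : R) Q : 0 < t -> measurable (dilate t Q).
Proof. by move=> t0; rewrite (dilateE (PosNum t0)); exact: measurable_cube. Qed.

Lemma leb_dilate (t : R) Q : 0 < t ->
  leb d (dilate t Q) = ((t * side Q) ^+ d)%:E.
Proof. by move=> t0; rewrite (dilateE (PosNum t0)) -/(vol _) volE. Qed.

End cubes.
End euclidean_theory.

(** * Complex-valued functions *)

Section complex_modulus.
Context {R : realType}.
Implicit Types z w : R[i].

Lemma ReD z w : complex.Re (z + w) = complex.Re z + complex.Re w.
Proof. by case: z; case: w. Qed.

Lemma ImD z w : complex.Im (z + w) = complex.Im z + complex.Im w.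
Proof. by case: z; case: w. Qed.

Lemma ReN z : complex.Re (- z) = - complex.Re z.
Proof. by case: z. Qed.

Lemma ImN z : complex.Im (- z) = - complex.Im z.
Proof. by case: z. Qed.

Lemma ReM z w : complex.Re (z * w) =
  complex.Re z * complex.Re w - complex.Im z * complex.Im w.
Proof. by case: z; case: w. Qed.

Lemma ImM z w : complex.Im (z * w) =
  complex.Re z * complex.Im w + complex.Im z * complex.Re w.
Proof. by case: z; case: w. Qed.

Lemma normcE z : normc z = Num.sqrt (complex.Re z ^+ 2 + complex.Im z ^+ 2).
Proof. by case: z. Qed.

Lemma normc_ge0 z : 0 <= normc z.
Proof. by rewrite normcE sqrtr_ge0. Qed.

Lemma normc0 : normc (0 : R[i]) = 0.
Proof. exact: ComplexField.Normc.normc0. Qed.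

Lemma normc1 : normc (1 : R[i]) = 1.
Proof. exact: ComplexField.Normc.normc1. Qed.

Lemma normc_eq0 z : (normc z == 0) = (z == 0).
Proof.
apply/eqP/eqP => [|->]; last exact: normc0.
exact: ComplexField.Normc.eq0_normc.
Qed.

Lemma normcM z w : normc (z * w) = normc z * normc w.
Proof. exact: ComplexField.Normc.normcM. Qed.

Lemma normcN z : normc (- z) = normc z.
Proof. by rewrite !normcE ReN ImN !sqrrN. Qed.

Lemma normc_real (a : R) : normc (a%:C)%C = `|a|.
Proof. by rewrite normcE /= expr0n/= addr0 sqrtr_sqr. Qed.

Lemma le_normcD z w : normc (z + w) <= normc z + normc w.
Proof. exact: le_normcD. Qed.

Lemma normc_sum (I : Type) (s : seq I) (P : pred I) (F : I -> R[i]) :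
  normc (\sum_(i <- s | P i) F i) <= \sum_(i <- s | P i) normc (F i).
Proof.
elim/big_ind2: _ => [|x1 x2 y1 y2 h1 h2|i _ //]; first by rewrite normc0.
by rewrite (le_trans (le_normcD _ _))// lerD.
Qed.

Lemma normc_prod (I : Type) (s : seq I) (P : pred I) (F : I -> R[i]) :
  normc (\prod_(i <- s | P i) F i) = \prod_(i <- s | P i) normc (F i).
Proof. by apply: big_morph; [exact: normcM|exact: normc1]. Qed.

Lemma normr_Re_le z : `|complex.Re z| <= normc z.
Proof. by rewrite normcE -sqrtr_sqr ler_wsqrtr// lerDl sqr_ge0. Qed.

Lemma normr_Im_le z : `|complex.Im z| <= normc z.
Proof. by rewrite normcE -sqrtr_sqr ler_wsqrtr// lerDr sqr_ge0. Qed.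

Lemma normc_le_ReIm z : normc z <= `|complex.Re z| + `|complex.Im z|.
Proof.
rewrite normcE -[leRHS]ger0_norm; last by rewrite addr_ge0.
rewrite -sqrtr_sqr ler_wsqrtr// sqrrD !real_normK ?num_real//.
by rewrite addrAC lerDl mulrn_wge0 ?mulr_ge0.
Qed.

End complex_modulus.

Section complex_integral.
Context {R : realType} {disp : measure_display} {T : measurableType disp}.
Implicit Types f g : T -> R[i].

Lemma cmeasurable_cst (a : R[i]) : cmeasurable (fun _ : T => a).
Proof. by split; exact: measurable_cst. Qed.

Lemma cmeasurableD f g :
  cmeasurable f -> cmeasurable g -> cmeasurable (fun x => f x + g x).
Proof.
move=> [rf If] [rg Ig]; split.
  by under eq_fun do rewrite ReD; exact: measurable_funD.
by under eq_fun do rewrite ImD; exact: measurable_funD.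
Qed.

Lemma cmeasurableN f : cmeasurable f -> cmeasurable (fun x => - f x).
Proof.
move=> [rf If]; split.
  by under eq_fun do rewrite ReN; exact: measurableT_comp.
by under eq_fun do rewrite ImN; exact: measurableT_comp.
Qed.

Lemma cmeasurableM f g :
  cmeasurable f -> cmeasurable g -> cmeasurable (fun x => f x * g x).
Proof.
move=> [rf If] [rg Ig]; split.
  by under eq_fun do rewrite ReM; apply: measurable_funB; exact: measurable_funM.
by under eq_fun do rewrite ImM; apply: measurable_funD; exact: measurable_funM.
Qed.

Lemma cmeasurable_sum (I : Type) (s : seq I) (F : I -> T -> R[i]) :
  (forall i, cmeasurable (F i)) -> cmeasurable (fun x => \sum_(i <- s) F i x).
Proof.
move=> mF; elim: s => [|i s IH].
  by under eq_fun do rewrite big_nil; exact: cmeasurable_cst.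
by under eq_fun do rewrite big_cons; exact: cmeasurableD.
Qed.

Lemma cmeasurable_prod (I : Type) (s : seq I) (F : I -> T -> R[i]) :
  (forall i, cmeasurable (F i)) -> cmeasurable (fun x => \prod_(i <- s) F i x).
Proof.
move=> mF; elim: s => [|i s IH].
  by under eq_fun do rewrite big_nil; exact: cmeasurable_cst.
by under eq_fun do rewrite big_cons; exact: cmeasurableM.
Qed.

Lemma cmeasurable_comp {d2} {T2 : measurableType d2} (h : T2 -> T) f :
  measurable_fun setT h -> cmeasurable f -> cmeasurable (f \o h).
Proof. by move=> mh [rf If]; split; [exact: (measurableT_comp rf mh)|exact: (measurableT_comp If mh)].
Qed.

Lemma cmeasurable_cut (A : set T) f :
  measurable A -> cmeasurable f -> cmeasurable (cut A f).
Proof.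
move=> mA mf.
have -> : cut A f = fun x => ((\1_A x)%:C)%C * f x.
  apply/funext => x; rewrite /cut indicE.
  by case: ifPn => xA; rewrite ?mul1r ?mul0r.
apply: cmeasurableM => //; split; last exact: measurable_cst.
by apply: (eq_measurable_fun (\1_A : T -> R)) => //; exact: measurable_indic.
Qed.

Lemma measurable_normc f : cmeasurable f -> measurable_fun setT (normc \o f).
Proof.
move=> [rf If].
have -> : normc \o f = (@powR R ^~ 2^-1) \o
    (fun x => complex.Re (f x) ^+ 2 + complex.Im (f x) ^+ 2).
  by apply/funext => x /=; rewrite normcE powR12_sqrt// addr_ge0 ?sqr_ge0.
apply: measurableT_comp; first exact: measurable_powR.
by apply: measurable_funD; exact: measurable_funX.
Qed.

Lemma measurable_normc_powR f (p : R) :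
  cmeasurable f -> measurable_fun setT (fun x => (normc (f x) `^ p)%:E).
Proof.
move=> mf; apply/measurable_EFinP.
apply: (measurableT_comp (measurable_powR p)); exact: measurable_normc.
Qed.

Lemma cutT f (A : set T) x : A x -> cut A f x = f x.
Proof. by move=> Ax; rewrite /cut mem_set. Qed.

Lemma cutF f (A : set T) x : ~ A x -> cut A f x = 0.
Proof. by move=> Ax; rewrite /cut memNset. Qed.

Lemma normc_cut (A : set T) f x : normc (cut A f x) <= normc (f x).
Proof. by rewrite /cut; case: ifP => // _; rewrite normc0 normc_ge0. Qed.

Variable mu : {measure set T -> \bar R}.

Lemma cintegrable_dom f (g : T -> R) : cmeasurable f ->
  mu.-integrable setT (EFin \o g) -> (forall x, normc (f x) <= g x) ->
  cintegrable mu f.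
Proof.
move=> [rf If] ig fg.
have ng x : normc (f x) <= `|g x| by rewrite (le_trans (fg x))// ler_norm.
split; apply: le_integrable ig => //; try exact/measurable_EFinP.
  by move=> x _; rewrite /= lee_fin (le_trans (normr_Re_le _)).
by move=> x _; rewrite /= lee_fin (le_trans (normr_Im_le _)).
Qed.

Lemma cintegralD f g : cintegrable mu f -> cintegrable mu g ->
  cintegral mu (fun x => f x + g x) = cintegral mu f + cintegral mu g.
Proof.
move=> [rf If] [rg Ig]; rewrite /cintegral.
under eq_Rintegral do rewrite ReD.
under [X in Complex _ X]eq_Rintegral do rewrite ImD.
by rewrite !RintegralD.
Qed.

Lemma cintegral_scale (a : R) f : cintegrable mu f ->
  cintegral mu (fun x => (a%:C)%C * f x) = (a%:C)%C * cintegral mu f.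
Proof.
move=> [rf If]; rewrite /cintegral.
under eq_Rintegral do rewrite ReM/= mul0r subr0.
under [X in Complex _ X]eq_Rintegral do rewrite ImM/= mul0r addr0.
rewrite !RintegralZl//.
by apply/eqP; rewrite eq_complex /= !mul0r subr0 addr0 !eqxx.
Qed.

Lemma eq_cintegral f g : f =1 g -> cintegral mu f = cintegral mu g.
Proof. by move=> /funext ->. Qed.

Lemma cintegral0 : cintegral mu (fun=> 0) = 0.
Proof. by rewrite /cintegral /= !Rintegral_cst// !mul0r. Qed.

End complex_integral.

(** * Integrability of the kernel against bounded functions *)

Section kernel_integrability.
Context {R : realType} {d m : nat}.
Variable Ks : int -> Rdn R d m.+1 -> R[i].
Hypothesis mKs : forall s, cmeasurable (Ks s).
Hypothesis supp_Ks : forall s x, Ks s x != 0 ->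
  forall k l : 'I_m.+1, dist (tnth x k) (tnth x l) <= 2 ^ s.
Local Open Scope ereal_scope.

(** The weight of scale [s] is a positive real, so an infinite supremum over [y] would make the
    whole size infinite. Only the slot [ord0] is kept, the one in which local forms cut their
    argument. *)
Lemma kernel_size_slice (q : \bar R) (s : int) : kernel_size Ks q < +oo ->
  exists N : R, (0 <= N)%R /\ forall y : Rd R d,
    cLnorm (lebn d m) q (fun z => Ks s (put_slot ord0 y z)) <= N%:E.
Proof.
move=> Kq.
have sumge0 y : 0 <= \sum_(k < m.+1)
    cLnorm (lebn d m) q (fun z => Ks s (put_slot k y z)).
  by apply: sume_ge0 => k _; exact: Lnorm_ge0.
pose a : \bar R := ereal_sup [set \sum_(k < m.+1)
         cLnorm (lebn d m) q (fun z => Ks s (put_slot k y z))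
       | y in [set: Rd R d]].
have y0 : Rd R d by exact: [tuple (0%R : R) | _ < d].
have a0 : 0 <= a.
  apply: le_trans (sumge0 y0) _; apply: ereal_sup_ubound.
  by exists y0.
have : a < +oo.
  rewrite ltey; apply/eqP => ay; move: Kq; rewrite ltNge => /negP; apply.
  apply: (@le_trans _ _ ((2 `^ ((m * d)%:R * s%:~R *
      fine (hoelder_conjugate q)^-1))%:E * a)).
    by rewrite ay mulry gtr0_sg ?mul1e// powR_gt0.
  by apply: ereal_sup_ubound; exists s.
move=> aoo; exists (fine a); split; first exact: fine_ge0.
move=> y; rewrite fineK ?ge0_fin_numE//.
apply: le_trans (_ : \sum_(k < m.+1)
         cLnorm (lebn d m) q (fun z => Ks s (put_slot k y z)) <= _); last first.
  by apply: ereal_sup_ubound; exists y.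
rewrite big_ord_recl leeDl//; apply: sume_ge0 => k _; exact: Lnorm_ge0.
Qed.

Lemma pow2_gt0 (s : int) : (0 < 2 ^ s :> R)%R.
Proof. exact: exprz_gt0. Qed.

Definition pow2 (s : int) : {posnum R} := PosNum (pow2_gt0 s).

(** Twice the needed radius, so that the closed condition on the coordinates fits into a half-open
    cube. *)
Definition centered_cube (s : int) : cube R d :=
  ([tuple (- (2 * 2 ^ s) : R)%R | _ < d], ((4 * (pow2 s)%:num)%:pos)%R).

Lemma centered_cubeP (s : int) (x : Rd R d) :
  (forall a, `|coord x a| <= 2 ^ s)%R -> cube_set (centered_cube s) x.
Proof.
move=> h a; have := h a; have := pow2_gt0 s.
rewrite /corner tnth_mktuple /side /= ler_norml.
by move: (2 ^ s)%R (coord x a) => u v u0 /andP[? ?]; apply/andP; split; lra.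
Qed.

(** [put_slot] adds [y] to the other variables, so [z] holds displacements from [y] and one cube
    contains the support for all [y]. *)
Lemma slice_supp (s : int) (y : Rd R d) (z : Rdn R d m) :
  Ks s (put_slot ord0 y z) != 0%R -> box (fun=> cube_set (centered_cube s)) z.
Proof.
move=> /supp_Ks h j; apply: centered_cubeP => a.
have := h (lift ord0 j) ord0; rewrite put_slot0 tnth_tconsS tnth_tcons0 /=.
rewrite tnth_mktuple; apply: le_trans; apply: le_trans (dist_coord _ _ a).
by rewrite coord_addv addrK.
Qed.

Lemma measurable_put_slot0 (y : Rd R d) :
  measurable_fun [set: Rdn R d m] (put_slot ord0 y).
Proof.
have -> : put_slot ord0 y = fun z : Rdn R d m => tcons (y, addvs z y).
  by apply/funext => z; exact: put_slot0.
have := measurableT_comp (@measurable_tcons _ (Rd R d) m)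
  (measurableT_comp (@pair1_measurable _ _ (Rd R d) (Rdn R d m) y)
  (addvs_preserves m y).1).
exact.
Qed.

Let Bs (s : int) : set (Rdn R d m) := box (fun=> cube_set (centered_cube s)).

Let mBs s : measurable (Bs s).
Proof. exact: (measurable_box (fun=> measurable_cube _)). Qed.

Let Bsoo s : lebn d m (Bs s) < +oo.
Proof.
rewrite /Bs /lebn pow_measure_box; last by move=> _; exact: measurable_cube.
under eq_bigr => i _ do rewrite -/(vol _) volE.
by rewrite prodEFin ltry.
Qed.

(* The slice is supported in a cube of side [4 * 2 ^ s], where the L^q norm
   dominates the L^1 norm up to a constant. *)
Lemma slice_bound (q : \bar R) (s : int) :
  1 <= q -> kernel_size Ks q < +oo ->
  exists C : R, (0 <= C)%R /\ forall y : Rd R d,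
    \int[lebn d m]_z (normc (Ks s (put_slot ord0 y z)))%:E <= C%:E.
Proof.
move=> q1 /kernel_size_slice -/(_ s)[N [N0 hN]].
have mk y : cmeasurable (fun z => Ks s (put_slot ord0 y z)).
  exact: (cmeasurable_comp (measurable_put_slot0 y) (mKs s)).
have mnk y : measurable_fun [set: Rdn R d m]
    (fun z => (normc (Ks s (put_slot ord0 y z)))%:E).
  by apply/measurable_EFinP; exact: measurable_normc.
have cutB y : \int[lebn d m]_z (normc (Ks s (put_slot ord0 y z)))%:E =
    \int[lebn d m]_(z in Bs s) (normc (Ks s (put_slot ord0 y z)))%:E.
  rewrite [RHS]integral_mkcond; apply: eq_integral => z _.
  rewrite patchE; case: ifPn => // /negP zB.
  have [->|/slice_supp zB'] := eqVneq (Ks s (put_slot ord0 y z)) 0%R.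
    by rewrite normc0.
  by case: zB; exact/mem_set.
have mu0 := measure_ge0 (lebn d m) (Bs s).
case: q q1 hN => [q| |//].
- rewrite lee_fin => q1 hN.
  have q0 : (q != 0)%R by rewrite gt_eqF// (lt_le_trans ltr01).
  (* The pointwise bound [t <= 1 + t ^ q] takes the place of Hoelder's inequality. The constant is
     not homogeneous, but only its finiteness matters. *)
  exists (fine (lebn d m (Bs s)) + N `^ q)%R; split.
    by rewrite addr_ge0 ?powR_ge0 ?fine_ge0.
  move=> y; rewrite cutB.
  apply: (@le_trans _ _ (\int[lebn d m]_(z in Bs s)
     (1 + (normc (Ks s (put_slot ord0 y z)) `^ q)%:E))).
    apply: ge0_le_integral => //.
    - by move=> z _; rewrite lee_fin normc_ge0.
    - exact: measurable_funTS.
    - apply: measurable_funTS; apply: emeasurable_funD => //.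
      exact: measurable_normc_powR.
    - move=> z _; rewrite -EFinD lee_fin.
      set t := normc _; have t0 : (0 <= t)%R by exact: normc_ge0.
      have [t1|t1] := leP t 1%R.
        by rewrite (le_trans t1)// lerDl powR_ge0.
      by rewrite (le_trans (le1r_powR (ltW t1) q1))// lerDr.
  rewrite ge0_integralD//; last 2 first.
  - by move=> z _; rewrite lee_fin powR_ge0.
  - by apply: measurable_funTS; exact: measurable_normc_powR.
  rewrite integral_cst// mul1e EFinD fineK ?ge0_fin_numE//; apply: leeD => //.
  have := hN y; rewrite /cLnorm => /(gt0_ler_poweR (r := q)).
  have qge0 : (0 <= q)%R by rewrite (le_trans ler01).
  rewrite poweR_Lnorm// !in_itv/= !leey !andbT lee_fin N0 Lnorm_ge0 => /(_ qge0 erefl erefl).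
  apply: le_trans.
  apply: (@le_trans _ _ (\int[lebn d m]_z ((normc (Ks s (put_slot ord0 y z)) `^ q)%:E))).
    apply: ge0_subset_integral => //; first exact: measurable_normc_powR.
    by move=> z _; rewrite lee_fin powR_ge0.
  rewrite le_eqVlt; apply/orP; left; apply/eqP; apply: eq_integral => z _.
  by rewrite /= ger0_norm ?normc_ge0.
- move=> _ hN; exists (N * fine (lebn d m (Bs s)))%R; split.
    by rewrite mulr_ge0// fine_ge0.
  move=> y; rewrite cutB EFinM fineK ?ge0_fin_numE// -integral_cst//.
  have := hN y; rewrite /cLnorm unlock; case: ifPn => [_ /ess_supP hess|].
    apply: ae_ge0_le_integral => //.
    - by move=> z _; rewrite lee_fin normc_ge0.
    - exact: measurable_funTS.
    - apply: filterS hess => z /= h _.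
      by rewrite (le_trans _ h)//= lee_fin ler_norm.
  (* On a space of measure zero the norm at [+oo] is 0 by convention; both integrals are then over a
     null set. *)
  rewrite -leNgt => muT _.
  have muB : lebn d m (Bs s) = 0.
    by apply/eqP; rewrite eq_le mu0 andbT (le_trans _ muT)// le_measure//; exact/mem_set.
  rewrite (null_set_integral (mBs s) _ muB)//.
  by rewrite (null_set_integral (mBs s) _ muB)//; exact: measurable_funTS.
Qed.

End kernel_integrability.

(** * Additivity and homogeneity of the forms on bounded functions *)

Section scale_forms.
Context {R : realType} {d m : nat}.
Implicit Types f g h : 'I_m.+1 -> Rd R d -> R[i].

Definition bounded_measurable f :=
  (forall i, cmeasurable (f i)) /\
  exists N : R, forall i x, normc (f i x) <= N.

Definition cut_first (L : cube R d) f : 'I_m.+1 -> Rd R d -> R[i] :=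
  dfwith f ord0 (cut (cube_set L) (f ord0)).

Lemma cut_first0 L f : cut_first L f ord0 = cut (cube_set L) (f ord0).
Proof. by rewrite /cut_first dfwithin. Qed.

Lemma cut_first_neq L f i : i != ord0 -> cut_first L f i = f i.
Proof. by move=> i0; rewrite /cut_first dfwithout// eq_sym. Qed.

Lemma cut_first_bounded L f : bounded_measurable f ->
  bounded_measurable (cut_first L f).
Proof.
move=> [mf [N fN]]; split.
  move=> i; have [->|i0] := eqVneq i ord0; last by rewrite cut_first_neq.
  by rewrite cut_first0; apply: cmeasurable_cut => //; exact: measurable_cube.
exists N => i x; have [->|i0] := eqVneq i ord0; last by rewrite cut_first_neq.
by rewrite cut_first0 (le_trans (normc_cut _ _ _)).
Qed.

Lemma cmeasurable_tensor f : (forall i, cmeasurable (f i)) ->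
  cmeasurable (tensor f).
Proof.
move=> mf; apply: cmeasurable_prod => i.
exact: (cmeasurable_comp (@measurable_tnth _ (Rd R d) m.+1 i) (mf i)).
Qed.

Variable Ks : int -> Rdn R d m.+1 -> R[i].

Lemma scale_form_eq (A : set int) f g : finite_set A ->
  (forall s x, A s -> Ks s x != 0 -> tensor f x = tensor g x) ->
  scale_form Ks A f = scale_form Ks A g.
Proof.
move=> fA fg; apply: eq_cintegral => x; rewrite !fsbig_finite//= !mulr_suml.
apply: eq_big_seq => s; rewrite in_fset_set// => /set_mem As.
have [->|Kx] := eqVneq (Ks s x) 0; first by rewrite !mul0r.
by rewrite (fg _ _ As).
Qed.

Lemma scale_form_set0 f : scale_form Ks set0 f = 0.
Proof.
rewrite /scale_form -[RHS](@cintegral0 _ _ _ (lebn d m.+1)).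
by apply: eq_cintegral => x; rewrite fsbig_set0 mul0r.
Qed.

Hypothesis mKs : forall s, cmeasurable (Ks s).
Hypothesis supp_Ks : forall s x, Ks s x != 0 ->
  forall k l : 'I_m.+1, dist (tnth x k) (tnth x l) <= 2 ^ s.
Hypothesis Ksize : exists q : \bar R, (1 <= q)%E /\ (kernel_size Ks q < +oo)%E.

(** Tonelli with the first variable outermost: translating the inner variables by [y] turns each
    inner integral into a slice, of mass at most [C] by [slice_bound], and the first variable ranges
    over a set of finite volume. *)
Lemma kernel_integrable (s : int) (L : cube R d) :
  (lebn d m.+1).-integrable setT
    (fun x => (normc (Ks s x) * \1_(cube_set L) (tnth x ord0))%:E).
Proof.
have [q [q1 /(slice_bound mKs supp_Ks s q1)[C [C0 hC]]]] := Ksize.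
have mK := measurable_normc (mKs s).
have mL : measurable_fun setT (\1_(cube_set L) : Rd R d -> R).
  by apply: measurable_indic; exact: measurable_cube.
have mKL : measurable_fun [set: Rdn R d m.+1]
    (fun x => (normc (Ks s x) * \1_(cube_set L) (tnth x ord0))%:E).
  apply/measurable_EFinP; apply: measurable_funM => //.
  exact: (measurableT_comp mL (@measurable_tnth _ (Rd R d) m.+1 ord0)).
apply/integrableP; split => //.
under eq_integral => x _.
  rewrite gee0_abs; last by rewrite lee_fin mulr_ge0// normc_ge0.
  over.
have KL0 x : (0 <= (normc (Ks s x) * \1_(cube_set L) (tnth x ord0))%:E)%E.
  by rewrite lee_fin mulr_ge0// normc_ge0.
rewrite (ge0_integral_pow_measureS (leb d) mKL KL0).
apply: (@le_lt_trans _ _ (\int[leb d]_y (C%:E * (\1_(cube_set L) y)%:E))%E).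
  apply: ge0_le_integral => //.
  - by move=> y _; apply: integral_ge0 => z _; rewrite lee_fin mulr_ge0// normc_ge0.
  - apply: (measurable_fun_fubini_tonelli_F
      (fun z => (normc (Ks s (tcons z)) * \1_(cube_set L) (tnth (tcons z) ord0))%:E)).
      exact: (measurableT_comp mKL (@measurable_tcons _ (Rd R d) m)).
    by move=> z; exact: KL0.
  - by apply: emeasurable_funM => //; exact/measurable_EFinP.
  - move=> y _; under eq_integral do rewrite tnth_tcons0 /= mulrC EFinM.
    have mKy : measurable_fun [set: Rdn R d m]
        (fun w => (normc (Ks s (tcons (y, w))))%:E).
      apply/measurable_EFinP.
      exact: (measurableT_comp mK (measurableT_comp
        (@measurable_tcons _ (Rd R d) m)
        (@pair1_measurable _ _ (Rd R d) (Rdn R d m) y))).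
    rewrite ge0_integralZl//; last by move=> z _; rewrite lee_fin normc_ge0.
    rewrite muleC lee_wpmul2r ?lee_fin//.
    rewrite -((addvs_preserves m y).2 _ mKy); last first.
      by move=> z; rewrite lee_fin normc_ge0.
    apply: le_trans (hC y); rewrite le_eqVlt; apply/orP; left; apply/eqP.
    by apply: eq_integral => z _; rewrite put_slot0.
rewrite ge0_integralZl//; last exact/measurable_EFinP.
rewrite integral_indic//; last exact: measurable_cube.
have -> : cube_set L `&` setT = cube_set L by rewrite setIT.
apply: (@le_lt_trans _ _ (C%:E * vol L)%E); first exact: lexx.
by rewrite volE -EFinM ltry.
Qed.

(** This is what makes local forms additive and homogeneous, since [cintegral] replaces a non-finite
    part by 0. Boundedness of the functions and the cut in the first slot are what
    [kernel_integrable] asks for. *)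
Lemma local_integrable (A : set int) (L : cube R d) f : finite_set A ->
  bounded_measurable f ->
  cintegrable (lebn d m.+1)
    (fun x => (\sum_(s \in A) Ks s x) * tensor (cut_first L f) x).
Proof.
move=> fA bf.
have [mf' _] := cut_first_bounded L bf; have [mf [N fN]] := bf.
pose M := Num.max N 0 ^+ m.+1.
apply: (@cintegrable_dom _ _ _ (lebn d m.+1) _ (fun x =>
  \sum_(s <- fset_set A) (M * (normc (Ks s x) * \1_(cube_set L) (tnth x ord0))))).
- apply: cmeasurableM; last exact: cmeasurable_tensor.
  under eq_fun do rewrite fsbig_finite//=.
  exact: cmeasurable_sum.
- have -> : EFin \o (fun x =>
     \sum_(s <- fset_set A) (M * (normc (Ks s x) * \1_(cube_set L) (tnth x ord0)))) =
     fun x => (\sum_(s <- fset_set A)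
       M%:E * (normc (Ks s x) * \1_(cube_set L) (tnth x ord0))%:E)%E.
    by apply/funext => x /=; rewrite -sumEFin.
  apply: integrable_sum => // s _.
  by apply: integrableZl => //; exact: kernel_integrable.
- move=> x; rewrite fsbig_finite//= mulr_suml.
  apply: le_trans (normc_sum _ _ _) _; apply: ler_sum => s _.
  rewrite normcM mulrCA ler_wpM2l ?normc_ge0//.
  have [xL|xL] := boolP (tnth x ord0 \in cube_set L).
    rewrite indicE xL mulr1 /tensor normc_prod /M.
    rewrite -[X in _ ^+ X](card_ord m.+1) -prodr_const.
    apply: ler_prod => i _; rewrite normc_ge0/= le_max.
    have [->|i0] := eqVneq i ord0; last by rewrite cut_first_neq// fN.
    by rewrite cut_first0 (le_trans (normc_cut _ _ _)).
  rewrite /tensor big_ord_recl cut_first0 /cut (negbTE xL) mul0r normc0.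
  by rewrite mulr_ge0// exprn_ge0// le_max lexx orbT.
Qed.

Lemma local_scale_formD (A : set int) (L : cube R d) f g h j : finite_set A ->
  bounded_measurable g -> bounded_measurable h ->
  (forall i, i != j -> f i = g i /\ f i = h i) ->
  (forall x, f j x = g j x + h j x) ->
  scale_form Ks A (cut_first L f) =
  scale_form Ks A (cut_first L g) + scale_form Ks A (cut_first L h).
Proof.
move=> fA bg bh fgh fj.
rewrite /scale_form -cintegralD; [|exact: local_integrable..].
apply: eq_cintegral => x; rewrite -mulrDr; congr (_ * _).
rewrite /tensor (bigD1 j)//= [in RHS](bigD1 j)//= [X in _ + X](bigD1 j)//=.
have E1 i : i != j -> cut_first L f i = cut_first L g i.
  move=> ij; have [i0|i0] := eqVneq i ord0; last first.
    by rewrite !cut_first_neq// (fgh _ ij).1.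
  by rewrite i0 !cut_first0 -i0 (fgh _ ij).1.
have E2 i : i != j -> cut_first L f i = cut_first L h i.
  move=> ij; have [i0|i0] := eqVneq i ord0; last first.
    by rewrite !cut_first_neq// (fgh _ ij).2.
  by rewrite i0 !cut_first0 -i0 (fgh _ ij).2.
under eq_bigr => i ij do rewrite (E1 _ ij).
have -> : \prod_(i < m.+1 | i != j) cut_first L h i (tnth x i) =
          \prod_(i < m.+1 | i != j) cut_first L g i (tnth x i).
  by apply: eq_bigr => i ij; rewrite -E1// E2.
rewrite -mulrDl; congr (_ * _).
have [j0|j0] := eqVneq j ord0; last by rewrite !cut_first_neq.
by rewrite j0 in fj *; rewrite !cut_first0 /cut; case: ifP => _; rewrite ?fj ?addr0.
Qed.

Lemma local_scale_form_scale (A : set int) (L : cube R d) f (c : 'I_m.+1 -> R) :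
  finite_set A -> bounded_measurable f ->
  scale_form Ks A (fun i x => ((c i)%:C)%C * cut_first L f i x) =
  ((\prod_i c i)%:C)%C * scale_form Ks A (cut_first L f).
Proof.
move=> fA bf; rewrite /scale_form -cintegral_scale; last exact: local_integrable.
apply: eq_cintegral => x; rewrite mulrCA; congr (_ * _).
by rewrite /tensor big_split/= rmorph_prod.
Qed.

End scale_forms.

(** * Dyadic grids and stopping cubes *)

Section dyadic.
Context {R : realType} {d : nat}.
Implicit Types (Q L : cube R d) (k : int) (n : {ffun 'I_d -> int}).
Variable o : d.-tuple R.

(** The origin [o] is a parameter because the orthants around the origin of one fixed grid never
    merge into a single cube. The index type is countable, which lets the weak-type bound enumerate
    the cubes. *)
Definition dy k n : cube R d :=
  ([tuple tnth o a + (n a)%:~R * 2 ^ k | a < d], pow2 k).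

Lemma side_dy k n : side (dy k n) = 2 ^ k.
Proof. by []. Qed.

Lemma corner_dy k n a : corner (dy k n) a = tnth o a + (n a)%:~R * 2 ^ k.
Proof. by rewrite /corner tnth_mktuple. Qed.

Lemma scale_dy k n : scale (dy k n) = k%:~R.
Proof.
rewrite /scale side_dy -powR_intmul// ln_powR mulfK// gt_eqF// ln_gt0//.
by rewrite ltr1n.
Qed.

Definition dygrid : set (cube R d) := [set Q | exists k n, Q = dy k n].

(* Containment of cubes expressed by corners, so that no point of the smaller
   cube is needed to use it. *)
Definition subc L Q := forall a, corner Q a <= corner L a /\
  corner L a + side L <= corner Q a + side Q.

Lemma subc_sub L Q : subc L Q -> cube_set L `<=` cube_set Q.
Proof.
move=> h x xL a; have [h1 h2] := h a; have /andP[x1 x2] := xL a.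
by rewrite (le_trans h1 x1) (lt_le_trans x2 h2).
Qed.

Lemma subc_trans L Q S : subc L Q -> subc Q S -> subc L S.
Proof.
move=> h1 h2 a; have [? ?] := h1 a; have [? ?] := h2 a.
by split; apply: le_trans; eassumption.
Qed.

Lemma subcc L : subc L L.
Proof. by []. Qed.

Lemma cube_corner L : cube_set L [tuple (corner L a : R) | a < d].
Proof.
move=> a; rewrite /coord tnth_mktuple lexx ltrDl; exact: side_gt0.
Qed.

Definition at_ k (x : Rd R d) : {ffun 'I_d -> int} :=
  [ffun a => Num.floor ((coord x a - tnth o a) / 2 ^ k)].

Lemma dy_at k (x : Rd R d) : cube_set (dy k (at_ k x)) x.
Proof.
move=> a; rewrite corner_dy side_dy ffunE.
have h := pow2_gt0 (R := R) k.
set t := (_ / _); have tE : coord x a = tnth o a + t * 2 ^ k.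
  by rewrite /t divfK ?gt_eqF// addrC subrK.
rewrite tE lerD2l ler_pM2r// floor_le/= -addrA ltrD2l -{3}[2 ^ k]mul1r -mulrDl ltr_pM2r//.
by rewrite -(rmorph1 (intr : int -> R)) -rmorphD/=; exact: floorD1_gt.
Qed.

Lemma pow2_le (k k' : int) : k <= k' -> exists M : nat, (0 < M)%N /\
  (2 ^ k' : R) = M%:R * 2 ^ k.
Proof.
move=> kk; exists (2 ^ `|k' - k|)%N; rewrite expn_gt0; split=> //.
rewrite natrX; have {1}-> : k' = `|k' - k|%N%:Z + k.
  by rewrite gez0_abs ?subr_ge0// subrK.
by rewrite expfzDr.
Qed.

(** The larger side is an integer multiple of the smaller. A common point gives strict inequalities
    between integers, and integrality sharpens each of them by one unit, which is containment. *)
Lemma dy_nested k k' n n' (x : Rd R d) : k <= k' ->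
  cube_set (dy k n) x -> cube_set (dy k' n') x -> subc (dy k n) (dy k' n').
Proof.
move=> kk xL xQ a; have := xL a; have := xQ a.
rewrite !corner_dy !side_dy; have [M [_ ->]] := pow2_le kk.
have := pow2_gt0 (R := R) k; move: (2 ^ k) => u u0.
move=> /andP[h1 h2] /andP[h3 h4].
have l1 : (n' a * M%:Z < n a + 1)%R.
  rewrite -(ltr_int R) -(ltr_pM2r u0) rmorphM/= rmorphD/= -!pmulrn mulrDl mul1r.
  by rewrite -mulrA; lra.
have l2 : (n a < (n' a + 1) * M%:Z)%R.
  rewrite -(ltr_int R) -(ltr_pM2r u0) rmorphM/= rmorphD/= -!pmulrn.
  by rewrite -mulrA mulrDl mul1r; lra.
have {}l1 : (n' a * M%:Z <= n a)%R by lia.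
have {}l2 : (n a + 1 <= (n' a + 1) * M%:Z)%R by lia.
move: l1 l2; rewrite -(ler_int R) -(ler_pM2r u0) rmorphM/= -!pmulrn => l1.
rewrite -(ler_int R) -(ler_pM2r u0) rmorphM/= !rmorphD/= -!pmulrn => l2.
split; first by rewrite lerD2l mulrA.
by move: l2; rewrite -mulrA !mulrDl !mul1r; lra.
Qed.

Lemma dy_inj k n n' (x : Rd R d) :
  cube_set (dy k n) x -> cube_set (dy k n') x -> n = n'.
Proof.
move=> xL xQ.
have h1 := dy_nested (lexx k) xL xQ; have h2 := dy_nested (lexx k) xQ xL.
apply/ffunP => a; have [h1a _] := h1 a; have [h2a _] := h2 a.
have : corner (dy k n) a = corner (dy k n') a by apply/eqP; rewrite eq_le h1a h2a.
rewrite !corner_dy => /addrI/(mulIf _) E.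
by apply: (@intr_inj R); apply: E; rewrite gt_eqF// pow2_gt0.
Qed.

Lemma dygrid_lattice : dyadic_lattice dygrid.
Proof.
split.
- by move=> _ [k [n ->]]; exists k.
- move=> _ _ [k [n ->]] [k' [n' ->]].
  have [->|/set0P[x [x1 x2]]] := eqVneq (cube_set (dy k n) `&` cube_set (dy k' n')) set0.
    by constructor 3.
  have [kk|kk] := leP k k'.
    by constructor 1; apply: subc_sub; exact: dy_nested x1 x2.
  by constructor 2; apply: subc_sub; exact: dy_nested (ltW kk) x2 x1.
- move=> k x; exists (dy k (at_ k x)); split=> //; last exact: dy_at.
  by exists k, (at_ k x).
Qed.

Lemma subc_at k k' n (x : Rd R d) : k <= k' -> cube_set (dy k n) x ->
  subc (dy k n) (dy k' (at_ k' x)).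
Proof. by move=> kk xL; apply: dy_nested kk xL (dy_at _ _). Qed.

Lemma parent_ex k k' n : k <= k' -> exists n', subc (dy k n) (dy k' n').
Proof.
move=> kk; exists (at_ k' [tuple (corner (dy k n) a : R) | a < d]).
by apply: subc_at => //; exact: cube_corner.
Qed.

Lemma subc_level k k' n n' : (0 < d)%N -> subc (dy k n) (dy k' n') -> k <= k'.
Proof.
move=> d0 h; have [h1 h2] := h (Ordinal d0); move: h1 h2; rewrite !side_dy => h1 h2.
have : (2 ^ k : R) <= 2 ^ k' by lra.
by rewrite ler_eXz2l// ltr1n.
Qed.

End dyadic.

(** * Maximal grid cubes relative to an exceptional set *)

Section stopping_cubes.
Context {R : realType} {d : nat}.
Variables (o : d.-tuple R) (K k0 : int) (nQ : {ffun 'I_d -> int}).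
Variable E : set (Rd R d).
Hypothesis d_gt0 : (0 < d)%N.
Local Notation dy := (dy o).
Local Notation Q := (dy K nQ).
Local Notation Q3 := (dilc 3%:pos Q).
Hypothesis k0K : k0 + 6 <= K.
Hypothesis E_small : forall k n, dilate 9 (dy k n) `<=` E -> k + 6 <= K.

Lemma pow2D (k : int) (j : nat) : (2 ^ (k + j%:Z) : R) = 2 ^+ j * 2 ^ k.
Proof. by rewrite expfzDr// mulrC. Qed.

Lemma pow2_leD (k k' : int) (j : nat) : k + j%:Z <= k' ->
  2 ^+ j * 2 ^ k <= 2 ^ k' :> R.
Proof. by move=> h; rewrite -pow2D ler_weXz2l// ler1n. Qed.

Lemma corner_Q3 a : corner Q3 a = tnth o a + (nQ a - 1)%:~R * 2 ^ K.
Proof.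
rewrite corner_dilc /center corner_dy side_dy /= rmorphB/= mulrBl mul1r.
by move: (2 ^ K) => u; lra.
Qed.

Lemma side_Q3 : side Q3 = 3 * 2 ^ K. Proof. by []. Qed.

(** [3Q] is not a grid cube but a union of grid cubes of level [K]: the ancestor at level [K] of a
    smaller cube that meets it lies inside it. *)
Lemma subc_Q3 (k : int) n (x : Rd R d) : k <= K ->
  cube_set (dy k n) x -> cube_set Q3 x -> subc (dy k n) Q3.
Proof.
move=> kK xL xQ a; have := subc_at kK xL a; have := dy_at o K x a; have := xQ a.
rewrite !corner_Q3 !side_Q3 !corner_dy !side_dy.
have := pow2_gt0 (R := R) K.
move: (at_ o K x a) (2 ^ K) (2 ^ k) (nQ a - 1) => n' u v p u0.
move=> /andP[h1 h2] /andP[h3 h4] [h5 h6].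
have l1 : p < n' + 1.
  by rewrite -(ltr_int R) -(ltr_pM2r u0) rmorphD/= mulrDl mul1r; lra.
have l2 : n' < p + 3.
  by rewrite -(ltr_int R) -(ltr_pM2r u0) rmorphD/= mulrDl; lra.
have {}l1 : p <= n' by lia.
have {}l2 : n' + 1 <= p + 3 by lia.
move: l1 l2; rewrite -(ler_int R) -(ler_pM2r u0) => l1.
rewrite -(ler_int R) -(ler_pM2r u0) !rmorphD/= !mulrDl mul1r => l2.
by split; lra.
Qed.

(* [stops] consists of the maximal cubes of the grid inside [3Q] whose ninefold
   dilate lies in the exceptional set; all cubes of the bottom level [k0] are
   admitted too, so that the family is finite and tiles [3Q]. *)
Definition admissible (k : int) n := [/\ k0 <= k, subc (dy k n) Q3 &
  dilate 9 (dy k n) `<=` E \/ k = k0].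

Definition stops : set (cube R d) := [set L | exists k n, [/\ L = dy k n,
  admissible k n &
  forall k' n', admissible k' n' -> subc (dy k n) (dy k' n') -> k' <= k]].

Lemma admissible_level k n : admissible k n -> k + 6 <= K.
Proof. by move=> [_ _ [/E_small//|->]]. Qed.

Lemma stopsP L : stops L -> exists k n, [/\ L = dy k n, admissible k n &
  exists n', [/\ subc (dy k n) (dy (k + 1) n') &
    ~ (dilate 9 (dy (k + 1) n') `<=` E)]].
Proof.
move=> [k [n [-> adm kmax]]]; exists k, n; split=> //.
have k1 : k <= k + 1 by lia.
have [n' h] := parent_ex o n k1; exists n'; split=> // E9.
suff /kmax : admissible (k + 1) n' by move/(_ h); lia.
have lK := admissible_level adm; have [kk0 s3 _] := adm.
split; [by lia| |by left].
have kK : k + 1 <= K by lia.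
have := cube_corner (dy k n) => xL.
exact: subc_Q3 kK (subc_sub h xL) (subc_sub s3 xL).
Qed.

(** The bottom cube around a point of [3Q] is admissible, and admissible levels are at most [K - 6];
    hence there is a largest admissible cube around the point. *)
Lemma stops_shadow : shadow stops = cube_set Q3.
Proof.
apply/seteqP; split=> [x [L [k [n [-> [_ s3 _] _]]]] xL|x xQ].
  exact: subc_sub s3 _ xL.
pose good (j : nat) := `[< admissible (k0 + j%:Z) (at_ o (k0 + j%:Z) x) >].
have good0 : good 0%N.
  apply/asboolP; rewrite addr0; split=> //; last by right.
  by apply: subc_Q3 (dy_at _ _ _) xQ; move: k0K; lia.
have goodle j : good j -> (j <= `|K - k0|)%N.
  by move=> /asboolP/admissible_level; lia.
have [j /asboolP adm jmax] := ex_maxnP (ex_intro good 0%N good0) goodle.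
exists (dy (k0 + j%:Z) (at_ o (k0 + j%:Z) x)); last exact: dy_at.
exists (k0 + j%:Z), (at_ o (k0 + j%:Z) x); split=> // k' n' adm' sub.
have [kk0 _ _] := adm'.
have E' : n' = at_ o k' x.
  exact: dy_inj (subc_sub sub (dy_at _ _ _)) (dy_at _ _ _).
have kE : k' = k0 + `|k' - k0|%N%:Z by lia.
have /jmax : good `|k' - k0|%N by apply/asboolP; rewrite -kE -E'.
by lia.
Qed.

Lemma stops_meet L L' x : stops L -> stops L' -> cube_set L x -> cube_set L' x ->
  L = L'.
Proof.
move=> [k [n [-> adm kmax]]] [k' [n' [-> adm' kmax']]] xL xL'.
suff kk : k = k' by rewrite -kk in xL' *; rewrite (dy_inj xL xL').
have [h|h] := leP k k'.
  have := kmax _ _ adm' (dy_nested h xL xL'); lia.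
have := kmax' _ _ adm (dy_nested (ltW h) xL' xL); lia.
Qed.

(** The larger cube [L] is at least eight levels above the bottom, so [9L] lies in [E]. If the
    dilates met at [z], the ninefold dilate of the parent of the small cube would stay within 13
    small sides of [z], less than one side of [L], hence inside [9L] and [E], against [stopsP]. *)
Lemma stops_sep_lt (k r : int) n n' z : r + 8 <= k ->
  stops (dy k n) -> stops (dy r n') ->
  dilate 7 (dy k n) z -> dilate 7 (dy r n') z -> False.
Proof.
move=> rk sL /stopsP[r2 [n2 [Er adm [n3 [sub nE]]]]] zL zR; apply: nE.
have [kL [nL [EL [kL0 _ cL] _]]] := sL.
have Er' : r2 = r.
  by have := congr1 (@scale R d) Er; rewrite !scale_dy => /intr_inj.
have EL' : kL = k.
  by have := congr1 (@scale R d) EL; rewrite !scale_dy => /intr_inj.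
case: adm => r0 _ _; case: cL => [EL9|]; last by lia.
apply: subset_trans EL9; rewrite -EL => y h a.
have := h a; have := sub a; have := zL a; have := zR a.
rewrite Er /center !side_dy.
have -> : (2 ^ (r2 + 1) : R) = 2 * 2 ^ r2 by rewrite (pow2D _ 1) expr1.
have : 2 ^+ 8 * 2 ^ r2 <= 2 ^ k :> R by apply: pow2_leD; lia.
have := pow2_gt0 (R := R) r2.
have -> : (2 : R) ^+ 8 = 256 by ring.
move: (2 ^ k) (2 ^ r2) (corner _ _) (corner (dy r2 n2) a) (corner _ a) (coord y a) (coord z a).
move=> u v c1 c2 c3 ya za v0 uv /andP[? ?] /andP[? ?] [? ?] /andP[? ?].
by apply/andP; split; lra.
Qed.

Lemma stops_stopping : stopping_collection (dygrid o) stops Q.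
Proof.
have Q3E : dilate 3 Q = cube_set Q3 by exact: (dilateE 3%:pos Q).
split.
- by exists K, nQ.
- by move=> L [k [n [-> _ _]]]; exists k, n.
- move=> L L' sL sL' LL'; rewrite -subset0 => x [xL xL'].
  by apply: LL'; exact: stops_meet xL xL'.
- by move=> L [k [n [-> [_ s3 _] _]]]; rewrite Q3E; exact: subc_sub.
- move=> L L' sL sL'.
  have [k [n [EL _ _]]] := sL; have [k' [n' [EL' _ _]]] := sL'.
  rewrite EL EL' in sL sL' *; rewrite !scale_dy -rmorphB/= -intr_norm.
  have -> : 8 = 8%:~R :> R by [].
  rewrite ler_int => kk; rewrite -subset0 => z [zL zL'].
  have [h|h] := leP k k'.
    by apply: (stops_sep_lt _ sL' sL zL' zL); lia.
  by apply: (stops_sep_lt _ sL sL' zL zL'); lia.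
(* Each coordinate of a point of [9L] differs by at most 6 sides of [L] from that of a point of
   [2Q]. This is less than half the side of [Q], so [9L] stays in [3Q], which the stopping cubes
   tile. *)
- rewrite stops_shadow => x [L /= [sL [z [z3 z2]]] x9] a.
  have [k [n [EL adm _]]] := sL; move: z3 x9; rewrite EL => z3 x9.
  have lK := pow2_leD (admissible_level adm).
  have := z3 a; have := z2 a; have := x9 a.
  rewrite corner_Q3 side_Q3 /center !side_dy !corner_dy rmorphB/= mulrBl mul1r.
  move: lK; have := pow2_gt0 (R := R) k.
  have -> : (2 : R) ^+ 6 = 64 by ring.
  move: (2 ^ k) (2 ^ K) (coord x a) (coord z a) => u v xa za u0 uv.
  move=> /andP[? ?] /andP[? ?] /andP[? ?].
  by apply/andP; split; lra.
Qed.

(** The ninefold dilate of the parent reaches at most 9.5 sides from the centre of [L], well within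
    the 16 of the dilate by [2 ^+ 5]. At such a [z] the infimum in [Ynorm] will be tested. *)
Lemma stops_good L : stops L -> exists z, dilate (2 ^+ 5) L z /\ ~ E z.
Proof.
move=> /stopsP[k [n [-> _ [n' [sub nE]]]]].
have : exists z, dilate 9 (dy (k + 1) n') z /\ ~ E z.
  apply: contrapT => h; apply: nE => z z9; apply: contrapT => Ez.
  by apply: h; exists z.
move=> [z [z9 Ez]]; exists z; split=> // a; have := z9 a; have := sub a.
rewrite /center !side_dy.
have -> : (2 ^ (k + 1) : R) = 2 * 2 ^ k by rewrite (pow2D _ 1) expr1.
have -> : (2 : R) ^+ 5 = 32 by ring.
have := pow2_gt0 (R := R) k.
move: (2 ^ k) (corner _ _) (corner _ a) (coord z a).
move=> u c1 c2 za u0 [? ?] /andP[? ?].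
by apply/andP; split; lra.
Qed.

Lemma stops_finite : finite_set stops.
Proof.
(* Levels are counted from [k0] and positions from the lower corner of [3Q]; level [k] has
   [3 * 2 ^ (K - k)] positions along each axis, at most [B]. *)
pose N := `|K - k0|%N.+1; pose B := (3 * 2 ^ N)%N.
pose F (p : 'I_N * {ffun 'I_d -> 'I_B}) : cube R d :=
  let k := k0 + (p.1 : nat)%:Z in
  dy k [ffun a => (nQ a - 1) * (2 ^ `|K - k|)%N%:Z + (p.2 a : nat)%:Z].
apply: (@sub_finite_set _ _ (F @` setT)); last exact: finite_image.
move=> L [k [n [-> adm _]]].
have lK := admissible_level adm; case: adm => kk0 s3 _.
have kN : (`|k - k0| < N)%N by rewrite /N; lia.
pose M := (2 ^ `|K - k|)%N.
have MB : (3 * M <= B)%N.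
  by rewrite /B leq_mul2l/= leq_exp2l// /N; lia.
have KM : (2 ^ K : R) = M%:R * 2 ^ k.
  have {1}-> : K = k + `|K - k|%N%:Z by lia.
  by rewrite pow2D /M natrX.
have bnd a : 0 <= n a - (nQ a - 1) * M%:Z < (3 * M)%N%:Z.
  have := s3 a; rewrite corner_Q3 side_Q3 corner_dy side_dy KM.
  have := pow2_gt0 (R := R) k; move: (2 ^ k) => u u0 [h1 h2].
  have l1 : (nQ a - 1) * M%:Z <= n a.
    rewrite -(ler_int R) -(ler_pM2r u0) rmorphM/= -!pmulrn -mulrA.
    lra.
  have l2 : n a + 1 <= (nQ a - 1) * M%:Z + 3 * M%:Z.
    rewrite -(ler_int R) -(ler_pM2r u0) !rmorphD/= !rmorphM/= -!pmulrn.
    rewrite !mulrDl mul1r -!mulrA.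
    lra.
  by apply/andP; split; lia.
have jB a : (`|(n a - (nQ a - 1) * M%:Z)%R| < B)%N.
  by have /andP[? ?] := bnd a; lia.
exists (Ordinal kN, [ffun a => Ordinal (jB a)]) => //.
rewrite /F /=; have -> : k0 + `|k - k0|%N%:Z = k by lia.
congr dy; apply/ffunP => a; rewrite !ffunE /= -/M.
by have /andP[? ?] := bnd a; lia.
Qed.

End stopping_cubes.

Lemma pow2_approx {R : realType} (s : R) : 0 < s ->
  exists K : int, s <= 2 ^ K /\ 2 ^ K <= 2 * s.
Proof.
move=> s0; pose k := Num.floor (ln s / ln 2).
have ln2 : 0 < ln 2 :> R by rewrite ln_gt0// ltr1n.
have sE : s = 2 `^ (ln s / ln 2).
  by rewrite /powR gt_eqF// divfK ?gt_eqF// lnK// posrE.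
have two (i : int) : (2 : R) ^ i = 2 `^ i%:~R by rewrite powR_intmul.
exists (k + 1); split.
  by rewrite {1}sE two ler_powR ?ler1n// ltW// floorD1_gt.
rewrite (pow2D _ 1) expr1 ler_pM2l// two [leRHS]sE.
by rewrite ler_powR ?ler1n// floor_le.
Qed.

(** Along each axis the cube meets the grid interval of its lower corner and at most the next one;
    the candidates are indexed by boolean functions. *)
Lemma cube_cover {R : realType} {d : nat} (o : d.-tuple R) (K : int)
    (S : cube R d) : side S <= 2 ^ K ->
  exists ns : seq {ffun 'I_d -> int}, [/\ uniq ns, size ns = (2 ^ d)%N &
    cube_set S `<=` \big[setU/set0]_(n <- ns) cube_set (dy o K n)].
Proof.
move=> K1; pose n0 := at_ o K [tuple (corner S a : R) | a < d].
have := dy_at o K [tuple (corner S a : R) | a < d]; rewrite -/n0 => hn0.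
pose shift (e : {ffun 'I_d -> bool}) : {ffun 'I_d -> int} :=
  [ffun a => n0 a + (e a : nat)%:Z].
have shift_inj : injective shift.
  move=> e e' /ffunP ee; apply/ffunP => a; have := ee a.
  by rewrite !ffunE => /addrI []; case: (e a); case: (e' a).
exists (map shift (enum {ffun 'I_d -> bool})); split.
- by rewrite map_inj_uniq// enum_uniq.
- by rewrite size_map -cardE card_ffun card_bool card_ord.
rewrite -bigcup_seq => y yS; exists (at_ o K y); last exact: dy_at.
rewrite /=; apply/mapP.
exists [ffun a => at_ o K y a != n0 a]; first by rewrite mem_enum.
apply/ffunP => a; rewrite [shift _ _]ffunE [X in nat_of_bool X]ffunE.
have := hn0 a; have := dy_at o K y a; have := yS a.
rewrite /coord tnth_mktuple -/(coord _ _) !corner_dy !side_dy.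
move=> /andP[y1 y2] /andP[y3 y4] /andP[y5 y6].
move: (at_ o K y a) (n0 a) (2 ^ K) (pow2_gt0 (R := R) K) K1 y1 y2 y3 y4 y5 y6.
move=> i j u u0 K1' y1 y2 y3 y4 y5 y6.
have l1 : j < i + 1.
  by rewrite -(ltr_int R) -(ltr_pM2r u0) rmorphD/= mulrDl mul1r; lra.
have l2 : i < j + 2.
  by rewrite -(ltr_int R) -(ltr_pM2r u0) rmorphD/= mulrDl; lra.
by case: eqVneq => /= ij; lia.
Qed.

(** * Weak-type bound *)

Section weak_type.
Context {R : realType} {d : nat}.
Variable o : d.-tuple R.
Hypothesis d_gt0 : (0 < d)%N.
Local Notation dy := (dy o).
Variables (F : Rd R d -> \bar R) (t M : R).
Hypothesis mF : measurable_fun setT F.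
Hypothesis F0 : forall x, (0 <= F x)%E.
Hypothesis t_gt0 : 0 < t.
Hypothesis FM : (\int[leb d]_x F x <= M%:E)%E.
Local Open Scope ereal_scope.

(* Every cube lies in the threefold dilate of a grid cube of comparable size, so
   off [bad_set] the averages of [F] over arbitrary cubes are controlled. *)
Definition bad (p : int * {ffun 'I_d -> int}) : Prop :=
  (t * (2 ^ p.1) ^+ d)%R%:E < \int[leb d]_(x in cube_set (dy p.1 p.2)) F x.

Definition bad_set : set (Rd R d) :=
  [set x | exists2 p, bad p & dilate 3 (dy p.1 p.2) x].

Definition bad_top (p : int * {ffun 'I_d -> int}) : Prop := bad p /\
  forall p' : int * {ffun 'I_d -> int}, bad p' ->
    subc (dy p.1 p.2) (dy p'.1 p'.2) -> (p'.1 <= p.1)%R.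

Let int_le A : measurable A -> \int[leb d]_(x in A) F x <= M%:E.
Proof.
move=> mA; apply: le_trans FM.
by apply: ge0_subset_integral => // x _; exact: F0.
Qed.

(** A bad cube has [t] times its volume below [M], which bounds its side since [0 < d]. This is why
    every bad cube lies in a maximal one. *)
Lemma bad_level : exists N : nat, forall p, bad p -> (p.1 < N%:Z)%R.
Proof.
pose N := (Num.truncn (M / t)).+1; exists N => p bp.
rewrite ltNge; apply/negP => Np.
have : (t * (2 ^ p.1) ^+ d)%:E < M%:E.
  by apply: lt_le_trans bp (int_le _); exact: measurable_cube.
rewrite lte_fin => h.
have [k pk] : exists k : nat, p.1 = k%:Z by exists `|p.1|%N; lia.
have h1 : (N%:R <= 2 ^ p.1 :> R)%R.
  rewrite pk -exprnP -natrX ler_nat (leq_trans _ (ltnW (ltn_expl k (ltnSn 1))))//.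
  by move: Np; rewrite pk; lia.
have h2 : (2 ^ p.1 <= (2 ^ p.1) ^+ d :> R)%R.
  by rewrite -{1}[(2 ^ p.1)%R]expr1 ler_weXn2l// (le_trans _ h1)// ler1n.
have h3 : (M / t < N%:R)%R by rewrite /N truncnS_gt.
have : (M < t * N%:R)%R by rewrite mulrC -ltr_pdivrMr.
have h4 : (t * N%:R <= t * (2 ^ p.1) ^+ d)%R by rewrite ler_pM2l// (le_trans h1 h2).
move=> h5; have := lt_trans (lt_le_trans h5 h4) h; by rewrite ltxx.
Qed.

Lemma bad_top_ex p : bad p -> exists2 p', bad_top p' &
  subc (dy p.1 p.2) (dy p'.1 p'.2).
Proof.
have [N hN] := bad_level.
have : (N%:Z <= p.1 + `|N%:Z - p.1|%N%:Z)%R by lia.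
move: `|_|%N => j; elim: j p => [|j IH] p pj bp.
  by have := hN _ bp; lia.
have [|] := pselect (exists p' : int * {ffun 'I_d -> int},
  [/\ bad p', subc (dy p.1 p.2) (dy p'.1 p'.2) & (p.1 < p'.1)%R]).
  move=> [p' [bp' sub lt]]; have [|p2 tp2 sub2] := IH p' _ bp'; first by lia.
  by exists p2 => //; exact: subc_trans sub sub2.
move=> h; exists p; last exact: subcc.
split=> // p' bp' sub; rewrite leNgt; apply/negP => lt; apply: h; by exists p'.
Qed.

Lemma bad_top_disjoint p p' x : bad_top p -> bad_top p' ->
  cube_set (dy p.1 p.2) x -> cube_set (dy p'.1 p'.2) x -> p = p'.
Proof.
case: p p' => [k n] [k' n'] [/= b1 m1] [/= b2 m2] x1 x2.
suff kk : k = k' by rewrite -kk in x2 *; rewrite (dy_inj x1 x2).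
have [h|h] := leP k k'.
  have := m1 _ b2 (dy_nested h x1 x2); move=> /=; lia.
have := m2 _ b1 (dy_nested (ltW h) x2 x1); move=> /=; lia.
Qed.

Lemma subc_dilate3 (L Q : cube R d) : subc L Q -> dilate 3 L `<=` dilate 3 Q.
Proof.
move=> sub x h a; have := h a; have := sub a; rewrite /center.
have := side_gt0 L; have := side_gt0 Q.
move: (side L) (side Q) (corner L a) (corner Q a) (coord x a) => u v c1 c2 xa.
move=> u0 v0 [? ?] /andP[? ?]; apply/andP; split; lra.
Qed.

(** The maximal bad cubes as a sequence, listed by the codes of their indices, so that countable
    additivity applies. [G] will be the cube itself or its threefold dilate. *)
Let A (G : cube R d -> set (Rd R d)) (i : nat) : set (Rd R d) :=
  if pickle_inv i is Some p then
    if `[< bad_top p >] then G (dy p.1 p.2) else set0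
  else set0.

Let A_ex G i x : A G i x -> exists p, [/\ i = choice.pickle p, bad_top p &
  G (dy p.1 p.2) x].
Proof.
have := @pickle_invK (int * {ffun 'I_d -> int})%type i.
rewrite /A; case E : pickle_inv => [p|//] /= <-.
by case: ifP => // /asboolP tp Gx; exists p.
Qed.

Let A_in G p x : bad_top p -> G (dy p.1 p.2) x -> A G (choice.pickle p) x.
Proof. by move=> tp Gx; rewrite /A pickleK_inv asboolT. Qed.

Let mA G i : (forall L, measurable (G L)) -> measurable (A G i).
Proof.
move=> mG; rewrite /A; case: pickle_inv => [p|]; last exact: measurable0.
by case: ifP => _; [exact: mG|exact: measurable0].
Qed.

Let bad_setE : bad_set = \bigcup_i A (dilate 3) i.
Proof.
apply/seteqP; split=> [x [p /bad_top_ex[p' tp' sub]] xp|x [i _ /A_ex[p [_ tp xp]]]].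
  by exists (choice.pickle p'); [exact: Logic.I|
    exact: (A_in tp' (subc_dilate3 sub xp))].
by exists p => //; case: tp.
Qed.

Lemma measurable_bad_set : measurable bad_set.
Proof.
rewrite bad_setE; apply: bigcup_measurable => i _; apply: mA => L.
exact: measurable_dilate.
Qed.

(** The threefold dilates of the maximal bad cubes cover [bad_set] and cost a factor [3 ^+ d]; the
    cubes themselves are disjoint, so their integrals of [F] add up to at most [M]. *)
Lemma bad_set_measure : t%:E * leb d bad_set <= (3 ^+ d * M)%:E.
Proof.
have mC i : measurable (A (@cube_set R d) i) by apply: mA; exact: measurable_cube.
have mD i : measurable (A (dilate 3) i).
  by apply: mA => L; exact: measurable_dilate.
have triv : trivIset setT (A (@cube_set R d)).
  apply/trivIsetP => i j _ _ ij; rewrite -subset0 => x [].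
  move=> /A_ex[p [pi tp xp]] /A_ex[p' [pj tp' xp']].
  by move/eqP: ij; apply; rewrite pi pj (bad_top_disjoint tp tp' xp xp').
have AE i : leb d (A (dilate 3) i) = (3 ^+ d)%:E * leb d (A (@cube_set R d) i).
  rewrite /A; case: pickle_inv => [p|]; last by rewrite measure0 mule0.
  case: ifP => _; last by rewrite measure0 mule0.
  by rewrite leb_dilate// -/(vol _) volE exprMn EFinM.
have tA i : t%:E * leb d (A (@cube_set R d) i) <= \int[leb d]_(x in A (@cube_set R d) i) F x.
  rewrite /A; case: pickle_inv => [p|]; last by rewrite measure0 mule0 integral_set0.
  case: ifPn => [/asboolP[bp _]|_]; last by rewrite measure0 mule0 integral_set0.
  by rewrite -/(vol _) volE; exact: ltW.
apply: (@le_trans _ _ (t%:E * \sum_(i <oo) leb d (A (dilate 3) i))).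
  rewrite lee_pmul2l ?lte_fin//.
  apply: (@measure_sigma_subadditive _ _ _ (leb d) _ _ mD measurable_bad_set).
  by rewrite bad_setE.
under eq_eseriesr do rewrite AE.
rewrite nneseriesZl => [|i _]; last exact: measure_ge0.
rewrite muleCA EFinM lee_pmul2l ?lte_fin ?exprn_gt0//.
rewrite -nneseriesZl => [|i _]; last exact: measure_ge0.
apply: (@le_trans _ _ (\sum_(i <oo) \int[leb d]_(x in A (@cube_set R d) i) F x)).
  apply: lee_nneseries => [i _ _|i _]; last exact: tA.
  by rewrite mule_ge0// lee_fin ltW.
rewrite -(ge0_integral_bigcup (leb d) mC (measurable_funTS mF) (fun x _ => F0 x) triv).
exact: (int_le (bigcup_measurable (fun k _ => mC k))).
Qed.

(** [S] is covered by [2 ^ d] grid cubes of side between [side S] and twice that. Those meeting [S]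
    have [x] in their threefold dilate, hence are not bad; the count and the larger volume each give
    [2 ^+ d]. *)
Lemma bad_setN_integral x (S : cube R d) : ~ bad_set x -> cube_set S x ->
  \int[leb d]_(y in cube_set S) F y <= (4 ^+ d * t * side S ^+ d)%:E.
Proof.
move=> xB xS.
have [K [K1 K2]] := pow2_approx (side_gt0 S).
have [ns [uns sns covS]] := cube_cover o K1.
have SE : cube_set S = \big[setU/set0]_(n <- ns) (cube_set S `&` cube_set (dy K n)).
  by rewrite -bigcup_seq -setI_bigcupr bigcup_seq; apply/esym/setIidPl.
have mD n : measurable (cube_set S `&` cube_set (dy K n)).
  exact: (measurableI _ _ (measurable_cube S) (measurable_cube (dy K n))).
have triv : trivIset [set` ns] (fun n => cube_set S `&` cube_set (dy K n)).
  apply/trivIsetP => n n' _ _ nn; rewrite -subset0 => y [[_ y1] [_ y2]].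
  by move/eqP: nn; apply; exact: dy_inj y1 y2.
rewrite [X in \int[leb d]_(y in X) _]SE.
rewrite (ge0_integral_bigsetU (leb d) mD uns triv (measurable_funTS mF)); last first.
  by move=> y _; exact: F0.
apply: (@le_trans _ _ (\sum_(n <- ns) (t * (2 ^ K) ^+ d)%R%:E)).
  apply: lee_sum => n _.
  have [->|/set0P[y [y1 y2]]] := eqVneq (cube_set S `&` cube_set (dy K n)) set0.
    by rewrite integral_set0 lee_fin mulr_ge0 ?exprn_ge0 ?exprz_ge0// ltW.
  apply: (@le_trans _ _ (\int[leb d]_(x in cube_set (dy K n)) F x)).
    exact: (ge0_subset_integral (leb d) (mD n) (measurable_cube _)
      (measurable_funTS mF) (fun x _ => F0 x) (@subIsetr _ _ _)).
  rewrite leNgt; apply/negP => bp; apply: xB; exists (K, n) => // a.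
  have := xS a; have := y1 a; have := y2 a.
  rewrite /center /= !side_dy.
  move: (2 ^ K)%R (pow2_gt0 (R := R) K) K1 (corner (dy K _) a) => u u0 K1' c.
  by move=> /andP[? ?] /andP[? ?] /andP[? ?]; apply/andP; split; lra.
rewrite sumEFin lee_fin big_const_seq count_predT sns iter_addr_0.
rewrite -[X in (X <= _)%R]mulr_natl natrX mulrCA.
have -> : (4 ^+ d = 2 ^+ d * 2 ^+ d :> R)%R.
  by rewrite -exprMn -natrM.
have -> : (2 ^+ d * 2 ^+ d * t * side S ^+ d =
           t * (2 ^+ d * (2 * side S) ^+ d) :> R)%R by rewrite exprMn; ring.
rewrite ler_pM2l// ler_pM2l ?exprn_gt0//.
by rewrite lerXn2r ?nnegrE ?exprz_ge0// mulr_ge0 ?ltW ?side_gt0.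
Qed.

End weak_type.

(** * Calderon-Zygmund decomposition *)

Section good_bad.
Context {R : realType} {d : nat}.
Implicit Types (L Q : cube R d) (f h : Rd R d -> R[i]).

Lemma normc_cintegral_le h (B : R) : cmeasurable h ->
  (\int[leb d]_x (normc (h x))%:E <= B%:E)%E ->
  normc (cintegral (leb d) h) <= 2 * B.
Proof.
move=> [rh Ih] hB; rewrite (le_trans (normc_le_ReIm _))//= mulrDl mul1r.
have mn : measurable_fun setT (fun x => (normc (h x))%:E).
  by apply/measurable_EFinP; exact: measurable_normc.
have aux (u : Rd R d -> R) : measurable_fun setT u ->
    (forall x, `|u x| <= normc (h x)) -> `|(\int[leb d]_x u x)| <= B.
  move=> mu uh; have iu : (leb d).-integrable setT (EFin \o u).
    apply/integrableP; split; first exact/measurable_EFinP.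
    apply: le_lt_trans (ltry B); apply: le_trans hB.
    apply: ge0_le_integral => //.
      by apply: measurableT_comp => //; exact/measurable_EFinP.
    by move=> x _; rewrite /= lee_fin.
  rewrite -lee_fin EFin_normr_Rintegral//.
  apply: le_trans (le_abse_integral _ _ _) _ => //; first exact/measurable_EFinP.
  apply: le_trans hB; apply: ge0_le_integral => //.
    by apply: measurableT_comp => //; exact/measurable_EFinP.
  by move=> x _; rewrite /= lee_fin.
by apply: lerD; apply: aux => // x; [exact: normr_Re_le|exact: normr_Im_le].
Qed.

Lemma cintegrable_cut_cube L f (N : R) : cmeasurable f ->
  (forall x, normc (f x) <= N) -> cintegrable (leb d) (cut (cube_set L) f).
Proof.
move=> mf fN; apply: (@cintegrable_dom _ _ _ _ _ (fun x => N * \1_(cube_set L) x)).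
- by apply: cmeasurable_cut => //; exact: measurable_cube.
- apply: (@integrableZl _ _ _ _ _ _ N (fun x => (\1_(cube_set L) x)%:E)) => //.
  apply/integrableP; split.
    by apply/measurable_EFinP; apply: measurable_indic; exact: measurable_cube.
  under eq_integral do rewrite /= ger0_norm//.
  rewrite integral_indic//; last exact: measurable_cube.
  apply: le_lt_trans (ltry (side L ^+ d)); rewrite -volE /vol setIT.
  exact: lexx.
- move=> x; rewrite /cut indicE; case: ifP => _; first by rewrite mulr1.
  by rewrite normc0 mulr0.
Qed.

Lemma cintegral_cut_cst L (c : R[i]) :
  cintegral (leb d) (cut (cube_set L) (fun=> c)) = ((side L ^+ d)%:C)%C * c.
Proof.
have aux (a : R) : \int[leb d]_x (if x \in cube_set L then a else 0) = side L ^+ d * a.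
  transitivity (\int[leb d]_(x in cube_set L) a).
    by rewrite [RHS]Rintegral_mkcond; apply: eq_Rintegral => x _; rewrite patchE.
  rewrite Rintegral_cst; last exact: measurable_cube.
  by rewrite mulrC; congr (_ * _); have := congr1 fine (volE L).
case: c => a b; rewrite /cintegral.
under eq_Rintegral do rewrite /cut (fun_if (@complex.Re R))/=.
under [X in Complex _ X]eq_Rintegral do rewrite /cut (fun_if (@complex.Im R))/=.
rewrite !aux; apply/eqP; rewrite eq_complex /=.
by rewrite !mul0r subr0 addr0 !eqxx.
Qed.

Definition mean L f : R[i] :=
  (((side L ^+ d)^-1)%:C)%C * cintegral (leb d) (cut (cube_set L) f).

Lemma cintegral_sub_mean L f (N : R) : cmeasurable f ->
  (forall x, normc (f x) <= N) ->
  cintegral (leb d) (cut (cube_set L) (fun x => f x - mean L f)) = 0.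
Proof.
move=> mf fN.
have -> : cut (cube_set L) (fun x => f x - mean L f) =
  fun x => cut (cube_set L) f x + cut (cube_set L) (fun=> - mean L f) x.
  by apply/funext => x; rewrite /cut; case: ifP; rewrite ?addr0.
rewrite cintegralD; last 2 first.
- exact: cintegrable_cut_cube fN.
- by apply: (@cintegrable_cut_cube _ _ (normc (- mean L f))) => //; exact: cmeasurable_cst.
rewrite cintegral_cut_cst /mean mulrN mulrA -rmorphM/= mulfV; last first.
  by rewrite expf_neq0// gt_eqF// side_gt0.
by rewrite rmorph1 mul1r subrr.
Qed.

(** The pointwise bound [u <= t + t * (u / t) ^ r] replaces Jensen's inequality and gives [2 * t];
    the other factor 2 is that of [normc_cintegral_le], from treating real and imaginary parts
    separately. *)
Lemma normc_mean_le L f (t r : R) : cmeasurable f -> 0 < t -> 1 <= r ->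
  (\int[leb d]_(x in cube_set L) (normc (f x) `^ r)%:E <=
    (t `^ r * side L ^+ d)%:E)%E ->
  normc (mean L f) <= 4 * t.
Proof.
move=> mf t0 r1 fL; have s0 : 0 < side L ^+ d by rewrite exprn_gt0// side_gt0.
rewrite /mean normcM normc_real ger0_norm ?invr_ge0 ?(ltW s0)//.
rewrite ler_pdivrMl//.
have -> : side L ^+ d * (4 * t) = 2 * (2 * t * side L ^+ d) by ring.
apply: normc_cintegral_le.
  by apply: cmeasurable_cut => //; exact: measurable_cube.
have mL := measurable_cube L.
have mp := @measurable_normc_powR _ _ _ f r mf.
apply: (@le_trans _ _ (\int[leb d]_(x in cube_set L)
    (t%:E + (t / t `^ r)%:E * (normc (f x) `^ r)%:E))%E).
  rewrite [leRHS]integral_mkcond; apply: ge0_le_integral => //.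
  - by move=> x _; rewrite lee_fin normc_ge0.
  - by apply/measurable_EFinP; apply: measurable_normc; exact: cmeasurable_cut.
  - apply/(measurable_restrictT _ _).1 => //; apply: measurable_funTS.
    apply: emeasurable_funD => //; exact: emeasurable_funM.
  - move=> x _; rewrite patchE /cut; case: ifP => xL; last by rewrite normc0.
    rewrite -EFinM -EFinD lee_fin; set u := normc _.
    have u0 : 0 <= u by exact: normc_ge0.
    have [ut|tu] := leP u t.
      by rewrite (le_trans ut)// lerDl mulr_ge0 ?powR_ge0// divr_ge0 ?powR_ge0// ltW.
    have -> : t / t `^ r * u `^ r = t * (u / t) `^ r.
      have tr0 : t `^ r != 0 by rewrite gt_eqF// powR_gt0.
      have ut0 : 0 <= u / t by rewrite divr_ge0// ltW.
      have -> : u `^ r = (u / t) `^ r * t `^ r.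
        by rewrite -(powRM r ut0 (ltW t0)) divfK// lt0r_neq0.
      by rewrite [_ * t `^ r]mulrC mulrA divfK.
    have : u / t <= (u / t) `^ r by rewrite le1r_powR// ler_pdivlMr// mul1r ltW.
    rewrite ler_pdivrMr// mulrC => h.
    by rewrite (le_trans h)// lerDr ltW.
have c0 : (0 <= (t / t `^ r)%:E)%E by rewrite lee_fin divr_ge0 ?powR_ge0// ltW.
have p0 x : (0 <= (normc (f x) `^ r)%:E)%E by rewrite lee_fin powR_ge0.
rewrite ge0_integralD//; last 3 first.
- by move=> x _; rewrite lee_fin ltW.
- by move=> x _; rewrite mule_ge0.
- by apply: measurable_funTS; exact: emeasurable_funM.
rewrite integral_cst// ge0_integralZl//; last exact: measurable_funTS.
apply: (@le_trans _ _ (t%:E * vol L + (t / t `^ r)%:E * (t `^ r * side L ^+ d)%:E)%E).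
  by rewrite leeD2l// lee_wpmul2l// lee_fin divr_ge0 ?powR_ge0// ltW.
rewrite volE -!EFinM -EFinD lee_fin.
have tr : t `^ r != 0 by rewrite gt_eqF// powR_gt0.
by rewrite mulrA divfK// mulrDl mul1r mulrDl.
Qed.

End good_bad.

Section sup_norms.
Context {R : realType} {d : nat}.
Implicit Types (L Q S : cube R d) (f h : Rd R d -> R[i]).

(** The norm at [+oo] is the essential supremum only on a space of positive measure. *)
Lemma leb_setT_gt0 : (0 < leb d [set: Rd R d])%E.
Proof.
pose L : cube R d := ([tuple 0 | _ < d], PosNum (@ltr01 R)).
have h : (0 < vol L)%E by rewrite volE lte_fin exprn_gt0// side_gt0.
apply: (lt_le_trans h); apply: le_measure => //; apply/mem_set.
  exact: measurable_cube.
exact: measurableT.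
Qed.

Lemma cLnorm_infty_leP h (B : R) : (cLnorm (leb d) +oo h <= B%:E)%E <->
  {ae leb d, forall x, normc (h x) <= B}.
Proof.
rewrite /cLnorm unlock leb_setT_gt0; split=> [/ess_supP|hB].
  by apply: filterS => x /=; rewrite lee_fin ger0_norm ?normc_ge0.
apply/ess_supP; apply: filterS hB => x /=.
by rewrite lee_fin ger0_norm ?normc_ge0.
Qed.

Lemma cLnorm_infty_le h (B : R) : (forall x, normc (h x) <= B) ->
  (cLnorm (leb d) +oo h <= B%:E)%E.
Proof. by move=> hB; apply/cLnorm_infty_leP; exact: aeW. Qed.

Lemma Ynorm_infty (P : set (cube R d)) h : Ynorm P +oo h = cLnorm (leb d) +oo h.
Proof. by rewrite /Ynorm eqxx. Qed.

Lemma maximal_le (r B : R) h (z : Rd R d) : 1 <= r -> 0 <= B ->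
  (forall S, cube_set S z ->
    (\int[leb d]_(y in cube_set S) (normc (h y) `^ r)%:E <=
      (B `^ r * side S ^+ d)%:E)%E) ->
  (maximal r h z <= B%:E)%E.
Proof.
move=> r1 B0 hS; have r0 : 0 < r by rewrite (lt_le_trans ltr01).
apply: ge_ereal_sup => _ [S /= zS <-].
have s0 : 0 < side S ^+ d by rewrite exprn_gt0// side_gt0.
have -> : B%:E = ((B `^ r)%:E `^ r^-1)%E.
  by rewrite poweR_EFin -powRrM mulfV ?gt_eqF// powRr1.
have int0 : (0 <= \int[leb d]_(y in cube_set S) (normc (h y) `^ r)%:E)%E.
  by apply: integral_ge0 => y _; rewrite lee_fin powR_ge0.
rewrite volE inver gt_eqF//.
apply: gt0_ler_poweR; rewrite ?invr_ge0 ?(ltW r0)//.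
- by rewrite in_itv/= leey andbT mule_ge0// lee_fin invr_ge0 ltW.
- by rewrite in_itv/= leey andbT lee_fin powR_ge0.
apply: le_trans (lee_wpmul2l _ (hS _ zS)) _; first by rewrite lee_fin invr_ge0 ltW.
by rewrite -EFinM lee_fin mulrCA mulVf ?mulr1// gt_eqF.
Qed.

(** Off the shadow [h] is zero, so only the infima of the maximal function count, and one point [z]
    in each dilate bounds them. *)
Lemma Ynorm_le (P : set (cube R d)) (r B : R) h : 1 <= r -> 0 <= B ->
  (forall x, ~ shadow P x -> h x = 0) ->
  (forall L, P L -> exists z, dilate (2 ^+ 5) L z /\ forall S, cube_set S z ->
    (\int[leb d]_(y in cube_set S) (normc (h y) `^ r)%:E <=
      (B `^ r * side S ^+ d)%:E)%E) ->
  (Ynorm P r%:E h <= B%:E)%E.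
Proof.
move=> r1 B0 h0 hL; rewrite /Ynorm /= ge_max; apply/andP; split.
  apply: cLnorm_infty_le => x; rewrite /cut; case: ifPn => [|_]; last first.
    by rewrite normc0.
  by move=> /set_mem /= /h0 ->; rewrite normc0.
apply: ge_ereal_sup => _ [L PL <-]; have [z [zL hz]] := hL _ PL.
apply: (@le_trans _ _ (maximal r h z)); last exact: maximal_le.
by apply: ereal_inf_lbound; exists z.
Qed.

Lemma normcD_powR (r : R) (u v : R[i]) : 0 <= r ->
  normc (u + v) `^ r <= 2 `^ r * (normc u `^ r + normc v `^ r).
Proof.
move=> r0; pose M := Num.max (normc u) (normc v).
have M0 : 0 <= M by rewrite le_max normc_ge0.
have h : normc (u + v) <= 2 * M.
  rewrite (le_trans (le_normcD _ _))// mulrDl mul1r lerD// le_max lexx ?orbT//.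
apply: (@le_trans _ _ ((2 * M) `^ r)).
  by rewrite ge0_ler_powR// nnegrE ?normc_ge0 ?mulr_ge0.
rewrite powRM// ler_wpM2l ?powR_ge0//.
by rewrite /M; case: (leP (normc u) (normc v)) => _; [rewrite lerDr|rewrite lerDl]; exact: powR_ge0.
Qed.

End sup_norms.

Section calderon_zygmund.
Context {R : realType} {d : nat}.
Variables (P : set (cube R d)) (Q3 : cube R d) (f : Rd R d -> R[i]) (N : R).
Hypothesis finP : finite_set P.
Hypothesis disjP : forall L L' x, P L -> P L' -> cube_set L x ->
  cube_set L' x -> L = L'.
Hypothesis shadowP : shadow P = cube_set Q3.
Hypothesis mf : cmeasurable f.
Hypothesis fN : forall x, normc (f x) <= N.

Definition good_part x : R[i] :=
  \sum_(L \in P) cut (cube_set L) (fun=> mean L f) x.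

Definition bad_part x : R[i] := cut (cube_set Q3) f x - good_part x.

Let sub_Q3 L : P L -> cube_set L `<=` cube_set Q3.
Proof. by move=> PL x xL; rewrite -shadowP; exists L. Qed.

Lemma sum_cut_in (h : cube R d -> Rd R d -> R[i]) L x : P L -> cube_set L x ->
  \sum_(L' \in P) cut (cube_set L') (h L') x = h L x.
Proof.
move=> PL xL; rewrite -(cutT (h L) xL).
transitivity (\sum_(L' \in [set L]) cut (cube_set L') (h L') x); last first.
  by rewrite fsbig_set1.
apply/esym/fsbig_widen; first by move=> _ ->.
move=> L' [/= PL' LL']; rewrite cutF// => xL'.
by apply: LL'; exact: disjP xL' xL.
Qed.

Lemma sum_cut_out (h : cube R d -> Rd R d -> R[i]) x : ~ cube_set Q3 x ->
  \sum_(L' \in P) cut (cube_set L') (h L') x = 0.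
Proof.
move=> xQ; apply: fsbig1 => L PL; rewrite cutF// => xL.
by apply: xQ; exact: sub_Q3 xL.
Qed.

Lemma good_part_bounded (B : R) : 0 <= B ->
  (forall L, P L -> normc (mean L f) <= B) -> forall x, normc (good_part x) <= B.
Proof.
move=> B0 hB x; have [xQ|xQ] := pselect (cube_set Q3 x).
  have [L PL xL] : shadow P x by rewrite shadowP.
  by rewrite /good_part (sum_cut_in (fun L _ => mean L f) PL xL); exact: hB.
by rewrite /good_part (sum_cut_out (fun L _ => mean L f) xQ) normc0.
Qed.

Lemma cmeasurable_good_part : cmeasurable good_part.
Proof.
rewrite /good_part; under eq_fun do rewrite fsbig_finite//=.
apply: cmeasurable_sum => L; apply: cmeasurable_cut; first exact: measurable_cube.
exact: cmeasurable_cst.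
Qed.

Let mf3 : cmeasurable (cut (cube_set Q3) f).
Proof. by apply: cmeasurable_cut => //; exact: measurable_cube. Qed.

Lemma cmeasurable_bad_part : cmeasurable bad_part.
Proof. exact: (cmeasurableD mf3 (cmeasurableN cmeasurable_good_part)). Qed.

Lemma bad_partE x : bad_part x =
  \sum_(L \in P) cut (cube_set L) (fun y => f y - mean L f) x.
Proof.
rewrite /bad_part /good_part; have [xQ|xQ] := pselect (cube_set Q3 x).
  have [L PL xL] : shadow P x by rewrite shadowP.
  rewrite (sum_cut_in (fun L _ => mean L f) PL xL) (cutT f xQ).
  by rewrite (sum_cut_in (fun L y => f y - mean L f) PL xL).
rewrite (sum_cut_out (fun L _ => mean L f) xQ) (cutF f xQ) subr0.
by rewrite (sum_cut_out (fun L y => f y - mean L f) xQ).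
Qed.

Lemma bad_part_Xdot (p : \bar R) : (Ynorm P p bad_part < +oo)%E ->
  in_Xdot P p bad_part.
Proof.
move=> Yb; split; first by split => //; exact: cmeasurable_bad_part.
exists (fun L => cut (cube_set L) (fun y => f y - mean L f)); split.
  move=> L PL; split.
  - apply: cmeasurable_cut; first exact: measurable_cube.
    by apply: (cmeasurableD mf); exact: cmeasurable_cst.
  - move=> x; apply: contra_neqP => xL; exact: cutF.
  - exact: cintegral_sub_mean fN.
exact: bad_partE.
Qed.

Let shadow_off x : ~ shadow P x -> ~ cube_set Q3 x.
Proof. by rewrite shadowP. Qed.

(** An average over [L] is compared with the 32-fold dilate of [L], which contains [z]: hence
    [32 ^+ d]. Cell averages are then at most [4 * (C * a)]; adding them to [f] inside an [r]-th
    power costs two more factors 2, whence 16. *)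
Lemma calderon_zygmund_fin (r C1 a : R) : 1 <= r -> 1 <= C1 -> 0 < a ->
  (forall L, P L -> exists z, dilate (2 ^+ 5) L z /\ forall S, cube_set S z ->
    (\int[leb d]_(y in cube_set S) (normc (cut (cube_set Q3) f y) `^ r)%:E <=
      (C1 * a `^ r * side S ^+ d)%:E)%E) ->
  let B := 16 * (32 ^+ d * C1) * a in
  [/\ forall x, normc (good_part x) <= B,
      (Ynorm P r%:E bad_part <= B%:E)%E &
      (Ynorm P r%:E (cut (cube_set Q3) f) <= B%:E)%E].
Proof.
move=> r1 C11 a0 hL B.
have r0 : 0 <= r by rewrite (le_trans ler01).
pose C : R := 32 ^+ d * C1.
have d1 : 1 <= (32 : R) ^+ d by rewrite exprn_ege1// ler1n.
have C1' : C1 <= C by rewrite /C ler_peMl// (le_trans ler01).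
have C_ge1 : 1 <= C by rewrite (le_trans C11).
have C0 : 0 <= C by rewrite (le_trans ler01).
(* As [C] and [r] are at least 1, the constant moves inside the power; thus [B] does not depend on
   [r]. *)
have CaE : C * a `^ r <= (C * a) `^ r.
  by rewrite powRM ?(ltW a0)// ler_wpM2r ?powR_ge0// le1r_powR.
have Ca0 : 0 < C * a by rewrite mulr_gt0// (lt_le_trans ltr01).
have powR_Ca (k : R) : 1 <= k -> (C * a) `^ r <= (k * (C * a)) `^ r.
  move=> k1; apply: ge0_ler_powR => //; rewrite ?nnegrE ?(ltW Ca0)//.
    by rewrite mulr_ge0// ?(ltW Ca0)// (le_trans ler01).
  by rewrite ler_peMl// ltW.
have mean_le L : P L -> normc (mean L f) <= 4 * (C * a).
  move=> PL; apply: normc_mean_le r1 _ => //.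
  have [z [zL hz]] := hL _ PL.
  have p32 : 0 < (2 : R) ^+ 5 by rewrite exprn_gt0.
  pose L32 := dilc (PosNum p32) L.
  have L32E : dilate (2 ^+ 5) L = cube_set L32 := dilateE (PosNum p32) L.
  have mp := @measurable_normc_powR _ _ _ _ r mf3.
  apply: (@le_trans _ _ (\int[leb d]_(y in cube_set L32)
      (normc (cut (cube_set Q3) f y) `^ r)%:E)%E).
    rewrite (@eq_integral _ _ _ (leb d) (cube_set L)
      (fun y => (normc (cut (cube_set Q3) f y) `^ r)%:E)); last first.
      by move=> y /set_mem yL; rewrite cutT//; exact: sub_Q3 yL.
    apply: ge0_subset_integral => //; [exact: measurable_cube..| | |].
    - exact: measurable_funTS.
    - by move=> y _; rewrite lee_fin powR_ge0.
    - rewrite -L32E => y yL b; have := yL b; rewrite /center.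
      have := side_gt0 L; have -> : (2 : R) ^+ 5 = 32 by ring.
      move: (side L) (corner L b) (coord y b) => u c v u0 /andP[? ?].
      by apply/andP; split; lra.
  apply: le_trans (hz L32 _) _; first by rewrite -L32E.
  rewrite lee_fin side_dilc exprMn /= mulrA ler_wpM2r ?exprn_ge0 ?(ltW (side_gt0 _))//.
  rewrite mulrC mulrA; apply: le_trans CaE; rewrite /C.
  by rewrite -[X in (X ^+ d)]natrX.
have g_le : forall x, normc (good_part x) <= 4 * (C * a).
  by apply: good_part_bounded mean_le; rewrite mulr_ge0// ltW.
have BE : B = 16 * (C * a) by rewrite /B /C !mulrA.
have B0 : 0 <= B by rewrite BE mulr_ge0// ltW.
split.
- by move=> x; rewrite (le_trans (g_le x))// BE ler_pM2r// ler_nat.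
- apply: Ynorm_le => //.
    by move=> x /shadow_off xQ; rewrite bad_partE sum_cut_out.
  move=> L PL; have [z [zL hz]] := hL _ PL; exists z; split=> // S zS.
  have s0 : 0 <= side S ^+ d by rewrite exprn_ge0// ltW// side_gt0.
  pose G : R := (4 * (C * a)) `^ r.
  have mp := @measurable_normc_powR _ _ _ _ r mf3.
  have mS := measurable_cube S.
  apply: (@le_trans _ _ (\int[leb d]_(y in cube_set S)
      ((2 `^ r)%:E * ((normc (cut (cube_set Q3) f y) `^ r)%:E + G%:E)))%E).
    apply: ge0_le_integral => //.
    - by move=> y _; rewrite lee_fin powR_ge0.
    - by apply: measurable_funTS; apply: measurable_normc_powR; exact: cmeasurable_bad_part.
    - apply: measurable_funTS; apply: emeasurable_funM => //.
      exact: emeasurable_funD.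
    - move=> y _; rewrite -EFinD -EFinM lee_fin /bad_part.
      apply: le_trans (normcD_powR _ _ r0) _.
      rewrite ler_wpM2l ?powR_ge0// lerD2l normcN /G.
      apply: ge0_ler_powR => //; rewrite ?nnegrE ?normc_ge0//.
      by rewrite mulr_ge0// ltW.
  have p0 y : (0 <= (normc (cut (cube_set Q3) f y) `^ r)%:E)%E.
    by rewrite lee_fin powR_ge0.
  have G0 : (0 <= G%:E)%E by rewrite lee_fin powR_ge0.
  have two0 : (0 <= (2 `^ r : R)%:E)%E by rewrite lee_fin powR_ge0.
  have mpG : measurable_fun (cube_set S)
      (fun y => ((normc (cut (cube_set Q3) f y) `^ r)%:E + G%:E)%E).
    by apply: measurable_funTS; exact: emeasurable_funD.
  rewrite (ge0_integralZl (leb d) mS mpG (fun y _ => adde_ge0 (p0 y) G0) two0).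
  rewrite (ge0_integralD (leb d) mS (fun y _ => p0 y) (measurable_funTS mp)
    (fun _ _ => G0) (measurable_cst _)).
  rewrite integral_cst//.
  apply: (@le_trans _ _ ((2 `^ r)%:E * ((C1 * a `^ r * side S ^+ d)%:E + G%:E * vol S))%E).
    by rewrite lee_wpmul2l ?lee_fin ?powR_ge0// leeD2r// hz.
  rewrite volE -(EFinM G) -EFinD -EFinM lee_fin -mulrDl mulrA ler_wpM2r//.
  have hG : C1 * a `^ r <= G.
    apply: (@le_trans _ _ (C * a `^ r)); first by rewrite ler_wpM2r ?powR_ge0.
    by rewrite (le_trans CaE)// /G powR_Ca// ler1n.
  apply: (@le_trans _ _ (2 `^ r * (2 `^ r * G))).
    rewrite ler_wpM2l ?powR_ge0//.
    apply: (@le_trans _ _ (2 * G)); first by rewrite mulrDl mul1r lerD2r.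
    by rewrite ler_wpM2r ?powR_ge0// le1r_powR// ler1n.
  have h4 : 0 <= 4 * (C * a) by rewrite mulr_ge0// ltW.
  have -> : B = 2 * (2 * (4 * (C * a))) by rewrite BE; ring.
  by rewrite /G !(powRM r (ler0n R 2))// mulr_ge0.
- apply: Ynorm_le => //; first by move=> x /shadow_off xQ; rewrite cutF.
  move=> L PL; have [z [zL hz]] := hL _ PL; exists z; split=> // S zS.
  apply: le_trans (hz _ zS) _.
  rewrite lee_fin ler_wpM2r ?exprn_ge0 ?(ltW (side_gt0 _))//.
  apply: (@le_trans _ _ (C * a `^ r)); first by rewrite ler_wpM2r ?powR_ge0.
  by rewrite (le_trans CaE)// BE powR_Ca// ler1n.
Qed.

(** The norm at [+oo] is the plain essential supremum, and the bounds [2 * a], [3 * a] and [a] come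
    out directly. They are relaxed to the [B] of the finite case so that all exponents share one
    constant. *)
Lemma calderon_zygmund_infty (C1 a : R) : 1 <= C1 -> 0 < a ->
  (cLnorm (leb d) +oo (cut (cube_set Q3) f) <= a%:E)%E ->
  let B := 16 * (32 ^+ d * C1) * a in
  [/\ forall x, normc (good_part x) <= B,
      (Ynorm P +oo bad_part <= B%:E)%E &
      (Ynorm P +oo (cut (cube_set Q3) f) <= B%:E)%E].
Proof.
move=> C11 a0 fa B.
have CB : 1 <= 32 ^+ d * C1 by rewrite mulr_ege1// exprn_ege1// ler1n.
have aB : 16 * a <= B by rewrite /B ler_pM2r// ler_peMr.
have fa' := (cLnorm_infty_leP _ _).1 fa.
have mean_le L : P L -> normc (mean L f) <= 2 * a.
  move=> PL; have s0 : 0 < side L ^+ d by rewrite exprn_gt0// side_gt0.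
  rewrite /mean normcM normc_real ger0_norm ?invr_ge0 ?(ltW s0)// ler_pdivrMl//.
  rewrite mulrCA; apply: normc_cintegral_le.
    by apply: cmeasurable_cut => //; exact: measurable_cube.
  have mL := measurable_cube L.
  apply: (@le_trans _ _ (\int[leb d]_(x in cube_set L) a%:E)%E).
    rewrite [leRHS]integral_mkcond; apply: ae_ge0_le_integral => //.
    - by move=> x _; rewrite lee_fin normc_ge0.
    - by apply/measurable_EFinP; apply: measurable_normc; exact: cmeasurable_cut.
    - by move=> x _; rewrite patchE; case: ifP => // _; rewrite lee_fin ltW.
    - exact/(measurable_restrictT _ _).1.
    apply: filterS fa' => x h _; rewrite patchE /cut; case: ifPn => xL.
      by rewrite lee_fin (le_trans _ h)// cutT//; apply: sub_Q3 PL _ _; exact: set_mem.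
    by rewrite normc0.
  rewrite integral_cst//; apply: (@le_trans _ _ (a%:E * vol L)%E) => //.
  by rewrite volE -EFinM lee_fin mulrC.
have g_le : forall x, normc (good_part x) <= 2 * a.
  by apply: good_part_bounded mean_le; rewrite mulr_ge0// ltW.
split.
- by move=> x; rewrite (le_trans (g_le x))// (le_trans _ aB)// ler_pM2r// ler_nat.
- rewrite Ynorm_infty; apply/cLnorm_infty_leP; apply: filterS fa' => x h.
  rewrite /bad_part (le_trans (le_normcD _ _))// normcN (le_trans _ aB)//.
  by have := g_le x; lra.
- rewrite Ynorm_infty (le_trans fa)// lee_fin (le_trans _ aB)// ler_peMl ?(ltW a0)//.
  by rewrite ler1n.
Qed.

End calderon_zygmund.

(** * Local forms and stopping forms *)

Section local_forms.
Context {R : realType} {d m : nat}.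
Implicit Types (L Q : cube R d) (f g h : 'I_m.+1 -> Rd R d -> R[i]).

Lemma finite_int_itv (mu nu : int) : finite_set [set s : int | mu < s < nu].
Proof.
apply: (@sub_finite_set _ _ ((fun k : nat => mu + k%:Z) @` `I_`|nu - mu|%N)).
  move=> s /= /andP[h1 h2]; exists `|s - mu|%N; last by lia.
  by rewrite /=; lia.
by apply: finite_image; exact: finite_II.
Qed.

Definition local_scales (mu nu : int) (Q : cube R d) :=
  [set s : int | mu < s < nu /\ s%:~R <= scale Q].

Lemma local_scales_finite mu nu Q : finite_set (local_scales mu nu Q).
Proof. by apply: sub_finite_set (finite_int_itv mu nu) => s []. Qed.

Variable Ks : int -> Rdn R d m.+1 -> R[i].

Lemma local_formE mu nu Q f :
  local_form Ks mu nu Q f = scale_form Ks (local_scales mu nu Q) (cut_first Q f).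
Proof. by []. Qed.

Lemma local_form_low mu nu (k : int) Q f : scale Q = k%:~R -> k <= mu ->
  local_form Ks mu nu Q f = 0.
Proof.
move=> Qs kmu; rewrite local_formE.
have -> : local_scales mu nu Q = set0; last exact: scale_form_set0.
apply/seteqP; split=> // s [/andP[h1 _]]; rewrite Qs ler_int => h2.
by have := lt_le_trans h1 (le_trans h2 kmu); rewrite ltxx.
Qed.

Hypothesis supp_Ks : forall s x, Ks s x != 0 ->
  forall k l : 'I_m.+1, dist (tnth x k) (tnth x l) <= 2 ^ s.

Lemma near_cube (s k : int) (x : Rdn R d m.+1) (Q : cube R d) :
  side Q = 2 ^ k -> s <= k -> Ks s x != 0 -> cube_set Q (tnth x ord0) ->
  forall i, cube_set (dilc 3%:pos Q) (tnth x i).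
Proof.
move=> Qk sk Kx xQ i a; have := xQ a.
have := le_trans (dist_coord _ _ a) (supp_Ks Kx i ord0).
have : 2 ^ s <= 2 ^ k :> R by rewrite ler_weXz2l// ler1n.
rewrite corner_dilc side_dilc /center Qk ler_norml /=.
move: (2 ^ s) (2 ^ k) (coord (tnth x i) a) (coord (tnth x ord0) a) (corner Q a).
move=> u v y z c uv /andP[? ?] /andP[? ?].
by apply/andP; split; lra.
Qed.

Lemma local_form_eq mu nu (k : int) Q f g : side Q = 2 ^ k -> scale Q = k%:~R ->
  (forall i x, cube_set (dilc 3%:pos Q) x -> f i x = g i x) ->
  local_form Ks mu nu Q f = local_form Ks mu nu Q g.
Proof.
move=> Qk Qs fg; rewrite !local_formE; apply: scale_form_eq.
  exact: local_scales_finite.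
move=> s x [_]; rewrite Qs ler_int => sk Kx; rewrite /tensor.
have [xQ|xQ] := pselect (cube_set Q (tnth x ord0)); last first.
  by rewrite !big_ord_recl !cut_first0 !cutF// !mul0r.
have near := near_cube Qk sk Kx xQ.
apply: eq_bigr => i _; have [->|i0] := eqVneq i ord0.
  by rewrite !cut_first0 !cutT//; exact: fg.
by rewrite !cut_first_neq//; exact: fg.
Qed.

End local_forms.

(** * Local forms bounded by the norm of the truncations *)

Section truncated_norm.
Context {R : realType} {d m : nat}.
Implicit Types (L Q : cube R d) (f g h : 'I_m.+1 -> Rd R d -> R[i]).

(** The exponent [fine q^-1] is 0 at [q = +oo], so one formula covers all [q]. *)
Lemma cLnorm_le_cube (q : \bar R) (Q : cube R d) (h : Rd R d -> R[i]) (A : R) :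
  (1 <= q)%E -> 0 <= A -> cmeasurable h -> (forall x, ~ cube_set Q x -> h x = 0) ->
  {ae leb d, forall x, normc (h x) <= A} ->
  (cLnorm (leb d) q h <= (A * (side Q ^+ d) `^ fine q^-1)%:E)%E.
Proof.
move=> q1 A0 mh h0 hA.
case: q q1 => [q| |//]; last first.
  by move=> _; rewrite /= powRr0 mulr1; apply/cLnorm_infty_leP.
rewrite lee_fin => q1; have q0 : 0 < q by rewrite (lt_le_trans ltr01).
have s0 : 0 < side Q ^+ d by rewrite exprn_gt0// side_gt0.
have mQ := measurable_cube Q.
have mp := measurable_normc_powR q mh.
have Aq0 : (0 <= (A `^ q)%:E)%E by rewrite lee_fin powR_ge0.
have hi : (\int[leb d]_x (normc (h x) `^ q)%:E <= (A `^ q * side Q ^+ d)%:E)%E.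
  apply: (@le_trans _ _ (\int[leb d]_(x in cube_set Q) (A `^ q)%:E)%E).
    rewrite [leRHS]integral_mkcond; apply: ae_ge0_le_integral => //.
    - by move=> x _; rewrite lee_fin powR_ge0.
    - by move=> x _; rewrite patchE; case: ifP.
    - exact/(measurable_restrictT _ _).1.
    apply: filterS hA => x hx _; rewrite patchE; case: ifPn => [_|/negP xQ].
      by rewrite lee_fin ge0_ler_powR ?nnegrE ?normc_ge0// ltW.
    rewrite h0; first by rewrite normc0 powR0// gt_eqF.
    by move=> xQ'; apply: xQ; exact/mem_set.
  rewrite integral_cst//.
  apply: (@le_trans _ _ ((A `^ q)%:E * vol Q)%E) => //.
  by rewrite volE -EFinM.
rewrite /cLnorm unlock inver gt_eqF//=.
have -> : (A * (side Q ^+ d) `^ q^-1)%:E = ((A `^ q * side Q ^+ d)%:E `^ q^-1)%E.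
  rewrite poweR_EFin powRM ?powR_ge0 ?(ltW s0)//.
  by rewrite -powRrM mulfV ?gt_eqF// powRr1.
apply: gt0_ler_poweR; first by rewrite invr_ge0 ltW.
- by rewrite in_itv/= leey andbT integral_ge0// => x _; rewrite poweR_ge0.
- by rewrite in_itv/= leey andbT lee_fin mulr_ge0 ?powR_ge0// ltW.
apply: le_trans hi; rewrite le_eqVlt; apply/orP; left; apply/eqP.
by apply: eq_integral => x _; rewrite /= ger0_norm ?normc_ge0// poweR_EFin.
Qed.

Variables (r : 'I_m -> \bar R) (alpha : \bar R).
Hypothesis r_ge1 : forall i, (1 <= r i)%E.
Hypothesis alpha_ge1 : (1 <= alpha)%E.
Hypothesis sum_r : (\sum_(i < m) (r i)^-1 = alpha^-1)%E.

Definition dual_exponent (i : 'I_m.+1) : \bar R :=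
  if unlift ord_max i is Some j then r j else hoelder_conjugate alpha.

Lemma dual_exponent_ge1 i : (1 <= dual_exponent i)%E.
Proof.
rewrite /dual_exponent; case: unliftP => [j _|_]; first exact: r_ge1.
exact: hoelder_conj_ge1.
Qed.

Lemma inve_ge1_fin (q : \bar R) : (1 <= q)%E -> (q^-1 = (fine q^-1)%:E)%E.
Proof.
case: q => [q| |//] //=; rewrite lee_fin => q1.
by rewrite inver gt_eqF// (lt_le_trans ltr01).
Qed.

Lemma sum_dual_exponent : \sum_(i < m.+1) fine (dual_exponent i)^-1 = 1.
Proof.
have E : (\sum_(i < m.+1) (dual_exponent i)^-1 = 1)%E.
  rewrite big_ord_recr/= (eq_bigr (fun i => (r i)^-1)%E); last first.
    move=> i _; congr (_^-1)%E; rewrite /dual_exponent.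
    have -> : widen_ord (leqnSn m) i = lift ord_max i.
      by apply: val_inj; rewrite /= /bump leqNgt ltn_ord.
    by rewrite liftK.
  rewrite sum_r /dual_exponent unlift_none.
  apply: hoelder_conjugate_eq1.
    by rewrite (lt_le_trans _ alpha_ge1)// ltNyr.
  by rewrite gt_eqF// (lt_le_trans _ alpha_ge1)// lte01.
apply: EFin_inj; rewrite -sumEFin -[RHS]E.
by apply: eq_bigr => i _; rewrite -inve_ge1_fin//; exact: dual_exponent_ge1.
Qed.

Variable Ks : int -> Rdn R d m.+1 -> R[i].
Hypothesis mKs : forall s, cmeasurable (Ks s).
Hypothesis supp_Ks : forall s x, Ks s x != 0 ->
  forall k l : 'I_m.+1, dist (tnth x k) (tnth x l) <= 2 ^ s.
Hypothesis Ksize : exists q : \bar R, (1 <= q)%E /\ (kernel_size Ks q < +oo)%E.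
Hypothesis CToo : (CT Ks r alpha < +oo)%E.

Lemma CT_ge0 : (0 <= CT Ks r alpha)%E.
Proof.
apply: (@le_trans _ _ (normc (trunc_form Ks 0 1 (fun=> fun=> 0)))%:E).
  by rewrite lee_fin normc_ge0.
apply: (@le_trans _ _ (form_norm dual_exponent (trunc_form Ks 0 1))); last first.
  by apply: ereal_sup_ubound; exists (0, 1).
apply: ereal_sup_ubound; exists (fun=> fun=> 0) => // i; split.
  exact: cmeasurable_cst.
rewrite /cLnorm.
have -> : (fun=> (normc (0 : R[i]))%:E) = cst 0%E :> (Rd R d -> \bar R).
  by apply/funext => x; rewrite normc0.
rewrite Lnorm0 ?lee01// gt_eqF// (lt_le_trans _ (dual_exponent_ge1 i))//.
Qed.

(* Normalise each [g i] on [3Q] in its own Lebesgue space: the exponents add up to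
   1, so the powers of the volume of [3Q] multiply to that volume. *)
Lemma local_form_CT mu nu (k : int) Q g (A : 'I_m.+1 -> R) : mu < nu ->
  side Q = 2 ^ k -> scale Q = k%:~R -> bounded_measurable g ->
  (forall i, 0 < A i) ->
  (forall i, {ae leb d, forall x,
    normc (cut (cube_set (dilc 3%:pos Q)) (g i) x) <= A i}) ->
  normc (local_form Ks mu nu Q g) <=
    fine (CT Ks r alpha) * (3 * 2 ^ k) ^+ d * \prod_i A i.
Proof.
move=> munu Qk Qs [mg [N gN]] A0 gA.
have p0 : 0 <= \prod_i A i by apply: prodr_ge0 => i _; exact: ltW.
have CT0 : 0 <= fine (CT Ks r alpha) by rewrite fine_ge0// CT_ge0.
have v0 : 0 < (3 * 2 ^ k : R) ^+ d by rewrite exprn_gt0// mulr_gt0// pow2_gt0.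
have [kmu|muk] := leP k mu.
  by rewrite (local_form_low _ _ _ Qs kmu) normc0 !mulr_ge0// ltW.
set Q3 := dilc 3%:pos Q in gA.
pose h i := cut (cube_set Q3) (g i).
have bh : bounded_measurable h.
  split=> [i|]; first by apply: cmeasurable_cut => //; exact: measurable_cube.
  by exists N => i x; rewrite (le_trans (normc_cut _ _ _)).
rewrite (local_form_eq supp_Ks (g := h) mu nu Qk Qs); last first.
  by move=> i x xQ; rewrite /h cutT.
(* Scales are integers, so [s <= k] is [s < k + 1]: the local form is a truncated form with a lower
   cutoff at the top. *)
pose nu' := Num.min nu (k + 1).
have munu' : mu < nu' by rewrite lt_min munu/=; lia.
have scE : local_scales mu nu Q = [set s : int | mu < s < nu'].
  apply/seteqP; split=> s.
    by move=> [/andP[h1 h2]]; rewrite Qs ler_int => h3; rewrite /= lt_min h1 h2/=; lia.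
  rewrite /= lt_min => /and3P[h1 h2 h3]; split; first by rewrite h1.
  by rewrite Qs ler_int; lia.
rewrite local_formE scE.
pose e i : R := fine (dual_exponent i)^-1.
pose c i : R := A i * ((3 * 2 ^ k) ^+ d) `^ e i.
have c0 i : 0 < c i by rewrite mulr_gt0// powR_gt0.
pose u i x : R[i] := (((c i)^-1)%:C)%C * cut_first Q h i x.
have fS : finite_set [set s : int | mu < s < nu'] by exact: finite_int_itv.
have uE := local_scale_form_scale mKs supp_Ks Ksize Q (fun i => (c i)^-1) fS bh.
have uCT : normc (scale_form Ks [set s : int | mu < s < nu'] u) <=
    fine (CT Ks r alpha).
  rewrite -lee_fin fineK ?ge0_fin_numE ?CT_ge0//.
  apply: (@le_trans _ _ (form_norm dual_exponent (trunc_form Ks mu nu'))); last first.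
    by apply: ereal_sup_ubound; exists (mu, nu').
  apply: ereal_sup_ubound; exists u => // i.
  have mui : cmeasurable (u i).
    apply: cmeasurableM; first exact: cmeasurable_cst.
    exact: (cut_first_bounded Q bh).1.
  split=> //.
  have cu x : normc (cut_first Q h i x) <= normc (h i x).
    have [->|i0] := eqVneq i ord0; last by rewrite cut_first_neq.
    by rewrite cut_first0 normc_cut.
  apply: le_trans (cLnorm_le_cube (dual_exponent_ge1 i) _ mui _
    (Q := Q3) (A := (c i)^-1 * A i) _) _.
  - by rewrite mulr_ge0 ?invr_ge0 ?ltW.
  - move=> x xQ; rewrite /u; apply/eqP; rewrite mulf_eq0 -!normc_eq0; apply/orP; right.
    by rewrite eq_le normc_ge0 andbT (le_trans (cu x))// /h cutF// normc0.
  - apply: filterS (gA i) => x hx; rewrite /u normcM normc_real.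
    rewrite ger0_norm ?invr_ge0 ?(ltW (c0 i))// ler_wpM2l ?invr_ge0 ?(ltW (c0 i))//.
    exact: le_trans (cu x) hx.
  - rewrite side_dilc Qk lee_fin -mulrA -/(c i) mulVf//.
    by rewrite gt_eqF.
rewrite uE normcM normc_real in uCT.
have pc0 : 0 < \prod_i c i by apply: prodr_gt0.
have pcE : \prod_i (c i)^-1 = (\prod_i c i)^-1 by rewrite prodfV.
rewrite pcE ger0_norm ?invr_ge0 ?(ltW pc0)// in uCT.
rewrite ler_pdivrMl// in uCT; apply: le_trans uCT _.
rewrite mulrC -mulrA ler_wpM2l// /c big_split/= mulrC ler_wpM2r//.
have -> : \prod_(i < m.+1) ((3 * 2 ^ k : R) ^+ d) `^ e i =
          ((3 * 2 ^ k) ^+ d) `^ (\sum_(i < m.+1) e i).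
  elim/big_ind2: _ => [|x1 x2 y1 y2 -> ->|//]; first by rewrite powRr0.
  by rewrite powRD// (gt_eqF v0) implybT.
by rewrite sum_dual_exponent powRr1// ltW.
Qed.

End truncated_norm.

Lemma measure_bigsetU_le {disp} {T : measurableType disp} {R : realType}
    (mu : {measure set T -> \bar R}) (I : Type) (s : seq I) (B : I -> set T) :
  (forall i, measurable (B i)) ->
  (mu (\big[setU/set0]_(i <- s) B i) <= \sum_(i <- s) mu (B i))%E.
Proof.
move=> mB; elim: s => [|i s IH]; first by rewrite !big_nil measure0.
rewrite !big_cons; apply: le_trans (leeD2l _ IH); apply: measureU2 => //.
exact: bigsetU_measurable.
Qed.

(** * The exceptional set of a tuple of functions *)

Section exceptional_set.
Context {R : realType} {d : nat}.
Variables (I : finType) (o : d.-tuple R) (K : int) (nQ : {ffun 'I_d -> int}).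
Hypothesis d_gt0 : (0 < d)%N.
Hypothesis I_gt0 : (0 < #|I|)%N.
Local Notation dy := (dy o).
Local Notation Q3 := (dilc 3%:pos (dy K nQ)).
Variables (f : I -> Rd R d -> R[i]) (a : I -> R) (p : I -> \bar R).
Hypothesis mf : forall i, cmeasurable (f i).
Hypothesis a_gt0 : forall i, 0 < a i.
Hypothesis fa : forall i r, p i = r%:E ->
  (\int[leb d]_x (normc (cut (cube_set Q3) (f i) x) `^ r)%:E <=
    (a i `^ r * (3 * 2 ^ K) ^+ d)%:E)%E.

(** The weak-type bound loses [3 ^+ d] and the volume of [3Q] another [3 ^+ d]; with the threshold
    [lam] the union over [I] has measure at most [(9 / 64) ^+ d] times that of [Q]. This is below
    one half, and it makes a cube whose ninefold dilate fits inside at least 64 times smaller than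
    [Q]. *)
Let lam : R := #|I|%:R * 64 ^+ d.

Let lam_gt0 : 0 < lam.
Proof. by rewrite mulr_gt0 ?ltr0n// exprn_gt0. Qed.

Let F i (x : Rd R d) : \bar R := (normc (cut (cube_set Q3) (f i) x) `^ fine (p i))%:E.

Let mF i : measurable_fun setT (F i).
Proof.
apply: measurable_normc_powR; apply: cmeasurable_cut => //.
exact: measurable_cube.
Qed.

Let F0 i x : (0 <= F i x)%E.
Proof. by rewrite lee_fin powR_ge0. Qed.

(** An exponent [+oo] contributes nothing: the bound on [f i] then holds almost everywhere on
    [3Q]. *)
Let E i : set (Rd R d) := if p i \is a fin_num
  then bad_set o (F i) (lam * a i `^ fine (p i)) else set0.

Let t_gt0 i : 0 < lam * a i `^ fine (p i).
Proof. by rewrite mulr_gt0// powR_gt0. Qed.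

Let M i : R := a i `^ fine (p i) * (3 * 2 ^ K) ^+ d.

Let FM i : p i \is a fin_num -> (\int[leb d]_x F i x <= (M i)%:E)%E.
Proof. by move=> pi; apply: fa; rewrite fineK. Qed.

Let mE i : measurable (E i).
Proof.
rewrite /E; case: ifPn => [pi|_]; last exact: measurable0.
exact: (measurable_bad_set o d_gt0 (mF i) (F0 i) (t_gt0 i) (FM pi)).
Qed.

Let v_gt0 : 0 < (2 ^ K : R) ^+ d.
Proof. by rewrite exprn_gt0// pow2_gt0. Qed.

Let Ele i : (leb d (E i) <= (#|I|%:R^-1 * ((9 / 64) ^+ d * (2 ^ K) ^+ d))%:E)%E.
Proof.
rewrite /E; case: ifPn => [pi|_]; last first.
  by rewrite measure0 lee_fin !mulr_ge0 ?exprn_ge0// ?ltW ?invr_ge0// pow2_gt0.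
have := bad_set_measure o d_gt0 (mF i) (F0 i) (t_gt0 i) (FM pi).
rewrite -lee_pdivlMl// => /le_trans; apply.
rewrite -EFinM lee_fin ler_pdivrMl// /M /lam.
have I0 : (#|I|%:R : R) != 0 by rewrite gt_eqF// ltr0n.
have e64 : (64 : R) ^+ d != 0 by rewrite gt_eqF// exprn_gt0.
have -> : (9 / 64 : R) ^+ d = 3 ^+ d * 3 ^+ d / 64 ^+ d.
  by rewrite -exprMn -natrM expr_div_n.
rewrite exprMn le_eqVlt; apply/orP; left; apply/eqP.
move: (a i `^ _) (3 ^+ d) (64 ^+ d) ((2 ^ K) ^+ d) #|I|%:R e64 I0 => x y z v w e64 I0.
by field; rewrite I0 e64.
Qed.

Definition exceptional_set : set (Rd R d) :=
  \big[setU/set0]_(i <- index_enum I) E i.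

Lemma measurable_exceptional_set : measurable exceptional_set.
Proof. exact: bigsetU_measurable. Qed.

Lemma exceptional_set_measure :
  (leb d exceptional_set <= ((9 / 64) ^+ d * (2 ^ K) ^+ d)%:E)%E.
Proof.
apply: le_trans (measure_bigsetU_le _ _ mE) _.
apply: (@le_trans _ _ (\sum_(i : I)
    (#|I|%:R^-1 * ((9 / 64) ^+ d * (2 ^ K) ^+ d))%:E)%E).
  by apply: lee_sum => i _; exact: Ele.
rewrite sumEFin lee_fin sumr_const (_ : #|_| = #|I|)//.
rewrite -mulrnAl -[(_^-1) *+ _]mulr_natr mulVf ?mul1r//.
by rewrite gt_eqF// ltr0n.
Qed.

Lemma exceptional_set_half :
  (leb d exceptional_set <= (2^-1 * (2 ^ K) ^+ d)%:E)%E.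
Proof.
apply: le_trans exceptional_set_measure _; rewrite lee_fin ler_wpM2r ?(ltW v_gt0)//.
have : (9 / 64 : R) ^+ d <= (9 / 64) ^+ 1 by rewrite ler_wiXn2l//; lra.
by rewrite expr1; lra.
Qed.

Lemma exceptional_set_small (k : int) n :
  dilate 9 (dy k n) `<=` exceptional_set -> k + 6 <= K.
Proof.
move=> sub.
have : (leb d (dilate 9 (dy k n)) <= ((9 / 64) ^+ d * (2 ^ K) ^+ d)%:E)%E.
  apply: le_trans _ exceptional_set_measure; apply: le_measure => //.
    by apply/mem_set; exact: measurable_dilate.
  by apply/mem_set; exact: measurable_exceptional_set.
rewrite leb_dilate// side_dy lee_fin -exprMn ler_pXn2r//; last 2 first.
- by rewrite nnegrE mulr_ge0// ltW// pow2_gt0.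
- by rewrite nnegrE mulr_ge0// ltW// pow2_gt0.
move=> h; have : 2 ^ (k + 6%:Z) <= 2 ^ K :> R.
  rewrite pow2D; have -> : (2 : R) ^+ 6 = 64 by ring.
  by lra.
by rewrite ler_eXz2l// ltr1n.
Qed.

Lemma exceptional_setN i (r : R) z S : p i = r%:E -> ~ exceptional_set z ->
  cube_set S z ->
  (\int[leb d]_(x in cube_set S) (normc (cut (cube_set Q3) (f i) x) `^ r)%:E <=
    (4 ^+ d * lam * a i `^ r * side S ^+ d)%:E)%E.
Proof.
move=> pi zE zS; have pfin : p i \is a fin_num by rewrite pi.
have -> : r = fine (p i) by rewrite pi.
rewrite -[_ * lam * _]mulrA.
apply: (bad_setN_integral (mF i) (F0 i) (t_gt0 i) _ zS) => zB.
apply: zE; rewrite /exceptional_set -bigcup_seq; exists i.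
  by rewrite /= mem_index_enum.
rewrite /E pfin; exact: zB.
Qed.

End exceptional_set.

(** * Splitting a stopping form into good and bad terms *)

Section stopping_forms.
Context {R : realType} {d m : nat}.
Implicit Types (L Q : cube R d) (f g h : 'I_m.+1 -> Rd R d -> R[i]).

(* The successive terms of the telescoping expansion of the form at [f = g + b]. *)
Definition mixed {A : Type} (g b f : 'I_m.+1 -> A) (n : nat) (i : 'I_m.+1) : A :=
  if (i < n)%N then g i else if (i : nat) == n then b i else f i.

Lemma Ynorm_ge0 (P : set (cube R d)) (p : \bar R) (h : Rd R d -> R[i]) :
  (0 <= Ynorm P p h)%E.
Proof.
rewrite /Ynorm; case: ifP => _; first exact: Lnorm_ge0.
by rewrite le_max Lnorm_ge0.
Qed.

Lemma lee_prod_fin (I : finType) (C : pred I) (x : I -> \bar R) (y : I -> R) :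
  (forall i, C i -> 0 <= x i)%E -> (forall i, C i -> x i <= (y i)%:E)%E ->
  (0 <= \prod_(i | C i) x i <= (\prod_(i | C i) y i)%:E)%E.
Proof.
move=> x0 xy; elim/big_ind2: _ => [|x1 y1 x2 y2|i Ci].
- by rewrite lee01 lexx.
- move=> /andP[h1 h2] /andP[h3 h4]; rewrite mule_ge0//= EFinM.
  by apply: lee_pmul.
- by rewrite x0//= xy.
Qed.

Lemma prod_split_at (j : 'I_m.+1) (y : 'I_m.+1 -> R) :
  (\prod_(i < m.+1 | (i < j)%N) y i) * y j * (\prod_(i < m.+1 | (j < i)%N) y i) =
  \prod_i y i.
Proof.
rewrite [RHS](bigID (fun i : 'I_m.+1 => (i < j)%N))/= -mulrA; congr (_ * _).
rewrite [RHS](bigD1 j)/=; last by rewrite ltnn.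
congr (_ * _); apply: eq_bigl => i; rewrite -leqNgt ltn_neqAle andbC.
by rewrite eq_sym.
Qed.

Variable Ks : int -> Rdn R d m.+1 -> R[i].
Hypothesis mKs : forall s, cmeasurable (Ks s).
Hypothesis supp_Ks : forall s x, Ks s x != 0 ->
  forall k l : 'I_m.+1, dist (tnth x k) (tnth x l) <= 2 ^ s.
Hypothesis Ksize : exists q : \bar R, (1 <= q)%E /\ (kernel_size Ks q < +oo)%E.
Variables (mu nu : int) (P : set (cube R d)) (Q : cube R d).
Hypothesis finP : finite_set P.

Definition inner_stops := [set L | P L /\ cube_set L `<=` cube_set Q].

Lemma inner_stops_finite : finite_set inner_stops.
Proof. by apply: sub_finite_set finP => L []. Qed.

Lemma stopping_formE u : stopping_form Ks mu nu P Q u = local_form Ks mu nu Q u -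
  \sum_(L <- fset_set inner_stops) local_form Ks mu nu L u.
Proof.
rewrite /stopping_form; congr (_ - _).
rewrite (fsbig_finite _ _ inner_stops_finite).
reflexivity.
Qed.

Lemma stopping_formD f g h j :
  bounded_measurable g -> bounded_measurable h ->
  (forall i, i != j -> f i = g i /\ f i = h i) ->
  (forall x, f j x = g j x + h j x) ->
  stopping_form Ks mu nu P Q f =
  stopping_form Ks mu nu P Q g + stopping_form Ks mu nu P Q h.
Proof.
move=> bg bh fgh fj.
have E L : local_form Ks mu nu L f = local_form Ks mu nu L g + local_form Ks mu nu L h.
  rewrite !local_formE.
  exact: (local_scale_formD mKs supp_Ks Ksize L (local_scales_finite mu nu L)
    bg bh fgh fj).
rewrite !stopping_formE (E Q) (eq_bigr _ (fun L _ => E L)).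
by rewrite big_split/= opprD addrACA.
Qed.

Lemma stopping_form_telescope (g b f : 'I_m.+1 -> Rd R d -> R[i]) :
  bounded_measurable g -> bounded_measurable b -> bounded_measurable f ->
  (forall i x, f i x = g i x + b i x) ->
  normc (stopping_form Ks mu nu P Q f) <=
  normc (stopping_form Ks mu nu P Q g) +
  \sum_(j < m.+1) normc (stopping_form Ks mu nu P Q (mixed g b f j)).
Proof.
move=> [mg [Ng gN]] [mb [Nb bN]] [mf [Nf fN]] fgb.
(* [H n] interpolates between [f] and [g], the first [n] slots being good already. Passing from
   [H j] to [H j.+1] splits slot [j] and leaves [mixed g b f j] over. *)
pose H (n : nat) (i : 'I_m.+1) := if (i < n)%N then g i else f i.
pose N := Num.max Ng (Num.max Nb Nf).
have bH n : bounded_measurable (H n).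
  split=> [i|]; first by rewrite /H; case: ifP.
  by exists N => i x; rewrite /H /N; case: ifP => _; rewrite !le_max ?gN ?fN ?orbT.
have bM n : bounded_measurable (mixed g b f n).
  split=> [i|]; first by rewrite /mixed; case: ifP => // _; case: ifP.
  exists N => i x; rewrite /mixed /N; case: ifP => _; first by rewrite !le_max gN.
  by case: ifP => _; rewrite !le_max ?bN ?fN ?orbT.
have step (j : 'I_m.+1) : stopping_form Ks mu nu P Q (H j) =
    stopping_form Ks mu nu P Q (H j.+1) + stopping_form Ks mu nu P Q (mixed g b f j).
  apply: (stopping_formD (bH j.+1) (bM j) (j := j)) => [i ij|x].
    rewrite /H /mixed ltnS [(i <= j)%N]leq_eqVlt; have -> : (i : nat) == j = false.
      by apply/negbTE; apply: contra ij => /eqP ij; apply/eqP; exact: val_inj.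
    by rewrite /=; split; case: ifP.
  by rewrite /H /mixed ltnn ltnSn eqxx.
have H0 : H 0%N = f by [].
have HS : H m.+1 = g by apply/funext => i; rewrite /H ltn_ord.
have gen n : (n <= m.+1)%N -> normc (stopping_form Ks mu nu P Q f) <=
    normc (stopping_form Ks mu nu P Q (H n)) +
    \sum_(0 <= j < n) normc (stopping_form Ks mu nu P Q (mixed g b f j)).
  elim: n => [_|n IH nm]; first by rewrite big_geq// addr0 H0.
  rewrite big_nat_recr//= (le_trans (IH (ltnW nm)))//.
  have := le_normcD (stopping_form Ks mu nu P Q (H n.+1))
    (stopping_form Ks mu nu P Q (mixed g b f n)).
  rewrite -(step (Ordinal nm)) => h.
  by rewrite addrA addrAC lerD2r.
by have := gen m.+1 (leqnn _); rewrite HS big_mkord.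
Qed.

Hypothesis d_gt0 : (0 < d)%N.
Variables (o : d.-tuple R) (K : int) (nQ : {ffun 'I_d -> int}).
Hypothesis QE : Q = dy o K nQ.
Hypothesis P_dy : forall L, P L -> exists k n, L = dy o k n.
Hypothesis disjP : forall L L' x, P L -> P L' -> cube_set L x ->
  cube_set L' x -> L = L'.

Lemma sum_inner_stops :
  \sum_(L <- fset_set inner_stops) side L ^+ d <= (2 ^ K) ^+ d.
Proof.
rewrite -lee_fin -sumEFin.
have -> : (\sum_(L <- fset_set inner_stops) (side L ^+ d)%:E)%E =
    leb d (\bigcup_(L in inner_stops) cube_set L).
  rewrite measure_fin_bigcup; last 3 first.
  - exact: inner_stops_finite.
  - apply/trivIsetP => L L' [PL _] [PL' _] /eqP LL'.
    by rewrite -subset0 => x [xL xL']; apply: LL'; exact: disjP xL xL'.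
  - by move=> L _; exact: measurable_cube.
  rewrite fsbig_finite/=; last exact: inner_stops_finite.
  by apply: eq_bigr => L _; exact/esym/volE.
have -> : ((2 ^ K) ^+ d)%:E = leb d (cube_set Q).
  by have := volE Q; rewrite {2}QE side_dy => <-.
apply: le_measure.
- apply/mem_set; apply: fin_bigcup_measurable; first exact: inner_stops_finite.
  by move=> L _; exact: measurable_cube.
- by apply/mem_set; exact: measurable_cube.
- by move=> x [L [_ LQ] xL]; exact: LQ.
Qed.

Variables (r : 'I_m -> \bar R) (alpha : \bar R).
Hypothesis r_ge1 : forall i, (1 <= r i)%E.
Hypothesis alpha_ge1 : (1 <= alpha)%E.
Hypothesis sum_r : (\sum_(i < m) (r i)^-1 = alpha^-1)%E.
Hypothesis CToo : (CT Ks r alpha < +oo)%E.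
Hypothesis munu : mu < nu.

(** Each local form costs the norm of the truncations times the volume of the tripled cube. The
    inner stopping cubes are disjoint in [Q], so together they cost no more than [Q] itself: hence
    the 2. *)
Lemma stopping_form_CT g (A : 'I_m.+1 -> R) : bounded_measurable g ->
  (forall i, 0 < A i) -> (forall i x, normc (g i x) <= A i) ->
  normc (stopping_form Ks mu nu P Q g) <=
    2 * 3 ^+ d * fine (CT Ks r alpha) * (2 ^ K) ^+ d * \prod_i A i.
Proof.
move=> bg A0 gA; pose C := fine (CT Ks r alpha).
have C0 : 0 <= C by rewrite fine_ge0// (CT_ge0 r_ge1 alpha_ge1).
have pA : 0 <= \prod_i A i by apply: prodr_ge0 => i _; exact: ltW.
have loc k n : normc (local_form Ks mu nu (dy o k n) g) <=
    C * 3 ^+ d * (2 ^ k) ^+ d * \prod_i A i.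
  rewrite -[_ * _ * (2 ^ k) ^+ d]mulrA -exprMn.
  apply: (local_form_CT r_ge1 alpha_ge1 sum_r mKs supp_Ks Ksize CToo munu
    (side_dy o k n) (scale_dy o k n) bg A0) => i.
  by apply: aeW => x; rewrite (le_trans (normc_cut _ _ _)).
rewrite stopping_formE (le_trans (le_normcD _ _))// normcN.
have -> : 2 * 3 ^+ d * C * (2 ^ K) ^+ d * \prod_i A i =
    C * 3 ^+ d * (2 ^ K) ^+ d * \prod_i A i +
    C * 3 ^+ d * (2 ^ K) ^+ d * \prod_i A i by ring.
apply: lerD; first by rewrite {1}QE.
apply: le_trans (normc_sum _ _ _) _.
apply: (@le_trans _ _ (\sum_(L <- fset_set inner_stops)
    (C * 3 ^+ d * \prod_i A i) * side L ^+ d)).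
  rewrite big_seq [leRHS]big_seq; apply: ler_sum => L; rewrite in_fset_set; last exact: inner_stops_finite.
  move=> /set_mem[PL _]; have [k [n ->]] := P_dy PL.
  by apply: le_trans (loc k n) _; rewrite side_dy mulrAC.
rewrite -mulr_sumr [leRHS]mulrAC ler_wpM2l ?sum_inner_stops//.
by rewrite mulr_ge0// mulr_ge0// exprn_ge0.
Qed.

End stopping_forms.

Local Notation triple Q := (dilc (3%:pos)%R Q).

(** * Sparse domination *)

Section esum_seq.
Context {R : realType} {I : eqType} {T : choiceType}.

Lemma esum_seq (s : seq I) (J : I -> set T) (a : T -> \bar R) :
  uniq s -> (forall x, 0 <= a x)%E ->
  (forall i j x, i \in s -> j \in s -> J i x -> J j x -> i = j) ->
  (\sum_(i <- s) \esum_(x in J i) a x =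
   \esum_(x in [set x | exists2 i, i \in s & J i x]) a x)%E.
Proof.
move=> us a0; elim: s us => [_ _|i s IH /= /andP[si us] disj].
  by rewrite big_nil; apply/esym/esum1 => x [? ].
rewrite big_cons IH//; last first.
  by move=> j k x js ks; apply: disj; rewrite in_cons ?js ?ks orbT.
rewrite [RHS](esumID (J i))//; congr (_ + _)%E; congr (esum _ _).
  apply/seteqP; split=> [x Jx|x [_ //]].
  by split=> //; exists i; rewrite ?mem_head.
apply/seteqP; split=> [x [j js Jx]|x [[j]]].
  split; first by exists j; rewrite ?in_cons ?js ?orbT.
  move=> Jix; move: si; rewrite (disj i j x)// ?mem_head ?js//.
  by rewrite in_cons js orbT.
by rewrite in_cons => /orP[/eqP ->|js] Jx // _; exists j.
Qed.

End esum_seq.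

Section averages.
Context {R : realType} {d : nat}.
Implicit Types (Q : cube R d) (h : Rd R d -> R[i]).

Lemma avg_ge0 (q : \bar R) h Q : (0 <= avg q h Q)%E.
Proof. by rewrite mule_ge0 ?poweR_ge0 ?Lnorm_ge0. Qed.

Lemma avgE (q : \bar R) h Q :
  avg q h Q = (((side Q ^+ d) `^ (- fine q^-1))%:E *
    cLnorm (leb d) q (cut (cube_set Q) h))%E.
Proof. by rewrite /avg volE poweR_EFin. Qed.

Lemma avg_fin_num (q : \bar R) h Q (N : R) : (1 <= q)%E -> cmeasurable h ->
  (forall x, normc (h x) <= N) -> avg q h Q \is a fin_num.
Proof.
move=> q1 mh hN.
have N0 : 0 <= N by rewrite (le_trans _ (hN [tuple (corner Q a : R) | a < d]))// normc_ge0.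
have le : (cLnorm (leb d) q (cut (cube_set Q) h) <=
    (N * (side Q ^+ d) `^ fine q^-1)%:E)%E.
  apply: cLnorm_le_cube => //.
  - by apply: cmeasurable_cut => //; exact: measurable_cube.
  - by move=> x /cutF.
  - by apply: aeW => x; rewrite (le_trans (normc_cut _ _ _)).
rewrite avgE fin_numM// ge0_fin_numE ?Lnorm_ge0//.
exact: le_lt_trans le (ltry _).
Qed.

Lemma avg_powR (s : R) h Q : 1 <= s -> avg s%:E h Q \is a fin_num ->
  (\int[leb d]_x (normc (cut (cube_set Q) h x) `^ s)%:E =
   (fine (avg s%:E h Q) `^ s * side Q ^+ d)%:E)%E.
Proof.
move=> s1 afin; have s0 : 0 < s by rewrite (lt_le_trans ltr01).
have v0 : 0 < side Q ^+ d by rewrite exprn_gt0// side_gt0.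
set I := (X in X = _).
have I0 : (0 <= I)%E by apply: integral_ge0 => x _; rewrite lee_fin powR_ge0.
have LE : cLnorm (leb d) s%:E (cut (cube_set Q) h) = (I `^ s^-1)%E.
  rewrite /cLnorm unlock; apply: (congr1 (fun z => z `^ s^-1)%E).
  by apply: eq_integral => x _; rewrite /= ger0_norm ?normc_ge0// poweR_EFin.
clearbody I.
have Ifin : I \is a fin_num.
  move: afin; rewrite ge0_fin_numE ?avg_ge0// avgE LE ge0_fin_numE//.
  case: I I0 {LE} => [x _ _|_|//]; first exact: ltry.
  rewrite poweRyr ?invr_eq0 ?gt_eqF// gt0_muley// lte_fin.
  by rewrite powR_gt0.
rewrite avgE LE inver gt_eqF//= -(fineK Ifin) poweR_EFin -EFinM/=.
have i0 : 0 <= fine I by rewrite fine_ge0.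
rewrite powRM ?powR_ge0// -!powRrM mulVf ?gt_eqF// mulNr mulVf ?gt_eqF//.
by rewrite powRr1// powRN powRr1 ?(ltW v0)// mulrAC mulVf ?mul1r// gt_eqF.
Qed.

Lemma avg_infty h Q : avg +oo h Q = cLnorm (leb d) +oo (cut (cube_set Q) h).
Proof. by rewrite avgE /= oppr0 powRr0 mul1e. Qed.

Lemma avg_eq0 (q : \bar R) h Q : (1 <= q)%E -> cmeasurable h ->
  avg q h Q = 0%E -> {ae leb d, forall x, normc (cut (cube_set Q) h x) = 0}.
Proof.
move=> q1 mh; rewrite avgE => /eqP; rewrite mule_eq0 => /orP[|/eqP L0].
  by rewrite eqe gt_eqF// powR_gt0// exprn_gt0// side_gt0.
have mc : cmeasurable (cut (cube_set Q) h).
  by apply: cmeasurable_cut => //; exact: measurable_cube.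
have q0 : (0 < q)%E by rewrite (lt_le_trans _ q1).
have mn : measurable_fun setT (fun x => (normc (cut (cube_set Q) h x))%:E).
  by apply/measurable_EFinP; exact: measurable_normc.
by apply: filterS (Lnorm_eq0_eq0 mn q0 L0) => x /(_ I) [].
Qed.

End averages.

(** * Passing to the limit in truncated integrals *)

Section truncated_integrals.
Context {R : realType} {disp : measure_display} {T : measurableType disp}.
Variable mu : {measure set T -> \bar R}.

Lemma Rintegral_nonintegrable (h : T -> R) : measurable_fun setT h ->
  ~ mu.-integrable setT (EFin \o h) -> \int[mu]_x h x = 0.
Proof.
move=> mh nh; rewrite /Rintegral; apply: contrapT => h0; apply: nh.
have mE : measurable_fun setT (EFin \o h) by exact/measurable_EFinP.
have : (\int[mu]_x (h x)%:E)%E \is a fin_num.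
  by move: h0; case: (\int[mu]_x (h x)%:E)%E => [x| |]//; rewrite eqxx.
rewrite integralE fin_numB => /andP[h1 h2].
apply/integrableP; split=> //.
have -> : (fun x => `|(EFin \o h) x|%E) = ((EFin \o h)^\+ \+ (EFin \o h)^\-)%E.
  by rewrite -fune_abse.
rewrite ge0_integralD//; [|exact: measurable_funepos|exact: measurable_funeneg].
by rewrite lte_add_pinfty// ltey_eq ?h1 ?h2.
Qed.

(** Either [h] is integrable and dominated convergence applies, or its integral is 0 by
    convention. *)
Lemma Rintegral_cut_le (h : T -> R) (A : (set T)^nat) (B : R) :
  measurable_fun setT h -> (forall n, measurable (A n)) ->
  (forall x, exists N, forall n, (N <= n)%N -> A n x) ->
  (forall n, `|\int[mu]_x (h \_ (A n)) x| <= B) -> `|\int[mu]_x h x| <= B.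
Proof.
move=> mh mA cA hB.
have [ih|nh] := pselect (mu.-integrable setT (EFin \o h)); last first.
  by rewrite (Rintegral_nonintegrable mh nh) normr0 (le_trans _ (hB 0%N)).
have mhA n : measurable_fun setT (h \_ (A n)).
  by apply/(measurable_restrictT _ (mA n)).1/measurable_funTS.
have hA n x : `|(h \_ (A n)) x| <= `|h x|.
  by rewrite patchE; case: ifP => // _; rewrite normr0.
have ihA n : mu.-integrable setT (EFin \o (h \_ (A n))).
  apply: le_integrable ih => //; first exact/measurable_EFinP.
  by move=> x _; rewrite /= lee_fin.
have EI (g : T -> R) : mu.-integrable setT (EFin \o g) ->
    (\int[mu]_x (g x)%:E = (\int[mu]_x g x)%:E)%E.
  by move=> ig; rewrite fineK//; exact: integrable_fin_num.
have cv : ((\int[mu]_x ((h \_ (A n)) x)%:E) @[n --> \oo] --> \int[mu]_x (h x)%:E)%E.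
  apply: (@dominated_cvg _ _ _ mu _ measurableT _ _ (fun x => `|h x|%:E)) => //.
  - by move=> n; exact/measurable_EFinP.
  - move=> x _; apply: cvg_near_cst; have [N hN] := cA x.
    by exists N => // n /= /hN Anx; rewrite patchE mem_set.
  - exact: integrable_abse ih.
  - by move=> n x _; rewrite /= lee_fin.
rewrite ler_norml -!lee_fin -EI//; apply/andP; split.
  apply: cvge_to_ge cv _; apply: nearW => n; rewrite EI// lee_fin.
  by have := hB n; rewrite ler_norml => /andP[].
apply: cvge_to_le cv _; apply: nearW => n; rewrite EI// lee_fin.
by have := hB n; rewrite ler_norml => /andP[].
Qed.

End truncated_integrals.

Section norm_monotone.
Context {R : realType} {d : nat}.
Implicit Types (Q : cube R d) (f g : Rd R d -> R[i]).

Lemma le_cLnorm (q : \bar R) f g : (1 <= q)%E -> cmeasurable f -> cmeasurable g ->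
  (forall x, normc (f x) <= normc (g x)) ->
  (cLnorm (leb d) q f <= cLnorm (leb d) q g)%E.
Proof.
move=> q1 mf mg fg.
have pw (h : Rd R d -> R[i]) (x : Rd R d) s :
  (`|(normc (h x))%:E| `^ s)%E = (normc (h x) `^ s)%:E.
  by rewrite /= ger0_norm ?normc_ge0// poweR_EFin.
case: q q1 => [q| |//]; last first.
  move=> _; have := Lnorm_ge0 (leb d) +oo%E (fun x => (normc (g x))%:E).
  rewrite -/(cLnorm (leb d) +oo g).
  case E : (cLnorm (leb d) +oo g) => [B| |]// _; last by rewrite leey.
  apply/cLnorm_infty_leP; have /cLnorm_infty_leP : (cLnorm (leb d) +oo g <= B%:E)%E.
    by rewrite E.
  by apply: filterS => x; exact: le_trans.
rewrite lee_fin => q1; have q0 : 0 < q by rewrite (lt_le_trans ltr01).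
rewrite /cLnorm unlock; apply: gt0_ler_poweR; first by rewrite invr_ge0 ltW.
- by rewrite in_itv/= leey andbT integral_ge0// => x _; rewrite poweR_ge0.
- by rewrite in_itv/= leey andbT integral_ge0// => x _; rewrite poweR_ge0.
under eq_integral do rewrite pw.
under [leRHS]eq_integral do rewrite pw.
apply: ge0_le_integral => //; try exact: measurable_normc_powR.
all: try by move=> x _; rewrite lee_fin powR_ge0.
by move=> x _; rewrite lee_fin ge0_ler_powR ?nnegrE ?normc_ge0// ltW.
Qed.

Lemma le_avg (q : \bar R) f g Q : (1 <= q)%E -> cmeasurable f -> cmeasurable g ->
  (forall x, normc (f x) <= normc (g x)) -> (avg q f Q <= avg q g Q)%E.
Proof.
move=> q1 mf mg fg; rewrite !avgE; apply: lee_wpmul2l.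
  by rewrite lee_fin powR_ge0.
apply: le_cLnorm => //; try (apply: cmeasurable_cut => //; exact: measurable_cube).
by move=> x; rewrite /cut; case: ifP.
Qed.

End norm_monotone.

(** * Sparse families of tripled cubes *)

Section tripled_family.
Context {R : realType} {d : nat}.
Implicit Types (X Q : cube R d).

Lemma triple_inj : injective (fun X => triple X).
Proof.
move=> X X' /[dup] e /(congr1 (@side _ _)); rewrite !side_dilc => /mulfI/= s.
have sE : side X = side X' by apply: s.
have c a : corner X a = corner X' a.
  have := congr1 (fun Y : cube R d => corner Y a) e; rewrite !corner_dilc /center sE.
  by move=> /addIr/addIr.
case: X X' sE c {e s} => [c s] [c' s'] /= sE c0; congr pair; last exact: val_inj.
by apply: eq_from_tnth => a; exact: c0.
Qed.

Lemma sub_triple X : cube_set X `<=` cube_set (triple X).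
Proof.
move=> x xX a; have := xX a; rewrite corner_dilc side_dilc /center /=.
have := side_gt0 X; move: (side X) (corner X a) (coord x a) => s c y s0 /andP[h1 h2].
by apply/andP; split; lra.
Qed.

(* The sparse form lives on the tripled cubes, but the disjoint major subsets are
   chosen inside the cubes themselves. *)
Definition half_sparse Q (S : set (cube R d)) (E : cube R d -> set (Rd R d)) :=
  [/\ forall X, S X -> subc X Q,
    forall X, S X -> [/\ measurable (E X), E X `<=` cube_set X &
      (2^-1%:E * vol X <= leb d (E X))%E] &
    forall X X', S X -> S X' -> X <> X' -> E X `&` E X' = set0].

Lemma half_sparse0 Q : half_sparse Q set0 (fun=> set0).
Proof. by split. Qed.

(** Half of a cube is this fraction of its triple. *)
Definition sparse_const : R := (2 * 3 ^+ d)^-1.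

Lemma sparse_const_bound : 0 < sparse_const < 1.
Proof.
have t1 : 1 <= (3 : R) ^+ d by rewrite exprn_ege1// ler1n.
have t2 : 1 < 2 * (3 : R) ^+ d by lra.
by rewrite invr_gt0 invf_lt1 ?(lt_trans ltr01 t2)//.
Qed.

Lemma half_sparse_triple Q (S : set (cube R d)) E : half_sparse Q S E ->
  sparse sparse_const [set triple X | X in S].
Proof.
move=> [_ hE disj].
(* Tripling is injective, so a tripled cube inherits the set of its only preimage; the union over
   preimages avoids naming an inverse. *)
have [E' E'E] : exists E' : cube R d -> set (Rd R d),
    forall X, S X -> E' (triple X) = E X.
  exists (fun Y => [set x | exists2 X, S X & triple X = Y /\ E X x]) => X SX.
  apply/seteqP; split=> [x [X' SX' [/triple_inj ->]]//|x xE].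
  by exists X.
exists E'; split=> [_ [X SX <-]|_ _ [X SX <-] [X' SX' <-] XX'].
  rewrite E'E//; have [mE EX vE] := hE _ SX; split=> //.
    by move=> x /EX; exact: sub_triple.
  apply: le_trans vE; rewrite !volE side_dilc exprMn -!EFinM lee_fin /sparse_const.
  have t0 : (3 : R) ^+ d != 0 by rewrite expf_neq0.
  by rewrite invfM -!mulrA [X in _ * X]mulrA mulVf// mul1r.
by rewrite !E'E//; apply: disj => // XE; apply: XX'; rewrite XE.
Qed.

End tripled_family.

Section top_cube.
Context {R : realType} {d : nat}.

Lemma compactly_supported_bounded (f : Rd R d -> R[i]) : compactly_supported f ->
  exists M : R, forall x, f x != 0 -> forall a, `|coord x a| <= M.
Proof.
move=> /compact_bounded/pinfty_ex_gt0[M _ hM]; exists M => x fx a.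
have : `|rowv x| <= M by apply: hM; apply: subset_closure; exists x.
apply: le_trans; rewrite [leRHS]mx_normrE.
by apply: le_trans (le_bigmax _ _ (ord0, a)); rewrite /= mxE.
Qed.

(** The grid starts at the lower corner of a box around the support, so the cube of index 0 contains
    it once its side exceeds [2 * M]. With [nu <= K] the scale restriction of the local form at the
    top is vacuous. *)
Lemma top_cube (f : Rd R d -> R[i]) (nu : int) : compactly_supported f ->
  exists (o : d.-tuple R) (K : int), nu <= K /\
    forall x, f x != 0 -> cube_set (dy o K [ffun=> 0]) x.
Proof.
move=> /compactly_supported_bounded[M hM].
pose N := (Num.bound (`|2 * M|)%R + `|nu|)%N.
have NM : 2 * M < 2 ^ N%:Z :> R.
  have : (Num.bound `|2 * M|)%:R < (2 ^ N)%N%:R :> R.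
    rewrite ltr_nat (leq_ltn_trans (leq_addr `|nu| _))//; exact: ltn_expl.
  rewrite natrX; apply: lt_trans; exact: le_lt_trans (ler_norm _) (archi_boundP (normr_ge0 _)).
exists [tuple - M | _ < d], N%:Z; split; first by rewrite /N; lia.
move=> x fx a; rewrite corner_dy side_dy tnth_mktuple ffunE mul0r addr0.
by have := hM _ fx a; rewrite ler_norml => /andP[h1 h2]; apply/andP; split; lra.
Qed.

End top_cube.

(** * The recursion and the removal of boundedness *)

Section sparse_domination.
Context {R : realType} {d m : nat}.
Implicit Types (L Q : cube R d).
Hypothesis d_gt0 : (0 < d)%N.

(** The constant of [calderon_zygmund_fin] with [C1] equal to the loss [4 ^+ d] of
    [bad_setN_integral] times the threshold factor of the exceptional set. *)
Definition cz_const : R :=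
  16 * (32 ^+ d * (4 ^+ d * (#|{: 'I_m.+1}|%:R * 64 ^+ d))).

(** [2 * 3 ^+ d] is the loss of [stopping_form_CT], [m.+1] the number of bad terms, and each of the
    [m.+1] slots contributes a factor [cz_const]. *)
Definition step_const : R := 2 * 3 ^+ d * m.+1%:R * cz_const ^+ m.+1.

Lemma cz_const_ge1 : 1 <= cz_const.
Proof.
have e (k : nat) : (0 < k)%N -> 1 <= (k%:R : R) ^+ d by move=> k0; rewrite exprn_ege1// ler1n.
rewrite /cz_const !mulr_ege1 ?e ?ler1n//.
by rewrite card_ord.
Qed.

Lemma step_const_gt0 : 0 < step_const.
Proof.
by rewrite !mulr_gt0// ?exprn_gt0// (lt_le_trans ltr01)// cz_const_ge1.
Qed.

Variable Ks : int -> Rdn R d m.+1 -> R[i].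
Hypothesis mKs : forall s, cmeasurable (Ks s).
Hypothesis supp_Ks : forall s x, Ks s x != 0 ->
  forall k l : 'I_m.+1, dist (tnth x k) (tnth x l) <= 2 ^ s.
Hypothesis Ksize : exists q : \bar R, (1 <= q)%E /\ (kernel_size Ks q < +oo)%E.
Variables (r : 'I_m -> \bar R) (alpha : \bar R).
Hypothesis r_ge1 : forall i, (1 <= r i)%E.
Hypothesis alpha_ge1 : (1 <= alpha)%E.
Hypothesis sum_r : (\sum_(i < m) (r i)^-1 = alpha^-1)%E.
Hypothesis CToo : (CT Ks r alpha < +oo)%E.
Variables (p : 'I_m.+1 -> \bar R) (CL : R).
Hypothesis p_ge1 : forall i, (1 <= p i)%E.
Hypothesis CL_gt0 : 0 < CL.
Hypothesis stopping_estimate :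
  forall (mu nu : int) (D P : set (cube R d)) (Q : cube R d),
     mu < nu -> dyadic_lattice D -> stopping_collection D P Q ->
     forall (j : 'I_m.+1) (g : 'I_m.+1 -> Rd R d -> R[i]),
       (forall i : 'I_m.+1, (i < j)%N -> in_Y P +oo%E (g i)) ->
       in_Xdot P (p j) (g j) ->
       (forall i : 'I_m.+1, (j < i)%N -> in_Y P (p i) (g i)) ->
       ((normc (stopping_form Ks mu nu P Q g))%:E <=
          CL%:E * vol Q *
          (\prod_(i < m.+1 | (i < j)%N) Ynorm P +oo (g i)) *
          Ynorm P (p j) (g j) *
          (\prod_(i < m.+1 | (j < i)%N) Ynorm P (p i) (g i)))%E.
Local Notation eta := (@sparse_const R d).
Let CTr := fine (CT Ks r alpha).
Let Cst := step_const * (CTr + CL).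

Section fixed_truncation.
Variables (mu nu : int).
Hypothesis munu : mu < nu.
Variables (o : d.-tuple R) (f : 'I_m.+1 -> Rd R d -> R[i]).
Hypothesis bf : bounded_measurable f.

(** The cubes on which the recursion continues; those left out have zero local form. *)
Definition children (P : set (cube R d)) Q : set (cube R d) :=
  [set L | inner_stops P Q L /\ mu%:~R < scale L].

(** The numbers [a i] need only dominate the averages over [3Q]; they must be positive because they
    set the thresholds of the exceptional set. *)
Lemma stopping_step (K : int) (nQ : {ffun 'I_d -> int}) (a : 'I_m.+1 -> R) :
  mu < K -> (forall i, 0 < a i) ->
  (forall i s, p i = s%:E ->
    (\int[leb d]_x (normc (cut (cube_set (triple (dy o K nQ))) (f i) x)
       `^ s)%:E <= (a i `^ s * (3 * 2 ^ K) ^+ d)%:E)%E) ->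
  (forall i, p i = +oo%E ->
    (cLnorm (leb d) +oo (cut (cube_set (triple (dy o K nQ))) (f i))
      <= (a i)%:E)%E) ->
  exists P : set (cube R d), [/\ finite_set P,
    forall L, P L -> exists k n, L = dy o k n /\ k < K,
    forall L L' x, P L -> P L' -> cube_set L x -> cube_set L' x -> L = L',
    (leb d (shadow (children P (dy o K nQ))) <= (2^-1 * (2 ^ K) ^+ d)%:E)%E &
    normc (stopping_form Ks mu nu P (dy o K nQ) f) <=
      step_const * (CTr + CL) * ((3 * 2 ^ K) ^+ d * \prod_i a i)].
Proof.
move=> muK a0 fa fa_infty; set Q := dy o K nQ; set Q3 := triple Q.
have [mf [N fN]] := bf.
have I0 : (0 < #|{: 'I_m.+1}|)%N by rewrite card_ord.
pose E := exceptional_set o K nQ f a p.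
(* Local forms at scales at most [mu] vanish, so the bottom cubes, which need not
   lie in the exceptional set, are not among the children. *)
pose k0 : int := mu - 8.
have k0K : k0 + 6 <= K by rewrite /k0; lia.
have Esmall := exceptional_set_small d_gt0 I0 mf a0 fa.
pose P := stops o K k0 nQ E.
have finP : finite_set P by exact: stops_finite Esmall.
have PdyK L : P L -> exists k n, L = dy o k n /\ k < K.
  move=> PL; have [k [n [LE adm _]]] := PL.
  by exists k, n; split=> //; have := admissible_level k0K Esmall adm; lia.
have Pdy L : P L -> exists k n, L = dy o k n.
  by move=> /PdyK[k [n [-> _]]]; exists k, n.
have disjP L L' x : P L -> P L' -> cube_set L x -> cube_set L' x -> L = L'.
  exact: stops_meet.
have shP : shadow P = cube_set Q3 by exact: stops_shadow k0K Esmall.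
have scP : stopping_collection (dygrid o) P Q by exact: stops_stopping Esmall.
exists P; split=> //.
- apply: le_trans (exceptional_set_half d_gt0 I0 mf a0 fa).
  apply: le_measure.
  + apply/mem_set; apply: fin_bigcup_measurable; last by move=> L _; exact: measurable_cube.
    by apply: sub_finite_set finP => L [[]].
  + by apply/mem_set; exact: measurable_exceptional_set.
  + move=> x [L [[PL _] muL] xL].
    have [k [n [LE [kk0 _ cE] _]]] := PL.
    case: cE => [sub|kE]; last first.
      by move: muL; rewrite LE scale_dy ltr_int kE /k0; lia.
    apply: sub => b; have := xL b; rewrite LE /center.
    have := side_gt0 (dy o k n).
    move: (side _) (corner _ b) (coord x b) => u c v u0 /andP[? ?].
    by apply/andP; split; lra.
pose C1 : R := 4 ^+ d * (#|{: 'I_m.+1}|%:R * 64 ^+ d).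
have C11 : 1 <= C1.
  by rewrite !mulr_ege1 ?exprn_ege1 ?ler1n.
pose B i := cz_const * a i.
have BE i : B i = 16 * (32 ^+ d * C1) * a i by [].
have B0 i : 0 < B i by rewrite mulr_gt0// (lt_le_trans ltr01)// cz_const_ge1.
pose f3 i := cut (cube_set Q3) (f i).
pose g i := good_part P (f i).
pose b i := bad_part P Q3 (f i).
have cz i : [/\ forall x, normc (g i x) <= B i,
      (Ynorm P (p i) (b i) <= (B i)%:E)%E & (Ynorm P (p i) (f3 i) <= (B i)%:E)%E].
  case pi : (p i) (p_ge1 i) => [s| |//].
    rewrite lee_fin => s1.
    apply: (calderon_zygmund_fin finP disjP shP (mf i) s1 C11 (a0 i)) => L PL.
    have [z [zL zE]] := stops_good d_gt0 k0K Esmall PL; exists z; split=> // S zS.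
    exact: (exceptional_setN I0 mf a0 pi zE zS).
  move=> _.
  exact: (calderon_zygmund_infty disjP shP (mf i) C11 (a0 i) (fa_infty i pi)).
have mg i : cmeasurable (g i) by exact: cmeasurable_good_part.
have mb i : cmeasurable (b i) by exact: cmeasurable_bad_part.
have mf3 i : cmeasurable (f3 i).
  by apply: cmeasurable_cut => //; exact: measurable_cube.
have f3N i x : normc (f3 i x) <= N by rewrite (le_trans (normc_cut _ _ _)).
have gB i x : normc (g i x) <= \sum_j B j.
  have [h _ _] := cz i; rewrite (le_trans (h x))// (bigD1 i)//= lerDl.
  by apply: sumr_ge0 => j _; exact: ltW.
have bg : bounded_measurable g by split=> //; exists (\sum_j B j).
have bf3 : bounded_measurable f3 by split=> //; exists N.
have bb : bounded_measurable b.
  split=> //; exists (N + \sum_j B j) => i x.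
  rewrite /b /bad_part; apply: le_trans (le_normcD _ _) _.
  by rewrite normcN; apply: lerD; [exact: f3N|exact: gB].
have fgb i x : f3 i x = g i x + b i x by rewrite /b /bad_part addrC subrK.
(* The triple of an inner stopping cube lies in [3Q], so no local form involved sees [f] outside
   [3Q]. *)
have -> : stopping_form Ks mu nu P Q f = stopping_form Ks mu nu P Q f3.
  rewrite !(stopping_formE _ _ _ _ finP); congr (_ - _).
    apply: (local_form_eq supp_Ks mu nu (side_dy o K nQ) (scale_dy o K nQ)).
    by move=> i x xQ; rewrite /f3 cutT.
  rewrite big_seq [RHS]big_seq; apply: eq_bigr => L.
  rewrite in_fset_set; last exact: inner_stops_finite.
  move=> /set_mem[PL LQ]; have [k [n [LE kK]]] := PdyK _ PL.
  rewrite LE; apply: (local_form_eq supp_Ks mu nu (side_dy o k n) (scale_dy o k n)).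
  move=> i x xL; rewrite /f3 cutT// => c.
  have sLQ : subc (dy o k n) Q.
    apply: (dy_nested (ltW kK) (cube_corner _)); apply: LQ; rewrite LE.
    exact: cube_corner.
  have := xL c; have [] := sLQ c; rewrite !corner_dilc !side_dilc /center.
  have := side_gt0 (dy o k n); have := side_gt0 Q => /=.
  move: (side _) (side _) (corner _ c) (corner _ c) (coord x c) => u v c1 c2 y.
  by move=> u0 v0 h1 h2 /andP[h3 h4]; apply/andP; split; lra.
apply: le_trans (stopping_form_telescope mKs supp_Ks Ksize mu nu Q finP bg bb bf3 fgb) _.
have v0 : 0 <= (2 ^ K : R) ^+ d by rewrite exprn_ge0// ltW// pow2_gt0.
have pB0 : 0 <= \prod_i B i by apply: prodr_ge0 => i _; exact: ltW.
have goodb : normc (stopping_form Ks mu nu P Q g) <=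
    2 * 3 ^+ d * CTr * (2 ^ K) ^+ d * \prod_i B i.
  apply: (stopping_form_CT mKs supp_Ks Ksize finP erefl Pdy disjP r_ge1 alpha_ge1
    sum_r CToo munu bg B0) => i x.
  by have [] := cz i.
have badb (j : 'I_m.+1) : normc (stopping_form Ks mu nu P Q (mixed g b f3 j)) <=
    CL * (2 ^ K) ^+ d * \prod_i B i.
  have jE : mixed g b f3 j j = b j by rewrite /mixed ltnn eqxx.
  have ltE (i : 'I_m.+1) : (i < j)%N -> mixed g b f3 j i = g i by rewrite /mixed => ->.
  have gtE (i : 'I_m.+1) : (j < i)%N -> mixed g b f3 j i = f3 i.
    by move=> ji; rewrite /mixed ltnNge (ltnW ji)/= gtn_eqF.
  have Yg i : (Ynorm P +oo (g i) <= (B i)%:E)%E.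
    by rewrite Ynorm_infty; apply: cLnorm_infty_le; have [] := cz i.
  have Yb i : (Ynorm P (p i) (b i) <= (B i)%:E)%E by have [] := cz i.
  have Yf i : (Ynorm P (p i) (f3 i) <= (B i)%:E)%E by have [] := cz i.
  rewrite -lee_fin; apply: le_trans (stopping_estimate munu (dygrid_lattice o) scP
    (j := j) _ _ _) _.
  - by move=> i /ltE ->; split=> //; exact: le_lt_trans (Yg i) (ltry _).
  - rewrite jE; apply: (bad_part_Xdot finP disjP shP (mf j) (fN j)).
    exact: le_lt_trans (Yb j) (ltry _).
  - by move=> i /gtE ->; split=> //; exact: le_lt_trans (Yf i) (ltry _).
  rewrite jE volE side_dy.
  have -> : ((CL * (2 ^ K) ^+ d * \prod_i B i)%:E =
      CL%:E * ((2 ^ K) ^+ d)%:E * (\prod_(i < m.+1 | (i < j)%N) B i)%:E *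
      (B j)%:E * (\prod_(i < m.+1 | (j < i)%N) B i)%:E)%E.
    by rewrite -!EFinM -(prod_split_at j B) !mulrA.
  have /andP[h1 h2] := @lee_prod_fin _ _ (fun i : 'I_m.+1 => (i < j)%N)
    (fun i => Ynorm P +oo (mixed g b f3 j i)) B
    (fun i _ => Ynorm_ge0 _ _ _)
    (fun i ij => eq_ind_r (fun h => Ynorm P +oo h <= (B i)%:E)%E (Yg i) (ltE i ij)).
  have /andP[h3 h4] := @lee_prod_fin _ _ (fun i : 'I_m.+1 => (j < i)%N)
    (fun i => Ynorm P (p i) (mixed g b f3 j i)) B
    (fun i _ => Ynorm_ge0 _ _ _)
    (fun i ij => eq_ind_r (fun h => Ynorm P (p i) h <= (B i)%:E)%E (Yf i) (gtE i ij)).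
  have c0 : (0 <= CL%:E * ((2 ^ K) ^+ d)%:E :> \bar R)%E by rewrite -EFinM lee_fin mulr_ge0// ltW.
  apply: lee_pmul => //.
  - by apply: mule_ge0; [exact: mule_ge0|exact: Ynorm_ge0].
  - apply: lee_pmul => //; first exact: mule_ge0.
    + exact: Ynorm_ge0.
    + exact: lee_pmul.
apply: le_trans (lerD goodb (ler_sum _ (fun j _ => badb j))) _.
rewrite sumr_const card_ord -[X in _ + X <= _]mulr_natl.
have pBE : \prod_i B i = cz_const ^+ m.+1 * \prod_i a i.
  by rewrite big_split/= prodr_const card_ord.
rewrite pBE; set c := cz_const ^+ m.+1; set A := \prod_i a i.
have c1 : 1 <= c by rewrite exprn_ege1// cz_const_ge1.
have A0 : 0 <= A by apply: prodr_ge0 => i _; exact: ltW.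
have CTr0 : 0 <= CTr by rewrite fine_ge0// (CT_ge0 r_ge1 alpha_ge1).
have t1 : 1 <= (3 : R) ^+ d by rewrite exprn_ege1// ler1n.
have m1 : 1 <= (m.+1%:R : R) by rewrite ler1n.
rewrite /step_const -/c exprMn.
set t := 3 ^+ d in t1 *; set v := (2 ^ K) ^+ d in v0 *; set w := m.+1%:R in m1 *.
have -> : 2 * t * CTr * v * (c * A) + w * (CL * v * (c * A)) =
  (2 * t * CTr + w * CL) * (c * (v * A)) by ring.
have -> : 2 * t * w * c * (CTr + CL) * (t * v * A) =
  (2 * t * w * (CTr + CL) * t) * (c * (v * A)) by ring.
rewrite ler_wpM2r//.
  by rewrite !mulr_ge0// (le_trans ler01).
have wt1 : 1 <= w * t by rewrite mulr_ege1.
apply: (@le_trans _ _ (2 * t * (w * t) * (CTr + CL))); last first.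
  by rewrite le_eqVlt; apply/orP; left; apply/eqP; ring.
rewrite mulrDr; apply: lerD.
  by rewrite ler_wpM2r// ler_peMr// mulr_ge0// (le_trans ler01).
rewrite ler_wpM2r ?(ltW CL_gt0)// mulrCA ler_peMr ?(le_trans ler01 m1)//.
have tt1 : 1 <= t * t by rewrite mulr_ege1.
by rewrite -mulrA; lra.
Qed.

Definition weight X : \bar R :=
  (vol (triple X) * \prod_i avg (p i) (f i) (triple X))%E.

(** If one average vanishes, that function is 0 almost everywhere on [3Q], and [local_form_CT]
    applies with an arbitrarily small bound in its slot. *)
Lemma local_form_avg0 (K : int) (nQ : {ffun 'I_d -> int}) (i : 'I_m.+1) :
  avg (p i) (f i) (triple (dy o K nQ)) = 0%E ->
  local_form Ks mu nu (dy o K nQ) f = 0.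
Proof.
move=> /(avg_eq0 (p_ge1 i) (bf.1 i)) f0.
have [mf [N fN]] := bf.
pose M := `|N| + 1.
have M0 : 0 < M by rewrite ltr_wpDl.
pose C := fine (CT Ks r alpha) * (3 * 2 ^ K) ^+ d * M ^+ m.
have C0 : 0 <= C.
  rewrite !mulr_ge0 ?exprn_ge0 ?(ltW M0)//; last by rewrite mulr_ge0// ltW// pow2_gt0.
  by rewrite fine_ge0// (CT_ge0 r_ge1 alpha_ge1).
have le e : 0 < e -> normc (local_form Ks mu nu (dy o K nQ) f) <= C * e.
  move=> e0; pose A j := if j == i then e else M.
  apply: le_trans (local_form_CT r_ge1 alpha_ge1 sum_r mKs supp_Ks Ksize CToo
    (A := A) munu (side_dy o K nQ) (scale_dy o K nQ) bf _ _) _.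
  - by move=> j; rewrite /A; case: ifP.
  - move=> j; rewrite /A; case: eqP => [->|_].
      by apply: filterS f0 => x ->; exact: ltW.
    apply: aeW => x; rewrite (le_trans (normc_cut _ _ _))// (le_trans (fN j x))//.
    by rewrite (le_trans (ler_norm _))// lerDl.
  rewrite (bigD1 i)//= {1}/A eqxx (eq_bigr (fun=> M)); last first.
    by move=> j ji; rewrite /A (negbTE ji).
  rewrite prodr_const cardC1 card_ord /C -!mulrA.
  by rewrite (mulrC e).
apply/eqP; rewrite -normc_eq0 eq_le normc_ge0 andbT.
apply/ler_addgt0Pr => e e0; rewrite add0r.
apply: le_trans (le (e / (C + 1)) _) _; first by rewrite divr_gt0// ltr_wpDl.
by rewrite mulrCA ger_pMr// ler_pdivrMr ?ltr_wpDl// mul1r lerDl.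
Qed.

(** [Q] keeps what its children do not cover, at least half of it; sets belonging to different
    children lie in disjoint cubes. Members of the subfamilies have lower level than [Q], so [Q] is
    not among them and its set is unambiguous. *)
Lemma half_sparseU (K : int) (nQ : {ffun 'I_d -> int}) (C : set (cube R d))
    (S : cube R d -> set (cube R d)) (E : cube R d -> cube R d -> set (Rd R d)) :
  let Q := dy o K nQ in
  finite_set C ->
  (forall L, C L -> exists k n, L = dy o k n /\ k < K) ->
  (forall L L' x, C L -> C L' -> cube_set L x -> cube_set L' x -> L = L') ->
  (forall L, C L -> subc L Q) ->
  (leb d (shadow C) <= (2^-1 * (2 ^ K) ^+ d)%:E)%E ->
  (forall L, C L -> half_sparse L (S L) (E L)) ->
  [/\ forall L, C L -> ~ S L Q &
    exists E', half_sparse Q (Q |` [set X | exists2 L, C L & S L X]) E'].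
Proof.
move=> Q finC dyC disjC CQ shC hC.
have notQ L : C L -> ~ S L Q.
  move=> CL' SQ; have [sub _ _] := hC _ CL'; have := sub _ SQ.
  have [k [n [-> kK]]] := dyC _ CL' => /(subc_level d_gt0).
  by rewrite leNgt kK.
split=> //.
pose E' X : set (Rd R d) := [set x | (X = Q /\ (cube_set Q `\` shadow C) x) \/
  (exists L, [/\ C L, S L X & E L X x])].
have E'Q : E' Q = cube_set Q `\` shadow C.
  apply/seteqP; split=> [x [[_ //]|[L [CL' SQ _]]]|x xQ]; last by left.
  by have := notQ _ CL'.
have E'L L X : C L -> S L X -> E' X = E L X.
  move=> CL' SX; apply/seteqP; split=> [x [[XQ _]|[L' [CL2 SX' xE]]]|x xE].
  - by move: SX; rewrite XQ => /(notQ _ CL').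
  - have [sub _ _] := hC _ CL'; have [sub' _ _] := hC _ CL2.
    have -> // : L = L'.
    apply: (disjC _ _ _ CL' CL2 (subc_sub (sub _ SX) (cube_corner X))).
    exact: (subc_sub (sub' _ SX') (cube_corner X)).
  - by right; exists L.
have mC : measurable (shadow C).
  by apply: fin_bigcup_measurable => // L _; exact: measurable_cube.
exists E'; split.
- move=> X [->//|[L CL' SX]].
  by have [sub _ _] := hC _ CL'; exact: subc_trans (sub _ SX) (CQ _ CL').
- move=> X [->|[L CL' SX]]; last first.
    by rewrite (E'L L X)//; have [_ h _] := hC _ CL'; exact: h.
  rewrite E'Q; split; [|by move=> x []|].
    by apply: measurableD => //; exact: measurable_cube.
  have := measureDI (leb d) (measurable_cube Q) mC.
  move=> vE; rewrite volE side_dy.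
  have QE : leb d (cube_set Q) = ((2 ^ K) ^+ d)%:E by exact: (volE Q).
  have le : (leb d (cube_set Q `&` shadow C) <= (2^-1 * (2 ^ K) ^+ d)%:E)%E.
    apply: le_trans shC; apply: le_measure; last by move=> x [].
    - by apply/mem_set; apply: measurableI => //; exact: measurable_cube.
    - exact/mem_set.
  rewrite -(@leeD2rE _ (2^-1 * (2 ^ K) ^+ d)%:E)//.
  apply: (@le_trans _ _ ((2 ^ K) ^+ d)%:E); last by rewrite -QE vE; exact: leeD.
  by rewrite -EFinM -EFinD lee_fin -mulrDl; lra.
- move=> X X' [->|[L CL' SX]] [->|[L' CL2 SX']] XX' //.
  + rewrite E'Q (E'L _ _ CL2 SX'); apply/seteqP; split=> // x [[_ nx] xE].
    have [sub h _] := hC _ CL2; have [_ EX _] := h _ SX'.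
    by apply: nx; exists L' => //; exact: (subc_sub (sub _ SX') (EX _ xE)).
  + rewrite E'Q (E'L _ _ CL' SX); apply/seteqP; split=> // x [xE [_ nx]].
    have [sub h _] := hC _ CL'; have [_ EX _] := h _ SX.
    by apply: nx; exists L => //; exact: (subc_sub (sub _ SX) (EX _ xE)).
  + rewrite (E'L _ _ CL' SX) (E'L _ _ CL2 SX').
    have [sub h dis] := hC _ CL'; have [_ EX _] := h _ SX.
    have [sub' h' dis'] := hC _ CL2; have [_ EX' _] := h' _ SX'.
    apply/seteqP; split=> // x [xE xE'].
    have LL : L = L'.
      apply: (disjC _ _ _ CL' CL2 (subc_sub (sub _ SX) (EX _ xE))).
      exact: (subc_sub (sub' _ SX') (EX' _ xE')).
    move: SX' xE'; rewrite -LL => SX' xE'.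
    by rewrite -(dis X X' SX SX' XX').
Qed.

Lemma weight_ge0 X : (0 <= weight X)%E.
Proof.
rewrite mule_ge0//.
by apply: prode_ge0 => i _; exact: avg_ge0.
Qed.

(** Induction on the number of levels above [mu]. The constant does not grow with [N]: the stopping
    form is charged to [Q] alone, and the local forms of the children enter with coefficient 1. *)
Lemma sparse_family (N : nat) (K : int) (nQ : {ffun 'I_d -> int}) : K <= mu + N%:Z ->
  exists S E, half_sparse (dy o K nQ) S E /\
    ((normc (local_form Ks mu nu (dy o K nQ) f))%:E <=
       Cst%:E * \esum_(X in S) weight X)%E.
Proof.
have c0 : 0 <= Cst.
  rewrite mulr_ge0 ?(ltW step_const_gt0)// addr_ge0 ?(ltW CL_gt0)//.
  by rewrite fine_ge0// (CT_ge0 r_ge1 alpha_ge1).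
elim: N K nQ => [|N IH] K nQ KN; set Q := dy o K nQ.
all: have zero : local_form Ks mu nu Q f = 0 ->
    exists S E, half_sparse Q S E /\
    ((normc (local_form Ks mu nu Q f))%:E <= Cst%:E * \esum_(X in S) weight X)%E
  by move=> ->; exists set0, (fun=> set0); split; [exact: half_sparse0|
    rewrite esum_set0 mule0 normc0].
all: have low : K <= mu -> local_form Ks mu nu Q f = 0
  by exact: local_form_low (scale_dy o K nQ).
  by apply/zero/low; rewrite addr0 in KN.
have [/low/zero//|muK] := leP K mu.
have [A AD] : exists A : 'I_m.+1 -> \bar R,
    forall i, A i = avg (p i) (f i) (triple Q).
  by exists (fun i => avg (p i) (f i) (triple Q)).
have [mf [M fM]] := bf.
have Afin i : A i \is a fin_num by rewrite AD; exact: avg_fin_num (p_ge1 i) (mf i) (fM i).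
pose a i := fine (A i).
have AE i : A i = (a i)%:E by rewrite fineK.
have [/existsP[i /eqP Ai]|] := boolP [exists i, A i == 0%E].
  by apply: zero; apply: (@local_form_avg0 _ _ i); rewrite -AD.
move=> /existsPn A0.
have a0 i : 0 < a i.
  by rewrite -lte_fin -AE lt_neqAle eq_sym A0/= AD avg_ge0.
have [||P [finP dyP disjP shP bound]] := @stopping_step K nQ a muK a0.
- move=> i s pi; have := Afin i; rewrite AD pi => Af.
  have s1 : 1 <= s by have := p_ge1 i; rewrite pi lee_fin.
  by rewrite (avg_powR s1 Af) lee_fin /a AD pi side_dilc side_dy.
- by move=> i pi; rewrite -avg_infty -AE AD pi.
pose C := children P Q.
have /choice[SE hSE] L :
    exists SE : set (cube R d) * (cube R d -> set (Rd R d)),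
      C L -> half_sparse L SE.1 SE.2 /\
      ((normc (local_form Ks mu nu L f))%:E <=
        Cst%:E * \esum_(X in SE.1) weight X)%E.
  have [CL'|nC] := pselect (C L); last by exists (set0, fun=> set0).
  have [k [n [LE kK]]] := dyP _ CL'.1.1.
  have [|S [E [h1 h2]]] := IH k n; last by exists (S, E); rewrite LE.
  by move: kK KN; lia.
have finC : finite_set C by apply: sub_finite_set finP => L [[]].
have subL L : C L -> subc L Q.
  move=> [[PL LQ] _]; have [k [n [LE kK]]] := dyP _ PL; move: LQ; rewrite LE => LQ.
  apply: (dy_nested (ltW kK) (cube_corner _)); apply: LQ; exact: cube_corner.
have [nSQ [E hE]] := @half_sparseU K nQ C (fun L => (SE L).1) (fun L => (SE L).2)
  finC (fun L CL' => dyP L CL'.1.1) (fun L L' x h h' => disjP L L' x h.1.1 h'.1.1)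
  subL shP (fun L CL' => (hSE L CL').1).
exists (Q |` [set X | exists2 L, C L & (SE L).1 X]), E; split=> //.
have -> : local_form Ks mu nu Q f = stopping_form Ks mu nu P Q f +
    \sum_(L <- fset_set (inner_stops P Q)) local_form Ks mu nu L f.
  by rewrite (stopping_formE _ _ _ _ finP) subrK.
have inner L : L \in fset_set (inner_stops P Q) -> inner_stops P Q L.
  by rewrite in_fset_set; [exact: set_mem|exact: inner_stops_finite].
(* Inner stopping cubes are either children or of scale at most [mu], with zero local form. *)
rewrite (bigID (fun L => mu%:~R < scale L))/= [X in _ + (_ + X)]big_seq_cond.
rewrite [X in _ + (_ + X)]big1 ?addr0; last first.
  move=> L /andP[/inner[PL _]]; have [k [n [-> kK]]] := dyP _ PL.
  rewrite scale_dy ltr_int -leNgt => kmu; exact: local_form_low (scale_dy o k n) kmu.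
rewrite -big_filter; set s := [seq L <- _ | _].
have sC L : L \in s = (L \in C).
  rewrite mem_filter in_fset_set; last exact: inner_stops_finite.
  by apply/andP/idP => [[h /set_mem h']|/set_mem[h h']]; [apply/mem_set|split=> //; apply/mem_set].
have us : uniq s by rewrite filter_uniq// fset_uniq.
(* The term of [Q] pays for the stopping form; the remaining terms are distributed over the
   children. *)
rewrite (esumID [set Q]) => [|X _]; last exact: weight_ge0.
have -> : (Q |` [set X | exists2 L, C L & (SE L).1 X]) `&` [set Q] = [set Q].
  by apply/seteqP; split=> [X []//|X ->]; split=> //; left.
have -> : (Q |` [set X | exists2 L, C L & (SE L).1 X]) `&` ~` [set Q] =
    [set X | exists2 L, L \in s & (SE L).1 X].
  apply/seteqP; split=> [X [[//|[L CL' SX]] _]|X [L]].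
    by exists L => //; rewrite sC; exact/mem_set.
  rewrite sC => /set_mem CL' SX; split; first by right; exists L.
  by move=> XQ; apply: (nSQ L CL'); move: SX; rewrite XQ.
rewrite esum_set1; last exact: weight_ge0.
rewrite -esum_seq//; last 2 first.
- exact: weight_ge0.
- move=> L L' X; rewrite !sC => /set_mem CL' /set_mem CL2 SX SX'.
  have [[sub _ _] _] := hSE _ CL'; have [[sub' _ _] _] := hSE _ CL2.
  apply: (disjP _ _ _ CL'.1.1 CL2.1.1 (subc_sub (sub _ SX) (cube_corner X))).
  exact: (subc_sub (sub' _ SX') (cube_corner X)).
have e0 L : (0 <= \esum_(X in (SE L).1) weight X)%E.
  by apply: esum_ge0 => X _; exact: weight_ge0.
rewrite ge0_muleDr ?weight_ge0 ?sume_ge0//.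
apply: (@le_trans _ _ ((normc (stopping_form Ks mu nu P Q f))%:E +
  \sum_(L <- s) (normc (local_form Ks mu nu L f))%:E)%E).
  rewrite sumEFin -EFinD lee_fin (le_trans (le_normcD _ _))// lerD2l.
  exact: normc_sum.
apply: leeD.
  rewrite /weight volE side_dilc side_dy.
  have -> : (\prod_i avg (p i) (f i) (triple Q) = (\prod_i a i)%:E)%E.
    by rewrite -prodEFin; apply: eq_bigr => i _; rewrite -AE AD.
  by rewrite -!EFinM lee_fin.
rewrite ge0_sume_distrr//.
rewrite [leLHS]big_seq [leRHS]big_seq; apply: lee_sum => L.
by rewrite sC => /set_mem CL'; have [] := hSE _ CL'.
Qed.

End fixed_truncation.

(** Only the first function needs compact support, since the local form cuts no other. On a large
    top cube neither the cut nor the scale restriction changes anything, so the truncated form is a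
    local form. *)
Lemma bounded_trunc_form (mu nu : int) (f : 'I_m.+1 -> Rd R d -> R[i]) : mu < nu ->
  bounded_measurable f -> compactly_supported (f ord0) ->
  exists S : set (cube R d), sparse eta S /\
    ((normc (trunc_form Ks mu nu f))%:E <= Cst%:E * PSF S p f)%E.
Proof.
move=> munu bf cf.
have [orig [K [nuK fQ]]] := top_cube nu cf.
have muK : K <= mu + `|K - mu|%N%:Z by lia.
have [S [E [hS bound]]] := sparse_family munu orig bf [ffun=> 0] muK.
exists [set triple X | X in S]; split; first exact: half_sparse_triple hS.
have -> : PSF [set triple X | X in S] p f = \esum_(X in S) weight f X.
  by rewrite /PSF (esum_image S (fun X => triple X))// => X X' _ _; exact: triple_inj.
suff -> : trunc_form Ks mu nu f = local_form Ks mu nu (dy orig K [ffun=> 0]) f by [].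
rewrite /local_form /trunc_form.
have -> : dfwith f ord0 (cut (cube_set (dy orig K [ffun=> 0])) (f ord0)) = f.
  apply/funext => i; have [->|i0] := eqVneq i ord0; last first.
    by rewrite dfwithout// eq_sym.
  rewrite dfwithin; apply/funext => x; rewrite /cut; case: ifPn => // /negP nx.
  have [->//|fx] := eqVneq (f ord0 x) 0.
  by exfalso; apply: nx; apply/mem_set; exact: fQ.
have -> // : [set s : int | mu < s < nu /\ s%:~R <= scale (dy orig K [ffun=> 0])] =
  [set s : int | mu < s < nu].
apply/seteqP; split=> [s [//]|s /= /andP[h1 h2]]; rewrite h1 h2; split=> //.
by rewrite scale_dy ler_int; lia.
Qed.

(* The functions are truncated at height [n] and [n] tends to infinity in the real
   and imaginary parts separately: a part that is not integrable has integral 0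
   by convention. This is where the factor 2 comes from. *)
Lemma trunc_form_le_sparse (mu nu : int) (f : 'I_m.+1 -> Rd R d -> R[i]) : mu < nu ->
  (forall j, in_Lp (leb d) (p j) (f j) /\ compactly_supported (f j)) ->
  ((normc (trunc_form Ks mu nu f))%:E <= (2 * Cst)%:E *
     ereal_sup [set PSF S p f | S in [set S | sparse eta S]])%E.
Proof.
move=> munu fp.
have mf i : cmeasurable (f i) by have [[]] := fp i.
have C0 : 0 < Cst.
  rewrite mulr_gt0 ?step_const_gt0// ltr_wpDl//.
  by rewrite fine_ge0// (CT_ge0 r_ge1 alpha_ge1).
set s := ereal_sup _.
have PSF0 (S : set (cube R d)) g : (0 <= PSF S p g)%E.
  by apply: esum_ge0 => X _; apply: mule_ge0 => //; apply: prode_ge0 => i _; exact: avg_ge0.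
have s0 : (0 <= s)%E.
  apply: (le_trans (PSF0 set0 f)); apply: ereal_sup_ubound; exists set0 => //.
  by exists (fun=> set0).
(* For an infinite supremum [0 < Cst] matters, as 0 times infinity is 0. *)
case sE : s s0 => [B| |]// s0; last first.
  by rewrite gt0_muley ?leey// lte_fin mulr_gt0.
pose D n i := [set x : Rd R d | normc (f i x) <= n%:R].
have mD n i : measurable (D n i).
  have := measurable_normc (mf i) measurableT (measurable_itv `]-oo, n%:R]).
  by rewrite setTI; congr (measurable _).
(* Large values are replaced by 0, not clipped, so that the tensor product of the [F n i] is the
   original one restricted to a set, [A n] below. *)
pose F n i := cut (D n i) (f i).
have mF n i : cmeasurable (F n i) by exact: cmeasurable_cut.
have bF n : bounded_measurable (F n).
  split=> //; exists n%:R => i x; rewrite /F /cut; case: ifPn => [/set_mem//|_].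
  by rewrite normc0.
have cF n : compactly_supported (F n ord0).
  have [_ cf0] := fp ord0; rewrite /compactly_supported.
  apply: (subclosed_compact _ cf0); first exact: closed_closure.
  apply: closureS => _ [x Fx <-]; exists x => //; move: Fx => /=.
  by rewrite /F /cut; case: ifP => //; rewrite eqxx.
have hF n : normc (trunc_form Ks mu nu (F n)) <= Cst * B.
  have [S [hS0 hS]] := bounded_trunc_form munu (bF n) (cF n).
  rewrite -lee_fin; apply: (le_trans hS).
  rewrite (EFinM Cst B); apply: lee_wpmul2l; first by rewrite lee_fin ltW.
  rewrite -sE.
  apply: (@le_trans _ _ (PSF S p f)); last by apply: ereal_sup_ubound; exists S.
  apply: le_esum => X _; apply: lee_wpmul2l => //.
  have /andP[] // : (0 <= \prod_i avg (p i) (F n i) X <= \prod_i avg (p i) (f i) X)%E.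
  elim/big_ind2: _ => [|x1 y1 x2 y2 /andP[? ?] /andP[? ?]|i _].
  - by rewrite lee01 lexx.
  - by rewrite mule_ge0//=; exact: lee_pmul.
  - rewrite avg_ge0/=; apply: le_avg => // x; exact: normc_cut.
pose ks : Rdn R d m.+1 -> R[i] := fun x => \sum_(s \in [set s : int | mu < s < nu]) Ks s x.
pose A n : set (Rdn R d m.+1) := [set x | forall i, D n i (tnth x i)].
have mks : cmeasurable ks.
  have fA := finite_int_itv mu nu.
  rewrite /ks; under eq_fun do rewrite fsbig_finite//=.
  exact: cmeasurable_sum.
have mA n : measurable (A n).
  have -> : A n = \bigcap_(i in [set: 'I_m.+1]) ((fun x => tnth x i) @^-1` D n i).
    by apply/seteqP; split=> [x xA i _|x xA i]; exact: xA.
  apply: fin_bigcap_measurable => [|i _]; first exact: finite_finset.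
  by rewrite -[X in measurable X]setTI; exact: measurable_tnth.
have cA x : exists N, forall n, (N <= n)%N -> A n x.
  exists (Num.bound (\sum_i normc (f i (tnth x i)))) => n Nn i.
  rewrite /D/=; apply: (@le_trans _ _ (\sum_i normc (f i (tnth x i)))).
    by rewrite (bigD1 i)//= lerDl sumr_ge0// => j _; exact: normc_ge0.
  apply: ltW; apply: lt_le_trans (archi_boundP _) _.
    by apply: sumr_ge0 => j _; exact: normc_ge0.
  by rewrite ler_nat.
have mG : cmeasurable (fun x => ks x * tensor f x).
  by apply: cmeasurableM => //; exact: cmeasurable_tensor.
have GE n : trunc_form Ks mu nu (F n) =
    cintegral (lebn d m.+1) (cut (A n) (fun x => ks x * tensor f x)).
  apply: eq_cintegral => x; rewrite /cut; case: ifPn => [/set_mem xA|/negP nA].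
    congr (_ * _); apply: eq_bigr => i _.
    by rewrite /F cutT//; exact: xA.
  have [i ni] : exists i, ~ D n i (tnth x i).
    by apply/existsNP => h; apply: nA; exact/mem_set.
  by rewrite /tensor (bigD1 i)//= /F cutF// mul0r mulr0.
have GI n : normc (cintegral (lebn d m.+1)
    (cut (A n) (fun x => ks x * tensor f x))) <= Cst * B by rewrite -GE.
have part (g : R[i] -> R) : measurable_fun setT (fun x => g (ks x * tensor f x)) ->
  g 0 = 0 ->
  (forall n, `|\int[lebn d m.+1]_x g (cut (A n) (fun x => ks x * tensor f x) x)| <= Cst * B) ->
  `|\int[lebn d m.+1]_x g (ks x * tensor f x)| <= Cst * B.
  move=> mg g0 hg; apply: (Rintegral_cut_le mg mA cA) => n.
  have := hg n; congr (`|_| <= _); apply: eq_Rintegral => x _.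
  by rewrite patchE /cut; case: ifP.
rewrite -EFinM lee_fin (le_trans (normc_le_ReIm _))// -mulrA mulr_natl mulr2n.
apply: lerD.
  apply: (part (@complex.Re R)) => //; first exact: mG.1.
  by move=> n; apply: le_trans (normr_Re_le _) (GI n).
apply: (part (@complex.Im R)) => //; first exact: mG.2.
by move=> n; apply: le_trans (normr_Im_le _) (GI n).
Qed.

End sparse_domination.

Unset Implicit Arguments.

Theorem theorem2 (R : realType) (m d : nat) (m_gt0 : (0 < m)%N)
    (d_gt0 : (0 < d)%N) :
  exists c eta : R, [/\ 0 < c, 0 < eta < 1 &
  forall (T : ('I_m -> Rd R d -> R[i]) -> Rd R d -> R[i])
    (K : Rdn R d m.+1 -> R[i]) (Ks : int -> Rdn R d m.+1 -> R[i])
    (r : 'I_m -> \bar R) (alpha : \bar R)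
    (p : 'I_m.+1 -> \bar R) (CL : R),
  (forall i, (1 <= r i)%E) -> (1 <= alpha)%E ->
  (\sum_(i < m) (r i)^-1 = alpha^-1)%E ->
  multilinear_on r T -> bounded_on r alpha T ->
  kernel_of T K -> kernel_decomposition K Ks ->
  (exists q : \bar R, (1 <= q)%E /\ (kernel_size Ks q < +oo)%E) ->
  (CT Ks r alpha < +oo)%E ->
  (forall j, (1 <= p j)%E) -> 0 < CL ->
  (forall (mu nu : int) (D P : set (cube R d)) (Q : cube R d),
     mu < nu -> dyadic_lattice D -> stopping_collection D P Q ->
     forall (j : 'I_m.+1) (g : 'I_m.+1 -> Rd R d -> R[i]),
       (forall i : 'I_m.+1, (i < j)%N -> in_Y P +oo%E (g i)) ->
       in_Xdot P (p j) (g j) ->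
       (forall i : 'I_m.+1, (j < i)%N -> in_Y P (p i) (g i)) ->
       ((normc (stopping_form Ks mu nu P Q g))%:E <=
          CL%:E * vol Q *
          (\prod_(i < m.+1 | (i < j)%N) Ynorm P +oo (g i)) *
          Ynorm P (p j) (g j) *
          (\prod_(i < m.+1 | (j < i)%N) Ynorm P (p i) (g i)))%E) ->
  forall f : 'I_m.+1 -> Rd R d -> R[i],
    (forall j, in_Lp (leb d) (p j) (f j) /\ compactly_supported (f j)) ->
    (ereal_sup [set (normc (trunc_form Ks munu.1 munu.2 f))%:E
                | munu in [set munu : int * int | (munu.1 < munu.2)%R]] <=
     c%:E * (CT Ks r alpha + CL%:E) *
     ereal_sup [set PSF S p f | S in [set S | sparse eta S]])%E].
Proof.
exists (2 * @step_const R d m), (@sparse_const R d); split.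
- by rewrite mulr_gt0// step_const_gt0.
- exact: sparse_const_bound.
move=> T K Ks r alpha p CL r1 a1 sr _ _ _ [mKs supp_Ks _] Ksize CToo p1 CL0 est f fp.
apply: ge_ereal_sup => _ [[mu nu] /= munu <-].
have CTE : CT Ks r alpha = (fine (CT Ks r alpha))%:E.
  by rewrite fineK// ge0_fin_numE// (CT_ge0 r1 a1).
rewrite CTE -EFinD -EFinM -mulrA.
exact: (trunc_form_le_sparse d_gt0 mKs supp_Ks Ksize r1 a1 sr CToo p1 CL0 est munu fp).
Qed.
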